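(* Let $x\in X$ be such that $g(x,0)<0$, and assume that either the set $\{z\in\mathbb{R}^m\mid g(x,z)\le0\}$ is bounded, or there exists $l>0$ such that $C_l(x)=X$. Assume in addition that $$\#\,\partial^C_xe(x,v)=1\quad\text{for }\mu_\zeta\text{-a.e. }v\in\mathbb{S}^{m-1}.\qquad(\star)$$ Then $\varphi$ is strictly differentiable at $x$ and $$\nabla\varphi(x)=\int_{v\in\mathbb{S}^{m-1}}\nabla_xe(x,v)\,d\mu_\zeta(v).$$ Consequently, if $X$ is finite-dimensional and $(\star)$ holds true (with $x$ replaced by $x'$) for all $x'$ in some neighborhood of $x$, then $\varphi$ is even continuously differentiable at $x$.
   Context: Setting. $X$ is a real reflexive separable Banach space with dual $X^*$; $\mathbb{B}_r(x)$ is the closed ball in $X$. The function $g:X\times\mathbb{R}^m\to\mathbb{R}$ is locally Lipschitzian in both arguments jointly, and $g(x,\cdot)$ is convex for every $x$. $\xi\sim\mathcal{N}(0,\Sigma)$ is an $m$-dimensional Gaussian random vector, $\Sigma$ a positive definite correlation matrix, $\Sigma=LL^T$ with $L$ a non-singular $m\times m$ matrix. $\varphi:X\to\mathbb{R}$, $\varphi(x):=\mathbb{P}(g(x,\xi)\le 0)$. $\mathbb{S}^{m-1}$ is the Euclidean unit sphere of $\mathbb{R}^m$, $\mu_\zeta$ the uniform probability measure on it, $\mu_\eta$ the one-dimensional Chi-distribution with $m$ degrees of freedom. $e(x,v):=\mu_\eta(\{r\ge 0 \mid g(x,rLv)\le 0\})$ for $(x,v)\in X\times\mathbb{S}^{m-1}$.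 One has $\varphi(x)=\int_{\mathbb{S}^{m-1}}e(x,v)\,d\mu_\zeta(v)$. For $x\in X$, $l>0$, $$C_l(x):=\Big\{h\in X \,\Big|\, g^\circ(\cdot,z)(y;h)\le l\|z\|^{-m}e^{\frac{\|z\|^2}{2\|L\|^2}}\|h\|\ \ \forall y\in\mathbb{B}_{1/l}(x),\ \forall z\in\mathbb{R}^m,\ \|z\|\ge l\Big\},$$ where $\|z\|$ is the Euclidean norm, $\|L\|$ the induced operator norm. For a locally Lipschitzian $f$, $f^\circ(\bar x;h)=\limsup_{x\to\bar x,\,t\downarrow0}\frac{f(x+th)-f(x)}{t}$ is Clarke's directional derivative and $\partial^Cf(\bar x)=\{x^*\in X^*\mid\langle x^*,h\rangle\le f^\circ(\bar x;h)\ \forall h\in X\}$ Clarke's subdifferential. $\partial^C_xe(x,v)$ is the Clarke subdifferential of $e(\cdot,v)$ at $x$ (under the hypotheses, each $e(\cdot,v)$ is locally Lipschitzian near $x$). $\#A$ is the cardinality of $A$. Strict differentiability is in Clarke's sense: $f$ is strictly differentiable at $x$ with derivative $\nabla f(x)\in X^*$ if for each $h\in X$, $\lim_{x'\to x,\,t\downarrow0}\frac{f(x'+th)-f(x')}{t}=\langle\nabla f(x),h\rangle$, the convergence being uniform for $h$ in compact sets. For $v$ with $\#\partial_x^Ce(x,v)=1$, $\nabla_xe(x,v)$ denotes the (strict) derivative of $e(\cdot,v)$ at $x$, i.e. the unique element of $\partial^C_xe(x,v)$. *)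

(* Defs.v *)
From HB Require Import structures.
From mathcomp Require Import all_boot all_order all_algebra.
From mathcomp Require Import all_classical all_reals all_analysis.

Set Implicit Arguments.
Unset Strict Implicit.
Unset Printing Implicit Defensive.

Import Order.TTheory GRing.Theory Num.Theory.
Import numFieldNormedType.Exports.
Local Open Scope card_scope.
Local Open Scope classical_set_scope.
Local Open Scope ring_scope.

Section Banach.
Context {R : realType} (X : normedModType R).

(* The dual X^* is carried by the plain function type X -> R. *)
Definition dual : set (X -> R) := [set p : X -> R | scalar p /\ continuous p].

Definition dual_norm (p : X -> R) : R :=
  sup [set `|p h| | h in [set h : X | `|h| <= 1]].

Definition separable_space : Prop := exists2 D : set X, countable D & dense D.

(* Every bounded linear functional on X^* is the evaluation at a point of X;
   only the values of Psi on [dual] matter. *)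
Definition reflexive_space : Prop :=
  forall Psi : (X -> R) -> R,
    (forall (a : R) (p q : X -> R), dual p -> dual q ->
       Psi (fun h => a * p h + q h) = a * Psi p + Psi q) ->
    (exists C : R, forall p, dual p -> `|Psi p| <= C * dual_norm p) ->
    exists h : X, forall p, dual p -> Psi p = p h.

Definition finite_dimensional : Prop :=
  exists (n : nat) (b : 'I_n -> X),
    forall h : X, exists c : 'I_n -> R, h = \sum_(i < n) c i *: b i.

Definition locally_lipschitz (f : X -> R^o) : Prop :=
  forall x : X, exists (k : R) (U : set X), nbhs x U /\ k.-lipschitz_U f.

(* Clarke's directional derivative, as an extended real. *)
Definition clarke_deriv (f : X -> R) (x h : X) : \bar R :=
  limf_esup (fun p : X * R => ((f (p.1 + p.2 *: h) - f p.1) / p.2)%:E)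
            (filter_prod (nbhs x) 0^'+).

Definition clarke_subdiff (f : X -> R) (x : X) : set (X -> R) :=
  dual `&` [set p | forall h, ((p h)%:E <= clarke_deriv f x h)%E].

(* The unique Clarke subgradient; the zero functional when the
   subdifferential is not a singleton. *)
Definition clarke_grad (f : X -> R) (x : X) : X -> R :=
  xget (fun=> 0) [set p | clarke_subdiff f x = [set p]].

(* Singletons being compact, this contains the convergence for each h. *)
Definition strict_derivative (f : X -> R) (x : X) (p : X -> R) : Prop :=
  dual p /\
  forall K : set X, compact K -> forall eps : R, 0 < eps ->
    \forall y \near x & t \near 0^'+,
      forall h, K h -> `|(f (y + t *: h) - f y) / t - p h| < eps.

(* f is of class C^1 on a neighbourhood of x: y |-> 'd f y is norm-continuous
   into X^*. *)
Definition continuously_differentiable_at (f : X -> R^o) (x : X) : Prop :=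
  \forall y \near x, differentiable f y /\
    (fun z : X => dual_norm (fun h => 'd f z h - 'd f y h)) @ y --> (0 : R).

(* p is the X^*-valued integral of F over S. For X reflexive and separable X^*
   is separable, so by Pettis' theorem a weakly measurable F with integrable
   norm is Bochner integrable, and its integral is determined by duality. *)
Definition dual_integral {d : measure_display} {T : measurableType d}
    (mu : {measure set T -> \bar R}) (S : set T) (F : T -> X -> R)
    (p : X -> R) : Prop :=
  mu.-integrable S (fun v => (dual_norm (F v))%:E) /\
  forall h, mu.-integrable S (fun v => (F v h)%:E) /\
            p h = \int[mu]_(v in S) F v h.

End Banach.

Section Euclidean.
Context {R : realType}.

(* R^m with its Borel sigma-algebra. *)
Definition borel_cV (m : nat) := g_sigma_algebraType (@open 'cV[R]_m).

(* The library norm on 'cV[R]_m is the sup norm. *)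
Definition enorm {m : nat} (z : 'cV[R]_m) : R :=
  Num.sqrt (\sum_(i < m) z i 0 ^+ 2).

Definition opnorm {m : nat} (A : 'M[R]_m) : R :=
  sup [set enorm (A *m v) | v in [set v : 'cV[R]_m | enorm v <= 1]].

Definition sphere {m : nat} : set 'cV[R]_m := [set v | enorm v = 1].

(* The uniform distribution on the sphere is the only Borel probability
   carried by it and invariant under the orthogonal group. *)
Definition uniform_on_sphere (m : nat) (mu : probability (borel_cV m) R) :=
  mu sphere = 1%E /\
  forall Q : 'M[R]_m, Q *m Q^T = 1%:M ->
    forall A : set (borel_cV m), measurable A ->
      mu [set v : 'cV[R]_m | A (Q *m v)] = mu A.

Definition correlation_matrix (m : nat) (Sigma : 'M[R]_m) : Prop :=
  [/\ Sigma^T = Sigma,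
      forall a : 'cV[R]_m, a != 0 -> 0 < (a^T *m Sigma *m a) 0 0 &
      forall i, Sigma i i = 1].

(* Independent N(0, 1) coordinates. *)
Definition standard_normal (m : nat) (gamma : probability (borel_cV m) R) :=
  forall A : 'I_m -> set R, (forall i, measurable (A i)) ->
    gamma [set z : 'cV[R]_m | forall i, A i (z i 0)] =
    (\prod_(i < m) fine (normal_prob 0 1 (A i)))%:E.

(* N(0, Sigma) is the law of M *m zeta with Sigma = M M^T and zeta standard
   normal; it does not depend on the choice of M. *)
Definition centered_normal (m : nat) (Sigma : 'M[R]_m)
    (nu : set (borel_cV m) -> \bar R) : Prop :=
  exists (M : 'M[R]_m) (gamma : probability (borel_cV m) R),
    [/\ Sigma = M *m M^T, standard_normal gamma &
        forall B : set (borel_cV m), measurable B ->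
          nu B = gamma [set z : 'cV[R]_m | B (M *m z)]].

(* The normalizing integral is 2 `^ (m / 2 - 1) * Gamma (m / 2). *)
Definition chi_pdf (m : nat) (r : R) : R :=
  let f (s : R) := s ^+ m.-1 * expR (- (s ^+ 2 / 2)) in
  if 0 <= r then f r / \int[lebesgue_measure]_(s in `[0, +oo[) f s else 0.

Definition chi_prob (m : nat) (A : set R) : \bar R :=
  (\int[lebesgue_measure]_(r in A) (chi_pdf m r)%:E)%E.

End Euclidean.

Section ProbabilityFunction.
Context {R : realType} {X : normedModType R} {m : nat}.
Variables (g : X -> 'cV[R]_m -> R) (L : 'M[R]_m).

Definition prob_fun {d : measure_display} {T : measurableType d}
    (P : probability T R) (xi : T -> 'cV[R]_m) (x : X) : R :=
  fine (P [set w | g x (xi w) <= 0]).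

Definition radial_prob (x : X) (v : 'cV[R]_m) : R :=
  fine (chi_prob m [set r : R | 0 <= r /\ g x (r *: (L *m v)) <= 0]).

Definition nice_directions (l : R) (x : X) : set X :=
  [set h : X | forall y : X, closed_ball x l^-1 y ->
     forall z : 'cV[R]_m, l <= enorm z ->
       (clarke_deriv (g ^~ z) y h <=
        (l * enorm z ^- m * expR (enorm z ^+ 2 / (2 * opnorm L ^+ 2))
         * `|h|)%:E)%E].

Definition ae_single_subgradient (mu : probability (borel_cV m) R) (x : X) :=
  {ae mu, forall v : 'cV[R]_m, sphere v ->
     clarke_subdiff (radial_prob ^~ v) x #= `I_1}.

End ProbabilityFunction.

(* Main.v *)
(* A Gaussian vector is a uniform direction v times a Chi-distributed radius, so
   phi(y) is the integral of e(y, v) over the sphere. This polar decomposition is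
   obtained by comparing integrals of Gaussian bumps, which determine a law: for
   a fixed direction the orthogonal group averages the bump over the sphere, and
   the law of the radius follows from the behaviour of the Gaussian under dilations.

   Along a ray the sublevel set of g(y, .) is an interval [0, r] by convexity. As
   g(x, 0) < 0, the slope at r is at least of order 1 / r, so r moves by at most r
   times the increment of g in y. In the unbounded case this increment grows at
   most like the inverse of the Chi density, which compensates it. Hence e(., v)
   is Lipschitz near x uniformly in v.

   Clarke's directional derivative of phi is then at most the integral of those of
   e(., v), by dominated convergence. Under (star) these are linear for almost
   every v, by the Hahn-Banach theorem; and a locally Lipschitz function whose
   directional derivative lies below a linear functional p is strictly
   differentiable with derivative p. In finite dimension the unit ball is compact,
   so strict derivatives depend continuously on the point. *)

Require Import Defs.
From HB Require Import structures.
From mathcomp Require Import all_boot all_order all_algebra.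
From mathcomp Require Import all_classical all_reals all_analysis.
From mathcomp Require Import measurable_realfun ring lra.

Set Implicit Arguments.
Unset Strict Implicit.
Unset Printing Implicit Defensive.

Import Order.TTheory GRing.Theory Num.Theory.
Import numFieldNormedType.Exports.
Local Open Scope classical_set_scope.
Local Open Scope ring_scope.

Import HBNNSimple.

(** * Gaussian bumps and the standard normal law *)

(** The Gaussian law is given by its values on boxes and the uniform law by its mass and invariance,
    so neither offers a density on $\mathbb{R}^m$ in which to pass to polar coordinates. Bumps take
    its place: their Gaussian integrals are explicit, and on the sphere they depend on scalar
    products only. The normalizing constant of the Chi density is not computed; it is forced by
    total mass one.

    The exponent in $C_l(x)$ is what closes the far estimate: for $z=rLv$ one has $\|z\|\le r\|L\|$,
    so the growth bound is at most a constant times $r^{-m}e^{r^2/2}$. The end of the ray moves by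
    at most about $r$ times that, where the density is of order $r^{m-1}e^{-r^2/2}$.

    In the integral step, the directional derivative is an uncountable upper limit; its
    measurability in $v$ comes from suprema over a countable dense set. Strict differentiability
    asks for uniformity on compact sets, which follows from linearity of the directional derivative
    only together with the Lipschitz bound on quotients. *)

Lemma ge0_integral_weight d d' (T : measurableType d) (T' : measurableType d')
    (R : realType) (mu : {measure set T -> \bar R})
    (nu : {measure set T' -> \bar R}) (G : T -> R) (phi : T -> T')
    (c : R) :
  measurable_fun setT G -> (forall x, 0 <= G x) -> measurable_fun setT phi ->
  (0 <= c) ->
  (forall A, measurable A ->
     (\int[mu]_x ((G x)%:E * (\1_A (phi x))%:E) = c%:E * nu A)%E) ->
  forall f : T' -> \bar R, measurable_fun setT f -> (forall y, 0 <= f y)%E ->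
  (\int[mu]_x ((G x)%:E * f (phi x)) = c%:E * \int[nu]_y f y)%E.
Proof.
move=> mG G0 mphi c0 H.
(* Linearity carries the identity from indicators to simple functions; monotone approximation of [f]
   then finishes. The factor [c] is there because in the induction on coordinates the image of the
   weight is only a multiple of a probability. *)
have Hs (h : {nnsfun T' >-> R}) :
  (\int[mu]_x ((G x)%:E * (h (phi x))%:E) = c%:E * \int[nu]_y (h y)%:E)%E.
  under eq_integral => x _.
    rewrite fimfunE -fsumEFin// ge0_mule_fsumr; last first.
      by move=> r; exact: nnfun_muleindic_ge0.
    over.
  have mt r : measurable_fun setT
      (fun x => ((G x)%:E * (r * \1_(h @^-1` [set r]) (phi x))%:E)%E).
    apply: emeasurable_funM; apply/measurable_EFinP => //.
    apply: measurable_funM => //.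
    by apply: (measurableT_comp (f := \1_(h @^-1` [set r]) : T' -> R)).
  rewrite ge0_integral_fsum//; last first.
    move=> r x _; apply: mule_ge0; first by rewrite lee_fin.
    exact: nnfun_muleindic_ge0.
  rewrite integralT_nnsfun sintegralE ge0_mule_fsumr; last first.
    by move=> r; exact: nnsfun_mulemu_ge0.
  apply: eq_fsbigr => r; rewrite inE => -[y _ <-{r}].
  rewrite muleCA -H//.
  rewrite -ge0_integralZl//.
  - by apply: eq_integral => x _; rewrite EFinM muleCA.
  - apply: emeasurable_funM; apply/measurable_EFinP => //.
    by apply: (measurableT_comp (f := \1_(h @^-1` _) : T' -> R)).
  - by move=> x _; rewrite mule_ge0// lee_fin.
  - by rewrite lee_fin.
move=> f mf f0.
pose g := nnsfun_approx measurableT mf.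
have gcvg y : (g n y)%:E @[n --> \oo] --> f y by exact: cvg_nnsfun_approx.
have nd y m n : (m <= n)%N -> ((g m y)%:E <= (g n y)%:E)%E.
  by move=> mn; rewrite lee_fin; exact/lefP/nd_nnsfun_approx.
have mgp n : measurable_fun setT (fun x => (g n (phi x))%:E).
  by apply/measurable_EFinP; apply: measurableT_comp.
transitivity (limn (fun n => \int[mu]_x ((G x)%:E * (g n (phi x))%:E)))%E.
  rewrite -monotone_convergence//.
  - apply: eq_integral => x _; apply/esym/cvg_lim => //.
    by apply: cvgeZl.
  - by move=> n; apply: emeasurable_funM => //; exact/measurable_EFinP.
  - by move=> n x _; rewrite mule_ge0// lee_fin.
  - by move=> x _ m n mn; apply: lee_wpmul2l; [by rewrite lee_fin|exact: nd].
under eq_fun do rewrite Hs.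
apply/cvg_lim => //; apply: cvgeZl => //.
rewrite [X in _ --> X](_ : _ = \int[nu]_y (limn (fun n => (g n y)%:E)))%E; last first.
  by apply: eq_integral => y _; apply/esym/cvg_lim => //.
apply: cvg_monotone_convergence => //.
- by move=> n; exact/measurable_EFinP.
- by move=> n x _; rewrite lee_fin.
- by move=> x _ m n mn; apply: nd.
Qed.

Lemma integral_indicT d (T : measurableType d) (R : realType)
    (mu : {measure set T -> \bar R}) (A : set T) : measurable A ->
  (\int[mu]_x (\1_A x)%:E = mu A)%E.
Proof. by move=> mA; rewrite integral_indic// setIT. Qed.

Lemma continuous_borel_measurable (R : realType) (m : nat) (f : 'cV[R]_m -> R) :
  continuous f -> measurable_fun [set: borel_cV m] (f : borel_cV m -> R).
Proof.
move=> /continuousP cf; apply: (measurability _ (RGenOpens.measurableE R)).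
move=> _ [_ [a [b ->]]] <-; rewrite setTI; apply: sub_sigma_algebra.
exact/cf/interval_open.
Qed.

Lemma measurable_fun_coord (R : realType) (m : nat) (i : 'I_m) :
  measurable_fun [set: borel_cV m] (fun z : borel_cV m => (z : 'cV[R]_m) i 0).
Proof.
apply: (@continuous_borel_measurable R m (fun z => z i 0)).
exact: coord_continuous.
Qed.

Lemma ge0_integral_unit_itv d (T : measurableType d) (R : realType)
    (P : probability T R) (f : T -> R) :
  measurable_fun setT f -> (forall x, 0 <= f x <= 1) ->
  (0 <= \int[P]_x (f x)%:E <= 1)%E.
Proof.
move=> mf f01; apply/andP; split.
  by apply: integral_ge0 => x _; rewrite lee_fin; case/andP: (f01 x).
rewrite (_ : 1%E = \int[P]_x (cst 1%E x))%E; last first.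
  by rewrite integral_cst// mul1e; exact/esym/probability_setT.
apply: ge0_le_integral => //.
- by move=> x _; rewrite lee_fin; case/andP: (f01 x).
- exact/measurable_EFinP.
- by move=> x _; rewrite lee_fin; case/andP: (f01 x).
Qed.

Lemma integral_unit_itv_fin_num d (T : measurableType d) (R : realType)
    (P : probability T R) (f : T -> R) :
  measurable_fun setT f -> (forall x, 0 <= f x <= 1) ->
  (\int[P]_x (f x)%:E)%E \is a fin_num.
Proof.
move=> mf f01; have /andP[h0 h1] := ge0_integral_unit_itv P mf f01.
by rewrite ge0_fin_numE// (le_lt_trans h1)// ltry.
Qed.

(** [standard_normal] speaks of boxes, that is, of products of indicators. The coordinates are
    released one at a time: with the others frozen, both sides are measures of the set in one
    coordinate, so [ge0_integral_weight] turns its indicator into a function. *)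
Lemma integral_standard_normal_prod (R : realType) (m : nat)
    (gamma : probability (borel_cV m) R) (f : 'I_m -> R -> R) :
  standard_normal gamma ->
  (forall i, measurable_fun setT (f i)) -> (forall i t, 0 <= f i t <= 1) ->
  (\int[gamma]_z (\prod_(i < m) f i ((z : 'cV[R]_m) i 0))%:E =
   (\prod_(i < m) fine (\int[normal_prob 0 1]_t (f i t)%:E))%:E)%E.
Proof.
move=> Hg.
(* Coordinates of index at least [k] carry indicators: [k = 0] is the definition of the standard
   normal law, [k = m] is the claim. *)
suff H k : forall f : 'I_m -> R -> R,
  (forall i, measurable_fun setT (f i)) -> (forall i t, 0 <= f i t <= 1) ->
  (forall i : 'I_m, (k <= i)%N ->
     exists2 A : set R, measurable A & f i = \1_A) ->
  (\int[gamma]_z (\prod_(i < m) f i ((z : 'cV[R]_m) i 0))%:E =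
   (\prod_(i < m) fine (\int[normal_prob 0 1]_t (f i t)%:E))%:E)%E.
  move=> mf f01; apply: (H m) => // i.
  by rewrite leqNgt ltn_ord.
elim: k {f} => [f mf f01 /(_ _ isT) fA|k IH f mf f01 fA].
  have [A mA fAE] : exists2 A : 'I_m -> set R,
      (forall i, measurable (A i)) & forall i, f i = \1_(A i).
    exists (fun i => sval (cid2 (fA i))) => i; first exact: (s2valP (cid2 (fA i))).
    exact: (s2valP' (cid2 (fA i))).
  pose B := [set z : borel_cV m | forall i, A i ((z : 'cV[R]_m) i 0)].
  have mB : measurable B.
    rewrite (_ : B = \bigcap_(i in [set: 'I_m])
        ((fun z : borel_cV m => (z : 'cV[R]_m) i 0) @^-1` (A i))).
      apply: fin_bigcap_measurable; first exact: finite_finset.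
      move=> i _; rewrite -[X in measurable X]setTI.
      exact: measurable_fun_coord.
    by apply/seteqP; split => z Bz i; [move=> _; exact: Bz|exact: (Bz i)].
  rewrite (eq_integral (fun z => (\1_B z)%:E)); last first.
    move=> z _; congr (_%:E); rewrite indicE.
    under eq_bigr do rewrite fAE indicE.
    case: (boolP (z \in B)) => [|/negP]; rewrite inE => Bz.
      by rewrite big1// => i _; rewrite mem_set//; exact: Bz.
    have [i nAi] : exists i, ~ A i ((z : 'cV[R]_m) i 0) by exact/existsNP.
    by rewrite (bigD1 i)//= memNset// mul0r.
  rewrite integral_indicT// [LHS](Hg A)//; congr (_%:E).
  apply: eq_bigr => i _; rewrite fAE.
  by congr fine; apply/esym/integral_indicT; exact: mA.
have [mk|km] := leqP m k.
  by apply: IH => // i ki; have := leq_trans mk ki; rewrite leqNgt ltn_ord.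
pose j := Ordinal km.
(* Coordinate [j] is being released: [G] is the weight contributed by the other coordinates and [c]
   the product of their integrals. *)
pose c := \prod_(i < m | i != j) fine (\int[normal_prob 0 1]_t (f i t)%:E)%E.
pose G (z : borel_cV m) := \prod_(i < m | i != j) f i ((z : 'cV[R]_m) i 0).
have mG : measurable_fun setT G.
  rewrite (_ : G = (fun z => \prod_(i <- enum 'I_m)
      if i != j then f i ((z : 'cV[R]_m) i 0) else 1)); last first.
    by apply/funext => z; rewrite /G big_mkcond big_enum.
  apply: measurable_prod => i _; case: (i != j) => //.
  exact: measurableT_comp (mf i) (measurable_fun_coord i).
have IN i : (\int[normal_prob 0 1]_t (f i t)%:E)%E \is a fin_num.
  exact: (integral_unit_itv_fin_num (normal_prob 0 1) (mf i) (f01 i)).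
rewrite [RHS](_ : _ = c%:E * \int[normal_prob 0 1]_t (f j t)%:E)%E; last first.
  by rewrite (bigD1 j)//= EFinM fineK// muleC.
apply: (etrans _ (@ge0_integral_weight _ _ _ _ _ gamma (normal_prob 0 1) G
  (fun z : borel_cV m => (z : 'cV[R]_m) j 0) c mG _ _ _ _
  (fun t => (f j t)%:E) _ _)).
- by apply: eq_integral => z _; rewrite (bigD1 j)//= -EFinM mulrC.
- by move=> z; apply: prodr_ge0 => i _; case/andP: (f01 i ((z : 'cV[R]_m) i 0)).
- exact: measurable_fun_coord.
- apply: prodr_ge0 => i _; apply: fine_ge0; apply: integral_ge0 => t _.
  by rewrite lee_fin; case/andP: (f01 i t).
- move=> A mA.
  pose f' i := if i == j then \1_A else f i : R -> R.
  have fj : f' j = \1_A by rewrite /f' eqxx.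
  have fN i : i != j -> f' i = f i by rewrite /f' => /negbTE ->.
  have := IH f'; rewrite (bigD1 j)//= fj => IH'.
  transitivity (\int[gamma]_z (\prod_(i < m) f' i ((z : 'cV[R]_m) i 0))%:E)%E.
    apply: eq_integral => z _; rewrite (bigD1 j)//= fj -EFinM mulrC.
    by congr (_ * _)%:E; apply: eq_bigr => i ij; rewrite fN.
  rewrite IH'.
  + rewrite integral_indicT// EFinM muleC; congr (_ * _)%E.
      by congr (_%:E); apply: eq_bigr => i ij; rewrite fN.
    by rewrite fineK// fin_num_measure.
  + by move=> i; rewrite /f'; case: ifP => // _; exact: measurable_indic.
  + move=> i t; rewrite /f'; case: ifP => // _; rewrite indicE.
    by case: (_ \in _); rewrite ?ler01 ?lexx.
  + move=> i; rewrite leq_eqVlt => /orP[/eqP ki|ki].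
      by exists A => //; rewrite -fj; congr f'; apply/val_inj.
    have ij : i != j by apply/eqP => ij; rewrite ij ltnn in ki.
    by rewrite fN//; exact: fA.
- by apply/measurable_EFinP; exact: mf.
- by move=> t; rewrite lee_fin; case/andP: (f01 j t).
Qed.
Definition sqnorm {R : realType} {m : nat} (z : 'cV[R]_m) : R :=
  \sum_(i < m) z i 0 ^+ 2.

Lemma ge0_integral_normal_prob (R : realType) (f : R -> R) :
  measurable_fun setT f -> (forall t, 0 <= f t) ->
  (\int[normal_prob 0 1]_t (f t)%:E =
   \int[lebesgue_measure]_t (normal_pdf 0 1 t * f t)%:E)%E.
Proof.
move=> mf f0.
have := @ge0_integral_weight _ _ _ _ _ lebesgue_measure (normal_prob 0 1)
  (normal_pdf 0 1) id 1 (measurable_normal_pdf 0 1) (normal_pdf_ge0 0 1)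
  (@measurable_id _ _ _) ler01 _ (fun t => (f t)%:E).
rewrite mul1e => <-//.
- move=> A mA; rewrite mul1e; apply/esym.
  rewrite [LHS]integral_mkcond.
  by apply: eq_integral => t _; rewrite epatch_indic.
- by apply/measurable_EFinP; exact: mf.
Qed.

(** Completing the square: the normal density times the bump is a multiple of the normal density
    with variance [1 / (1 + 2 * s)] and mean [2 * s * b / (1 + 2 * s)]. *)
Lemma integral_normal_bump (R : realType) (s b : R) : 0 <= s ->
  (\int[normal_prob 0 1]_t (expR (- (s * (t - b) ^+ 2)))%:E =
   ((Num.sqrt (1 + 2 * s))^-1 * expR (- (s * b ^+ 2 / (1 + 2 * s))))%:E)%E.
Proof.
move=> s0.
pose D := 1 + 2 * s; have D0 : 0 < D by rewrite /D; nra.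
pose sg := (Num.sqrt D)^-1.
have sg0 : 0 < sg by rewrite invr_gt0 sqrtr_gt0.
have sg2 : sg ^+ 2 = D^-1 by rewrite /sg exprVn sqr_sqrtr// ltW.
rewrite ge0_integral_normal_prob//; last first.
  apply: measurableT_comp => //; apply: measurableT_comp => //.
  apply: measurable_funM => //; apply: measurable_funX.
  exact: measurable_funB.
transitivity (\int[lebesgue_measure]_t ((sg * expR (- (s * b ^+ 2 / D)))%:E *
    (normal_pdf (2 * s * b / D) sg t)%:E))%E.
  apply: eq_integral => t _; rewrite -EFinM; congr (_%:E).
  rewrite !normal_pdfE ?oner_eq0 ?gt_eqF//.
  have -> : normal_peak 1 = sg * normal_peak sg.
    rewrite /normal_peak -!mulrnAr expr1n mul1r sqrtrM ?sqr_ge0//.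
    by rewrite sqrtr_sqr gtr0_norm// invfM mulrA divff ?mul1r// gt_eqF.
  rewrite /normal_fun -!mulrA -expRD [in RHS](mulrCA (expR _)) -expRD.
  congr (_ * (_ * expR _)); rewrite sg2 /D; field.
  by rewrite gt_eqF.
rewrite ge0_integralZl//.
- by rewrite integral_normal_pdf mule1.
- by apply/measurable_EFinP; exact: measurable_normal_pdf.
- by move=> t _; rewrite lee_fin normal_pdf_ge0.
- by rewrite lee_fin mulr_ge0 ?expR_ge0// ltW.
Qed.

Lemma integral_standard_normal_bump (R : realType) (m : nat)
    (gamma : probability (borel_cV m) R) (s : R) (b : 'cV[R]_m) :
  standard_normal gamma -> 0 <= s ->
  (\int[gamma]_z (expR (- (s * sqnorm ((z : 'cV[R]_m) - b))))%:E =
   ((Num.sqrt (1 + 2 * s))^-1 ^+ m *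
     expR (- (s * sqnorm b / (1 + 2 * s))))%:E)%E.
Proof.
move=> Hg s0.
transitivity (\int[gamma]_z (\prod_(i < m)
    expR (- (s * ((z : 'cV[R]_m) i 0 - b i 0) ^+ 2)))%:E)%E.
  apply: eq_integral => z _; rewrite -expR_sum; congr (expR _)%:E.
  rewrite /sqnorm mulr_sumr -sumrN; apply: eq_bigr => i _.
  by rewrite !mxE.
rewrite (@integral_standard_normal_prod _ _ _
  (fun i t => expR (- (s * (t - b i 0) ^+ 2))) Hg).
- congr (_%:E); under eq_bigr do rewrite integral_normal_bump//=.
  rewrite big_split /= big_const_ord iter_mulr_1 -expR_sum; congr (_ * expR _).
  by rewrite /sqnorm mulr_sumr mulr_suml -sumrN.
- move=> i; apply: measurableT_comp => //; apply: measurableT_comp => //.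
  apply: measurable_funM => //; apply: measurable_funX.
  exact: measurable_funB.
- move=> i t; rewrite expR_ge0 -[leRHS]expR0 ler_expR oppr_le0.
  by rewrite mulr_ge0// sqr_ge0.
Qed.

Lemma measurable_sqnorm (R : realType) (m : nat) d (T : measurableType d)
    (u : T -> 'cV[R]_m) :
  (forall i, measurable_fun setT (fun x => u x i 0)) ->
  measurable_fun setT (fun x => sqnorm (u x)).
Proof.
move=> mu; apply: measurable_sum => i; exact: measurable_funX.
Qed.

Lemma measurable_coord_comp (R : realType) (m : nat) d (T : measurableType d)
    (Z : T -> borel_cV m) (i : 'I_m) : measurable_fun setT Z ->
  measurable_fun setT (fun x => (Z x : 'cV[R]_m) i 0).
Proof.
by move=> mZ; exact: (measurableT_comp (measurable_fun_coord i) mZ).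
Qed.

Section gaussian_kernel.
Context {R : realType} {m : nat}.
Implicit Types (s : R) (z a : 'cV[R]_m).

(** Two readings of one function. In [a] it is the bump of sharpness [s] around [z], normalized to
    integral 1 against the Gaussian law ([gauss_kernelE]). In [z], as written here, it is a factor
    depending on [a] alone times a bump centred at a dilate of [a]; in this form it can be
    integrated against any measure whose bump integrals are known. *)
Definition gauss_kernel s z a : R :=
  Num.sqrt (1 + 2 * s) ^+ m *
  expR (sqnorm a / 2 -
    2 * s ^+ 2 / (1 + 2 * s) * sqnorm (z - ((1 + 2 * s) / (2 * s)) *: a)).

Lemma gauss_kernel_ge0 s z a : 0 <= gauss_kernel s z a.
Proof. by rewrite mulr_ge0 ?expR_ge0// exprn_ge0// sqrtr_ge0. Qed.

Lemma gauss_kernelE s z a : 0 < s ->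
  gauss_kernel s z a = Num.sqrt (1 + 2 * s) ^+ m *
    expR (s * sqnorm z / (1 + 2 * s)) * expR (- (s * sqnorm (z - a))).
Proof.
move=> s0; rewrite /gauss_kernel -[RHS]mulrA -expRD; congr (_ * expR _).
rewrite /sqnorm !(mulr_sumr, mulr_suml) -!sumrN -!big_split /=.
apply: eq_bigr => i _; rewrite !mxE; field.
by apply/andP; split; apply/eqP; nra.
Qed.

Lemma measurable_gauss_kernel d (T : measurableType d) s
    (Z A : T -> borel_cV m) :
  measurable_fun setT Z -> measurable_fun setT A ->
  measurable_fun setT (fun x => gauss_kernel s (Z x) (A x)).
Proof.
move=> mZ mA; apply: measurable_funM => //; apply: measurableT_comp => //.
apply: measurable_funB; first apply: measurable_funM => //.
  by apply: measurable_sqnorm => i; exact: measurable_coord_comp.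
apply: measurable_funM => //; apply: measurable_sqnorm => i.
under eq_fun do rewrite !mxE.
apply: measurable_funB; first exact: measurable_coord_comp.
by apply: measurable_funM => //; exact: measurable_coord_comp.
Qed.

Lemma integral_gauss_kernel (gamma : probability (borel_cV m) R) s z :
  standard_normal gamma -> 0 < s ->
  (\int[gamma]_a (gauss_kernel s z a)%:E = 1)%E.
Proof.
move=> Hg s0; have D0 : 0 < 1 + 2 * s by nra.
transitivity (\int[gamma]_a ((Num.sqrt (1 + 2 * s) ^+ m *
    expR (s * sqnorm z / (1 + 2 * s)))%:E *
    (expR (- (s * sqnorm ((a : 'cV[R]_m) - z))))%:E))%E.
  apply: eq_integral => a _; rewrite -EFinM gauss_kernelE//.
  congr (_ * expR (- (_ * _)))%:E; apply: eq_bigr => i _.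
  by rewrite !mxE -sqrrN opprB.
rewrite ge0_integralZl//.
- rewrite integral_standard_normal_bump ?ltW// -EFinM; congr (_%:E).
  rewrite mulrACA -expRD subrr expR0 mulr1 -exprMn divff ?expr1n//.
  by rewrite gt_eqF// sqrtr_gt0.
- apply/measurable_EFinP; apply: measurableT_comp => //.
  apply: measurableT_comp => //; apply: measurable_funM => //.
  apply: measurable_sqnorm => i; under eq_fun do rewrite !mxE.
  by apply: measurable_funB => //; exact: measurable_fun_coord.
Qed.

(** An exponential beats a power: the root is at most [3 * n.+1%:R], and the term of degree [m.+1]
    of the exponential series leaves a bound [C / n.+1%:R]. *)
Lemma cvg_gauss_tail (dl : R) : 0 < dl ->
  Num.sqrt (1 + 2 * n.+1%:R) ^+ m * expR (- (n.+1%:R * dl)) @[n --> \oo] --> (0 : R).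
Proof.
move=> dl0.
pose C := 3 ^+ m * (m.+1)`!%:R / dl ^+ m.+1.
apply: (@squeeze_cvgr _ _ _ _ (fun=> 0) (fun n => C * n.+1%:R^-1)).
- near=> n; apply/andP; split.
    by rewrite mulr_ge0 ?expR_ge0// exprn_ge0// sqrtr_ge0.
  have n0 : 0 < n.+1%:R :> R by rewrite ltr0n.
  have n1 : 1 <= n.+1%:R :> R by rewrite ler1n.
  have h1 : Num.sqrt (1 + 2 * n.+1%:R) ^+ m <= (3 * n.+1%:R) ^+ m :> R.
    have h3 : 0 <= 3 * n.+1%:R :> R by rewrite mulr_ge0.
    apply: lerXn2r; rewrite ?nnegrE ?sqrtr_ge0//.
    rewrite -[leRHS]ger0_norm// -sqrtr_sqr ler_wsqrtr//; nra.
  have h2 : (n.+1%:R * dl) ^+ m.+1 / (m.+1)`!%:R <= expR (n.+1%:R * dl).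
    have nd0 : 0 <= n.+1%:R * dl by rewrite mulr_ge0// ltW.
    by apply: le_trans (expR_ge1Dxn m nd0); rewrite lerDr.
  have P0 : 0 < (n.+1%:R * dl) ^+ m.+1 / (m.+1)`!%:R.
    by rewrite divr_gt0 ?ltr0n ?fact_gt0// exprn_gt0// mulr_gt0.
  rewrite expRN.
  apply: (@le_trans _ _ ((3 * n.+1%:R) ^+ m * ((n.+1%:R * dl) ^+ m.+1 / (m.+1)`!%:R)^-1)).
    apply: ler_pM => //; rewrite ?exprn_ge0 ?sqrtr_ge0 ?invr_ge0 ?expR_ge0//.
    by rewrite lef_pV2 ?posrE ?expR_gt0.
  rewrite le_eqVlt; apply/orP; left; apply/eqP.
  rewrite /C !exprMn !exprS; field.
  by rewrite !gt_eqF ?exprn_gt0// ltr0n fact_gt0.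
- exact: cvg_cst.
- rewrite -(mulr0 C); apply: cvgMr; exact: cvg_harmonic.
Unshelve. all: by end_near. Qed.


(** The kernels form an approximate identity. Off the ball of radius [dl], [f] varies by at most 1
    and the kernel is below [M n], which tends to 0; inside, continuity of [f] and the unit mass of
    the kernel suffice. *)
Lemma cvg_gauss_kernel (gamma : probability (borel_cV m) R) (f : 'cV[R]_m -> R)
    (z : 'cV[R]_m) : standard_normal gamma ->
  continuous f -> (forall a, 0 <= f a <= 1) ->
  (\int[gamma]_a (gauss_kernel n.+1%:R z a * f a)%:E @[n --> \oo] -->
    (f z)%:E)%E.
Proof.
move=> Hg cf f01.
have mf := continuous_borel_measurable cf.
have mk n := @measurable_gauss_kernel _ (borel_cV m) n.+1%:R (cst z) id
  (measurable_cst _) (@measurable_id _ _ _).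
have n0 n : 0 < n.+1%:R :> R by rewrite ltr0n.
have kf0 n a : 0 <= gauss_kernel n.+1%:R z a * f a.
  by rewrite mulr_ge0 ?gauss_kernel_ge0//; case/andP: (f01 a).
have mkf n : measurable_fun setT (fun a : borel_cV m =>
    (gauss_kernel n.+1%:R z a * f a)%:E).
  by apply/measurable_EFinP; exact: measurable_funM.
have kfle n : (\int[gamma]_a (gauss_kernel n.+1%:R z a * f a)%:E <= 1)%E.
  rewrite -(integral_gauss_kernel z Hg (n0 n)).
  apply: ge0_le_integral => //.
  - by move=> a _; rewrite lee_fin.
  - by apply/measurable_EFinP.
  - move=> a _; rewrite lee_fin ler_piMr ?gauss_kernel_ge0//.
    by case/andP: (f01 a).
have kfin n : (\int[gamma]_a (gauss_kernel n.+1%:R z a * f a)%:E)%E \is a fin_num.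
  by rewrite ge0_fin_numE ?(le_lt_trans (kfle n)) ?ltry// integral_ge0// => a _; rewrite lee_fin.
apply/fine_cvgP; split; first exact: nearW.
apply/cvgrPdist_le => e e0.
have e20 : 0 < e / 2 by rewrite divr_gt0.
have /cvgrPdist_le/(_ _ e20) /nbhs_ballP[dl /= dl0 Hdl] := cf z.
pose M n := expR (sqnorm z / 2) * (Num.sqrt (1 + 2 * n.+1%:R) ^+ m *
  expR (- (n.+1%:R * (dl ^+ 2)))).
have Mcvg : M n @[n --> \oo] --> (0 : R).
  rewrite -(mulr0 (expR (sqnorm z / 2))); apply: cvgMr; apply: cvg_gauss_tail.
  by rewrite exprn_gt0.
have M0 n : 0 <= M n.
  by rewrite !mulr_ge0 ?expR_ge0// exprn_ge0// sqrtr_ge0.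
have key n a : gauss_kernel n.+1%:R z a * `|f a - f z| <=
    gauss_kernel n.+1%:R z a * (e / 2) + M n.
  have k0 := gauss_kernel_ge0 n.+1%:R z a.
  have [za|za] := pselect (ball z dl a).
    have := Hdl _ za; rewrite distrC => h.
    by rewrite (le_trans (ler_wpM2l k0 h))// lerDl.
  apply: (@le_trans _ _ (gauss_kernel n.+1%:R z a)).
    rewrite ler_piMr// ler_norml; move: (f01 a) (f01 z) => /andP[? ?] /andP[? ?].
    by apply/andP; split; lra.
  rewrite -[leLHS]add0r lerD//; first by rewrite mulr_ge0// ltW.
  rewrite gauss_kernelE// /M mulrCA -mulrA.
  apply: ler_wpM2l; first by rewrite exprn_ge0// sqrtr_ge0.
  apply: ler_pM; rewrite ?expR_ge0//.
    rewrite ler_expR ler_pdivrMr; last by have := n0 n; lra.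
    have : 0 <= sqnorm z by apply: sumr_ge0 => i _; exact: sqr_ge0.
    by have := n0 n; nra.
  rewrite ler_expR lerN2 ler_wpM2l//.
  (* Balls of ['cV[R]_m] are cubes, so leaving one makes a single coordinate large, and hence
     [sqnorm] as well. *)
  have [i hi] : exists i, dl <= `|z i 0 - a i 0|.
    apply: contrapT => /forallNP H; apply: za; split=> // i j.
    by rewrite (ord1 j) /ball /= ltNge; apply/negP; exact: H.
  rewrite /sqnorm (bigD1 i)//= !mxE -[leLHS]addr0 lerD//; last first.
    by apply: sumr_ge0 => k _; exact: sqr_ge0.
  by rewrite -[leRHS]real_normK ?num_real// lerXn2r ?nnegrE// ltW.
have kE n c : 0 <= c ->
    (\int[gamma]_a (gauss_kernel n.+1%:R z a * c + M n)%:E = (c + M n)%:E)%E.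
  move=> c0.
  have kc0 a : [set: borel_cV m] a ->
    (0 <= (gauss_kernel n.+1%:R z a)%:E * c%:E)%E.
    by move=> _; rewrite -EFinM lee_fin mulr_ge0// gauss_kernel_ge0.
  have k0 a : [set: borel_cV m] a -> (0 <= (gauss_kernel n.+1%:R z a)%:E)%E.
    by move=> _; rewrite lee_fin gauss_kernel_ge0.
  have mk' : measurable_fun [set: borel_cV m]
      (fun a => (gauss_kernel n.+1%:R z a)%:E).
    exact/measurable_EFinP.
  have mkc : measurable_fun [set: borel_cV m]
      (fun a => ((gauss_kernel n.+1%:R z a)%:E * c%:E)%E).
    exact: emeasurable_funM.
  have MM a : [set: borel_cV m] a -> (0 <= (M n)%:E)%E by rewrite lee_fin.
  under eq_integral do rewrite EFinD EFinM.
  rewrite ge0_integralD// ge0_integralZr// integral_gauss_kernel// mul1e.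
  by rewrite integral_cst// [X in (_ * X)%E](probability_setT gamma) mule1.
have mkc n c : measurable_fun setT (fun a : borel_cV m =>
    (gauss_kernel n.+1%:R z a * c + M n)%:E).
  by apply/measurable_EFinP; apply: measurable_funD => //; exact: measurable_funM.
have [fz0 fz1] : 0 <= f z /\ f z <= 1 by case/andP: (f01 z).
near=> n.
have HM : M n <= e / 2.
  have : `|0 - M n| <= e / 2 by near: n; move/cvgrPdist_le : Mcvg; exact.
  by rewrite sub0r normrN ger0_norm.
have U : (\int[gamma]_a (gauss_kernel n.+1%:R z a * f a)%:E <=
    (f z + e / 2 + M n)%:E)%E.
  rewrite -kE; last by rewrite addr_ge0// ltW.
  apply: ge0_le_integral => //.
  - by move=> a _; rewrite lee_fin.
  - move=> a _; rewrite lee_fin mulrDr -addrA -lerBlDl -mulrBr.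
    apply: le_trans (key n a); apply: ler_wpM2l; first exact: gauss_kernel_ge0.
    exact: ler_norm.
have Lo : ((f z)%:E <= \int[gamma]_a (gauss_kernel n.+1%:R z a * f a)%:E +
    (e / 2 + M n)%:E)%E.
  rewrite -kE; last exact: ltW.
  have h1 (a : borel_cV m) : [set: borel_cV m] a ->
      (0 <= (gauss_kernel n.+1%:R z a * f a)%:E)%E.
    by move=> _; rewrite lee_fin.
  have h2 (a : borel_cV m) : [set: borel_cV m] a ->
      (0 <= (gauss_kernel n.+1%:R z a * (e / 2) + M n)%:E)%E.
    by move=> _; rewrite lee_fin addr_ge0// mulr_ge0 ?gauss_kernel_ge0// ltW.
  have h3 (a : borel_cV m) : [set: borel_cV m] a ->
      (0 <= (gauss_kernel n.+1%:R z a)%:E)%E.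
    by move=> _; rewrite lee_fin gauss_kernel_ge0.
  have mk' : measurable_fun [set: borel_cV m]
      (fun a => (gauss_kernel n.+1%:R z a)%:E).
    exact/measurable_EFinP.
  rewrite -ge0_integralD// -[leLHS]mul1e -(integral_gauss_kernel z Hg (n0 n)).
  rewrite -ge0_integralZr//.
  apply: ge0_le_integral => //.
  - by move=> a _; rewrite -EFinM lee_fin mulr_ge0 ?gauss_kernel_ge0.
  - exact: emeasurable_funM.
  - exact: emeasurable_funD.
  - move=> a _; rewrite -EFinM -EFinD lee_fin -lerBlDl -mulrBr.
    apply: le_trans (key n a); apply: ler_wpM2l; first exact: gauss_kernel_ge0.
    by rewrite distrC; exact: ler_norm.
move: U Lo; rewrite -(fineK (kfin n)) -EFinD !lee_fin => U Lo.
rewrite ler_norml; apply/andP; split; lra.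
Unshelve. all: by end_near. Qed.

Section smoothing.
Context d (T : measurableType d).
Variables (nu : {sigma_finite_measure set T -> \bar R})
  (gamma : probability (@borel_cV R m) R) (w : T -> R) (Z : T -> @borel_cV R m)
  (f : 'cV[R]_m -> R).
Hypotheses (Hg : standard_normal gamma) (mw : measurable_fun setT w)
  (w0 : forall x, 0 <= w x) (mZ : measurable_fun setT Z)
  (cf : continuous f) (f01 : forall a, 0 <= f a <= 1).

Let F s (p : T * @borel_cV R m) : \bar R :=
  (w p.1 * (gauss_kernel s (Z p.1) p.2 * f p.2))%:E.

Let f0 a : 0 <= f a. Proof. by case/andP: (f01 a). Qed.

Let mF s : measurable_fun setT (F s).
Proof.
apply/measurable_EFinP; apply: measurable_funM.
  exact: measurableT_comp mw (@measurable_fst _ _ _ _).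
apply: measurable_funM.
  apply: measurable_gauss_kernel; last exact: measurable_snd.
  exact: measurableT_comp mZ (@measurable_fst _ _ _ _).
have mf := continuous_borel_measurable cf.
exact: measurableT_comp mf (@measurable_snd _ _ _ _).
Qed.

Let F0 s p : (0 <= F s p)%E.
Proof. by rewrite lee_fin !mulr_ge0// gauss_kernel_ge0. Qed.

(** After Tonelli the weighted measure enters only through its bump integrals, of sharpness
    [2 * s ^+ 2 / (1 + 2 * s)]. *)
Lemma smoothing_swap s : 0 < s ->
  (\int[nu]_x \int[gamma]_a F s (x, a) =
   \int[gamma]_a ((f a * (Num.sqrt (1 + 2 * s) ^+ m * expR (sqnorm a / 2)))%:E *
     \int[nu]_x (w x * expR (- (2 * s ^+ 2 / (1 + 2 * s) *
       sqnorm ((Z x : 'cV[R]_m) - ((1 + 2 * s) / (2 * s)) *: (a : 'cV[R]_m)))))%:E))%E.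
Proof.
move=> s0; rewrite (fubini_tonelli (F s))//.
apply: eq_integral => a _; rewrite -ge0_integralZl//.
- apply: eq_integral => x _; rewrite -EFinM; congr (_%:E).
  by rewrite /gauss_kernel expRD /=; ring.
- apply/measurable_EFinP; apply: measurable_funM => //.
  apply: measurableT_comp => //; apply: measurableT_comp => //.
  apply: measurable_funM => //; apply: measurable_sqnorm => i.
  under eq_fun do rewrite !mxE.
  by apply: measurable_funB => //; exact: measurable_coord_comp.
- by move=> x _; rewrite lee_fin mulr_ge0// expR_ge0.
- by rewrite lee_fin !mulr_ge0 ?expR_ge0// exprn_ge0// sqrtr_ge0.
Qed.

Lemma smoothing_cvg : (\int[nu]_x (w x)%:E < +oo)%E ->
  (\int[nu]_x \int[gamma]_a F n.+1%:R (x, a) @[n --> \oo] -->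
   \int[nu]_x (w x * f (Z x))%:E)%E.
Proof.
move=> wfin.
have mf := continuous_borel_measurable cf.
have mk n x : measurable_fun [set: borel_cV m]
    (fun a => (gauss_kernel n.+1%:R (Z x) a)%:E).
  by apply/measurable_EFinP; exact: measurable_gauss_kernel.
have mkf n x : measurable_fun [set: borel_cV m]
    (fun a => (gauss_kernel n.+1%:R (Z x) a * f a)%:E).
  under eq_fun do rewrite EFinM.
  by apply: emeasurable_funM => //; exact/measurable_EFinP.
have kf0 n x a : (0 <= (gauss_kernel n.+1%:R (Z x) a * f a)%:E)%E.
  by rewrite lee_fin mulr_ge0// gauss_kernel_ge0.
have FE n x : (\int[gamma]_a F n.+1%:R (x, a) =
    (w x)%:E * \int[gamma]_a (gauss_kernel n.+1%:R (Z x) a * f a)%:E)%E.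
  by rewrite -ge0_integralZl// ?lee_fin//.
have kfle n x : (\int[gamma]_a (gauss_kernel n.+1%:R (Z x) a * f a)%:E <= 1)%E.
  rewrite -(@integral_gauss_kernel gamma n.+1%:R (Z x) Hg) ?ltr0n//.
  apply: ge0_le_integral => //.
  move=> a _; rewrite lee_fin ler_piMr ?gauss_kernel_ge0//.
    by case/andP: (f01 a).
have [|||||_ _] := @dominated_convergence _ T R nu setT measurableT
  (fun n x => \int[gamma]_a F n.+1%:R (x, a))%E
  (fun x => (w x * f (Z x))%:E) (fun x => (w x)%:E).
- by move=> n; apply: (measurable_fun_fubini_tonelli_F (F n.+1%:R)).
- apply/measurable_EFinP; apply: measurable_funM => //.
  exact: measurableT_comp mf mZ.
- apply: aeW => x _; rewrite EFinM.
  under eq_fun do rewrite FE.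
  apply: cvgeZl => //; exact: cvg_gauss_kernel.
- apply/integrableP; split; first exact/measurable_EFinP.
  by under eq_integral do rewrite gee0_abs ?lee_fin//.
- apply: aeW => x n _; rewrite gee0_abs ?integral_ge0//.
  by rewrite FE -[leRHS]mule1 lee_wpmul2l ?lee_fin// kfle.
by [].
Qed.

End smoothing.

(* Superposing bumps centred at all points with weight [f] gives a Gaussian
   smoothing of [f], which tends to [f] as the bumps sharpen. *)
Lemma gauss_bump_determines d (T : measurableType d)
    (nu : {sigma_finite_measure set T -> \bar R})
    (gamma : probability (borel_cV m) R) (w : T -> R) (Z : T -> borel_cV m)
    (f : 'cV[R]_m -> R) :
  standard_normal gamma ->
  measurable_fun setT w -> (forall x, 0 <= w x) -> measurable_fun setT Z ->
  (forall s b, 0 <= s ->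
     (\int[nu]_x (w x * expR (- (s * sqnorm ((Z x : 'cV[R]_m) - b))))%:E =
      \int[gamma]_z (expR (- (s * sqnorm ((z : 'cV[R]_m) - b))))%:E)%E) ->
  continuous f -> (forall a, 0 <= f a <= 1) ->
  (\int[nu]_x (w x * f (Z x))%:E = \int[gamma]_z (f z)%:E)%E.
Proof.
move=> Hg mw w0 mZ H cf f01.
have n0 n : 0 < n.+1%:R :> R by rewrite ltr0n.
(* A bump of sharpness 0 is constant, so [H] also says that the weight has total mass 1; it can then
   serve as dominating function. *)
have wfin : (\int[nu]_x (w x)%:E < +oo)%E.
  have := H 0 0 (lexx 0).
  under eq_integral do rewrite mul0r oppr0 expR0 mulr1.
  move=> ->; under eq_integral do rewrite mul0r oppr0 expR0.
  by rewrite integral_cst// [X in (_ * X)%E](probability_setT gamma) mule1 ltry.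
have C1 := @smoothing_cvg _ T nu gamma w Z f Hg mw w0 mZ cf f01 wfin.
have C2 := @smoothing_cvg _ (borel_cV m) gamma gamma (cst 1) id f Hg
  (measurable_cst _) (fun=> ler01) (@measurable_id _ _ _) cf f01.
(* By [smoothing_swap] and [H] the smoothings over [nu] and over [gamma] are the same sequence,
   whose limit is known on each side. *)
have {}C2 : (\int[nu]_x \int[gamma]_a (w x * (gauss_kernel n.+1%:R (Z x) a * f a))%:E
    @[n --> \oo] --> \int[gamma]_z (f z)%:E)%E.
  under eq_integral do rewrite -[f _]mul1r.
  rewrite (_ : (fun n => _) = (fun n => \int[gamma]_x \int[gamma]_a
    (1 * (gauss_kernel n.+1%:R x a * f a))%:E)%E).
    apply: C2.
    rewrite [X in (X < _)%E](_ : _ = \int[gamma]_x (cst 1%E x))%E//.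
    by rewrite integral_cst// [X in (_ * X)%E](probability_setT gamma) mule1 ltry.
  apply/funext => n.
  rewrite (@smoothing_swap _ T nu gamma w Z f)//.
  rewrite (@smoothing_swap _ (borel_cV m) gamma gamma (cst 1) id f)//.
  apply: eq_integral => a _; congr (_ * _)%E.
  under [RHS]eq_integral do rewrite mul1r.
  by apply: H; rewrite divr_ge0// ?mulr_ge0// addr_ge0// mulr_ge0.
exact: (cvg_unique _ C1 C2).
Qed.

End gaussian_kernel.

(** Second countability: an open set is the countable union of the cubes with rational centre and
    radius an inverse integer that it contains, and membership in a cube is a condition on
    coordinates. *)
Lemma measurable_to_borel (R : realType) (m : nat) d (T : measurableType d)
    (u : T -> 'cV[R]_m) :
  (forall i, measurable_fun setT (fun x => u x i 0)) ->
  measurable_fun setT (u : T -> borel_cV m).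
Proof.
move=> mu; apply: (measurability _ (erefl (@measurable _ (@borel_cV R m)))).
move=> _ [W oW <-]; rewrite setTI.
pose Q (p : 'cV[rat]_m * nat) :=
  [set y : 'cV[R]_m | forall i, `|ratr (p.1 i 0) - y i 0| < p.2.+1%:R^-1].
pose F p := if pselect (Q p `<=` W) then u @^-1` (Q p) else set0.
have -> : u @^-1` W = \bigcup_p F p.
  apply/seteqP; split => [x Ox|x [p _]]; last first.
    by rewrite /F; case: pselect => //= QO; exact: QO.
  have /nbhs_ballP[e /= e0 eO] := open_nbhs_nbhs (conj oW Ox).
  pose n := Num.truncn (2 / e).
  have ne : n.+1%:R^-1 < e / 2.
    rewrite -[ltRHS]invrK ltf_pV2 ?posrE ?invr_gt0 ?divr_gt0// invf_div.
    by rewrite truncnS_gt.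
  have : 0 < n.+1%:R^-1 :> R by rewrite invr_gt0 ltr0n.
  move: ne; have [r rE] : exists r : R, n.+1%:R^-1 = r by exists n.+1%:R^-1.
  rewrite rE => ne n0.
  have /choice[q Hq] : forall i, exists q : rat, `|ratr q - u x i 0| < r.
    move=> i.
    have /rat_in_itvoo[q] : u x i 0 - r < u x i 0 + r by lra.
    rewrite in_itv /= => /andP[h1 h2]; exists q.
    by rewrite ltr_norml; apply/andP; split; lra.
  exists (\col_i q i, n) => //; rewrite /F; case: pselect => /= [QO|]; last first.
    case=> y /= Hy; apply: eO; split => // i j; rewrite (ord1 j).
    move: (Hy i) (Hq i); rewrite rE mxE /= /ball /= => h1 h2.
    rewrite -(subrKA (ratr (q i))) (le_lt_trans (ler_normD _ _))//.
    by rewrite (distrC (u x i 0)); lra.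
  by move=> i /=; rewrite rE mxE; exact: Hq.
apply: countable_bigcupT_measurable; first exact: countableP.
move=> p; rewrite /F; case: pselect => //= _.
rewrite (_ : _ @^-1` _ = \bigcap_(i in [set: 'I_m])
  ((fun x => ratr (p.1 i 0) - u x i 0) @^-1` ball (0 : R) p.2.+1%:R^-1)).
  apply: fin_bigcap_measurable; first exact: finite_finset.
  move=> i _; rewrite -[X in measurable X]setTI.
  have : measurable_fun setT (fun x => ratr (p.1 i 0) - u x i 0) by exact: measurable_funB.
  by apply => //; exact: measurable_ball.
apply/seteqP; split => x Hx i.
  by move=> _; rewrite /= /ball /= sub0r normrN; exact: Hx.
by have := Hx i Logic.I; rewrite /= /ball /= sub0r normrN.
Qed.

(** Packages the image of a weighted measure as a measure, so that two such images can be compared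
    by the uniqueness theorem. *)
Lemma exists_density_measure d d' (T : measurableType d) (T' : measurableType d')
    (R : realType) (mu : {measure set T -> \bar R}) (G : T -> R)
    (phi : T -> T') :
  measurable_fun setT G -> (forall x, 0 <= G x) -> measurable_fun setT phi ->
  exists nu : {measure set T' -> \bar R},
    forall A, (nu A = \int[mu]_(x in phi @^-1` A) (G x)%:E)%E.
Proof.
move=> mG G0 mphi.
pose n (A : set T') := (\int[mu]_(x in phi @^-1` A) (G x)%:E)%E.
have n0 : n set0 = 0%E by rewrite /n preimage_set0 integral_set0.
have nge0 A : (0 <= n A)%E by apply: integral_ge0 => x _; rewrite lee_fin.
have nsig : semi_sigma_additive n.
  move=> /= A mA tA mUA; rewrite /n preimage_bigcup ge0_integral_bigcup//=.
  - apply: is_cvg_ereal_nneg_natsum_cond => k _ _; exact: nge0.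
  - move=> k; rewrite -[X in measurable X]setTI; exact: mphi.
  - apply/measurable_EFinP; exact: measurable_funTS.
  - by move=> x _; rewrite lee_fin.
  - move=> i j _ _ [x [/= xi xj]]; apply: (tA i j) => //.
    by exists (phi x).
pose nu : {measure set T' -> \bar R} :=
  HB.pack n (isMeasure.Build _ _ _ n n0 nge0 nsig).
by exists nu.
Qed.

(** * Indicators of open sets as monotone limits of continuous functions *)

Section open_sets.
Context {R : realType} {U : topologicalType}.
Variables (F G : U -> R).
Hypotheses (cF : continuous F) (F01 : forall a, 0 <= F a <= 1)
  (cG : continuous G).

Let Gp z := (G z + `|G z|) / 2.

Let Gp0 z : 0 <= Gp z.
Proof. by rewrite /Gp divr_ge0// -lerBlDl sub0r -normrN ler_norm. Qed.

Let GpE z : 0 < G z -> Gp z = G z.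
Proof. by move=> G0; rewrite /Gp gtr0_norm//; field. Qed.

Let GpE0 z : ~~ (0 < G z) -> Gp z = 0.
Proof. by rewrite -leNgt => G0; rewrite /Gp ler0_norm// subrr mul0r. Qed.

(** [Gp] is the positive part of [G]: the second factor vanishes where [G] is nonpositive and
    increases to 1 where it is positive, while staying continuous. *)
Definition open_approx (n : nat) z := F z * (1 - expR (- (n%:R * Gp z))).

Lemma open_approx_itv n z : 0 <= open_approx n z <= 1.
Proof.
have /andP[h0 h1] := F01 z.
have e1 : expR (- (n%:R * Gp z)) <= 1.
  by rewrite -[leRHS]expR0 ler_expR oppr_le0 mulr_ge0.
have e0 := expR_ge0 (- (n%:R * Gp z)).
by rewrite /open_approx; apply/andP; split; nra.
Qed.

Lemma continuous_open_approx n : continuous (open_approx n).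
Proof.
move=> z; apply: cvgM; first exact: cF.
apply: cvgB; first exact: cvg_cst.
apply: (@cvg_comp _ _ _ (fun z => - (n%:R * Gp z)) expR); last exact: continuous_expR.
apply: cvgN; apply: cvgMr; rewrite /Gp; apply: cvgMl.
by apply: cvgD; [exact: cG|apply: cvg_norm; exact: cG].
Qed.

Lemma open_approx_nd z : nondecreasing_seq (open_approx ^~ z).
Proof.
move=> a b ab; have /andP[h0 _] := F01 z.
apply: ler_wpM2l => //; rewrite lerB// ler_expR lerN2 ler_wpM2r//.
by rewrite ler_nat.
Qed.

Lemma cvg_open_approx z :
  open_approx n z @[n --> \oo] --> F z * \1_[set z | 0 < G z] z.
Proof.
apply: cvgMr; rewrite indicE; case: (boolP (0 < G z)) => G0.
  rewrite mem_set// -[X in _ --> X]subr0; apply: cvgB; first exact: cvg_cst.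
  under eq_fun do rewrite -mulrN expRM_natl.
  apply: cvg_expr; rewrite ger0_norm ?expR_ge0// -[ltRHS]expR0 ltr_expR.
  by rewrite oppr_lt0 GpE.
rewrite memNset; last by apply/negP.
under eq_fun do rewrite GpE0// mulr0 oppr0 expR0 subrr.
exact: cvg_cst.
Qed.

End open_sets.

(** Monotone convergence along [open_approx]. The factor [F] lets a continuous radial weight be
    carried along with the indicator of a ball. *)
Lemma weak_eq_open (R : realType) (m : nat) (F G : 'cV[R]_m -> R)
    d (T : measurableType d) (nu : {measure set T -> \bar R})
    (gamma : {measure set (@borel_cV R m) -> \bar R}) (w : T -> R)
    (Z : T -> @borel_cV R m) :
  continuous F -> (forall a, 0 <= F a <= 1) -> continuous G ->
  measurable_fun setT w -> (forall x, 0 <= w x) -> measurable_fun setT Z ->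
  (forall f : 'cV[R]_m -> R, continuous f -> (forall a, 0 <= f a <= 1) ->
     (\int[nu]_x (w x * f (Z x))%:E = \int[gamma]_z (f z)%:E)%E) ->
  (\int[nu]_x (w x * (F (Z x) * \1_[set z | 0 < G z] (Z x)))%:E =
   \int[gamma]_z (F z * \1_[set z | 0 < G z] (z : 'cV[R]_m))%:E)%E.
Proof.
move=> cF F01 cG mw w0 mZ H.
pose open_approx := open_approx F G.
have itv n z : 0 <= open_approx n z <= 1 by exact: open_approx_itv.
have cont n : continuous (open_approx n) by exact: continuous_open_approx.
have cvgo z : open_approx n z @[n --> \oo] --> F z * \1_[set z | 0 < G z] z.
  exact: cvg_open_approx.
have nd z : nondecreasing_seq (open_approx ^~ z) by exact: open_approx_nd.
have mf n : measurable_fun setT (open_approx n : @borel_cV R m -> R).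
  exact: (continuous_borel_measurable (cont n)).
have C1 : (\int[nu]_x (w x * open_approx n (Z x))%:E @[n --> \oo] -->
    \int[nu]_x (w x * (F (Z x) * \1_[set z | 0 < G z] (Z x)))%:E)%E.
  rewrite (_ : (\int[nu]_x (w x * (F (Z x) * \1_[set z | 0 < G z] (Z x)))%:E)%E =
    (\int[nu]_x limn (fun n => (w x * open_approx n (Z x))%:E))%E); last first.
    apply: eq_integral => x _; apply/esym/cvg_lim => //; apply: cvg_EFin.
      exact: nearW.
    by apply: cvgMr; exact: cvgo.
  apply: cvg_monotone_convergence => //.
  - move=> n; apply/measurable_EFinP; apply: measurable_funM => //.
    exact: measurableT_comp (mf n) mZ.
  - by move=> n x _; rewrite lee_fin mulr_ge0//; case/andP: (itv n (Z x)).
  - by move=> x _ a b ab; rewrite lee_fin ler_wpM2l// nd.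
have C2 : (\int[gamma]_x (open_approx n x)%:E @[n --> \oo] -->
    \int[gamma]_x (F x * \1_[set z | 0 < G z] (x : 'cV[R]_m))%:E)%E.
  rewrite (_ : (\int[gamma]_x (F x * \1_[set z | 0 < G z] (x : 'cV[R]_m))%:E)%E =
    (\int[gamma]_x limn (fun n => (open_approx n x)%:E))%E); last first.
    apply: eq_integral => x _; apply/esym/cvg_lim => //; apply: cvg_EFin.
      exact: nearW.
    exact: cvgo.
  apply: cvg_monotone_convergence => //.
  - by move=> n; apply/measurable_EFinP.
  - by move=> n x _; rewrite lee_fin; case/andP: (itv n x).
  - by move=> x _ a b ab; rewrite lee_fin nd.
have E : (fun n => \int[nu]_x (w x * open_approx n (Z x))%:E)%E =
    (fun n => \int[gamma]_x (open_approx n x)%:E)%E.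
  by apply/funext => n; rewrite H.
by rewrite E in C1; exact: (cvg_unique _ C1 C2).
Qed.

Lemma sqnorm_ge0 (R : realType) m (z : 'cV[R]_m) : 0 <= sqnorm z.
Proof. by apply: sumr_ge0 => i _; exact: sqr_ge0. Qed.

Lemma sqnormZ (R : realType) m (c : R) (z : 'cV[R]_m) :
  sqnorm (c *: z) = c ^+ 2 * sqnorm z.
Proof.
by rewrite /sqnorm mulr_sumr; apply: eq_bigr => i _; rewrite mxE exprMn.
Qed.

Lemma continuous_sqnorm (R : realType) m : continuous (@sqnorm R m).
Proof.
rewrite /sqnorm; apply: continuous_big => [|i _]; first exact: add_continuous.
move=> z; apply: (@continuous_comp _ _ _ (fun z : 'cV[R]_m => z i 0)
  (fun t : R => t ^+ 2)); [exact: coord_continuous|exact: exprn_continuous].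
Qed.

Lemma enorm_lt (R : realType) m (z : 'cV[R]_m) (rho : R) : 0 < rho ->
  (enorm z < rho) = (sqnorm z < rho ^+ 2).
Proof.
move=> r0; rewrite -(@ltr_pXn2r _ 2)//= ?nnegrE ?sqrtr_ge0 ?ltW//.
by rewrite sqr_sqrtr// sqnorm_ge0.
Qed.

Section homogeneity.
Context {R : realType} {m : nat}.
Variable gamma : probability (@borel_cV R m) R.
Hypothesis Hg : standard_normal gamma.

(** The weight is the Jacobian [q ^+ m] times the ratio of the Gaussian densities at [q *: z] and at
    [z]. That the weighted dilation reproduces the law is verified on bumps alone. With [1 < q] the
    weight is bounded, and the exponent [P] below is positive even for [s = 0]. *)
Lemma gaussian_homogeneous (q : R) (F G : 'cV[R]_m -> R) : 1 < q ->
  continuous F -> (forall a, 0 <= F a <= 1) -> continuous G ->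
  (\int[gamma]_z (q ^+ m * expR (- ((q ^+ 2 - 1) / 2 * sqnorm (z : 'cV[R]_m))) *
     (F (q *: (z : 'cV[R]_m)) *
      \1_[set z | 0 < G z] (q *: (z : 'cV[R]_m))))%:E =
   \int[gamma]_z (F z * \1_[set z | 0 < G z] (z : 'cV[R]_m))%:E)%E.
Proof.
move=> q1 cF F01 cG.
have mZ : measurable_fun setT (fun z : @borel_cV R m => q *: (z : 'cV[R]_m) : borel_cV m).
  apply: measurable_to_borel => i; under eq_fun do rewrite mxE.
  by apply: measurable_funM => //; exact: measurable_fun_coord.
have msq (c : R) : measurable_fun setT
    (fun z : @borel_cV R m => expR (- (c * sqnorm (z : 'cV[R]_m)))).
  apply: measurableT_comp => //; apply: measurableT_comp => //.
  apply: measurable_funM => //; apply: measurable_sqnorm => i.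
  exact: measurable_fun_coord.
have mw : measurable_fun setT
    (fun z : @borel_cV R m => q ^+ m * expR (- ((q ^+ 2 - 1) / 2 * sqnorm (z : 'cV[R]_m)))).
  exact: measurable_funM.
have w0 (z : @borel_cV R m) : 0 <= q ^+ m * expR (- ((q ^+ 2 - 1) / 2 * sqnorm (z : 'cV[R]_m))).
  by rewrite mulr_ge0 ?expR_ge0// exprn_ge0//; lra.
apply: (@weak_eq_open R m F G _ _ gamma gamma _
  (fun z : @borel_cV R m => q *: (z : 'cV[R]_m))) => // f cf f01.
apply: (@gauss_bump_determines _ _ _ _ gamma gamma) => // s b s0.
(* [P] is the coefficient of [sqnorm z] in the total exponent; completing the square then leaves a
   bump centred at a multiple of [b]. *)
pose P := (q ^+ 2 - 1) / 2 + s * q ^+ 2.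
have P0 : 0 < P by rewrite /P; nra.
have PE : 1 + 2 * P = q ^+ 2 * (1 + 2 * s) by rewrite /P; field.
transitivity (\int[gamma]_z ((q ^+ m * expR (- ((s - s ^+ 2 * q ^+ 2 / P) * sqnorm b)))%:E *
  (expR (- (P * sqnorm ((z : 'cV[R]_m) - (s * q / P) *: b))))%:E))%E.
  apply: eq_integral => z _; rewrite -EFinM; congr (_%:E).
  rewrite -!mulrA -!expRD; congr (_ * expR _).
  rewrite /sqnorm !mulr_sumr -!sumrN -!big_split /=; apply: eq_bigr => i _.
  by rewrite !mxE /P; field; rewrite -/P; apply/eqP; rewrite /P in P0 *; nra.
have mb : measurable_fun [set: @borel_cV R m]
    (fun z => (expR (- (P * sqnorm ((z : 'cV[R]_m) - (s * q / P) *: b))))%:E).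
  apply/measurable_EFinP; apply: measurableT_comp => //.
  apply: measurableT_comp => //; apply: measurable_funM => //.
  apply: measurable_sqnorm => i; under eq_fun do rewrite !mxE.
  by apply: measurable_funB => //; exact: measurable_fun_coord.
have c0 : (0 <= (q ^+ m * expR (- ((s - s ^+ 2 * q ^+ 2 / P) * sqnorm b)))%:E)%E.
  by rewrite lee_fin mulr_ge0 ?expR_ge0// exprn_ge0//; lra.
rewrite ge0_integralZl//.
rewrite (integral_standard_normal_bump _ Hg (ltW P0)).
rewrite (integral_standard_normal_bump _ Hg s0) -EFinM; congr (_%:E).
rewrite PE sqrtrM ?sqr_ge0// sqrtr_sqr gtr0_norm; last by lra.
rewrite invfM exprMn mulrACA !exprVn -!mulrA mulrA divff ?mul1r; last first.
  by rewrite expf_neq0// gt_eqF//; lra.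
rewrite -expRD; congr (_ * expR _); rewrite sqnormZ.
set N := sqnorm b; rewrite /P; field.
by rewrite !gt_eqF//=; lra.
Qed.

End homogeneity.

Lemma continuous_subr (R : realType) (U : topologicalType) (f g : U -> R) :
  continuous f -> continuous g -> continuous (fun x => f x - g x).
Proof. by move=> cf cg x; apply: cvgB; [exact: cf|exact: cg]. Qed.

Lemma indic_bool (R : pzRingType) (U : Type) (p : U -> bool) (x : U) :
  \1_[set z | p z] x = (p x)%:R :> R.
Proof.
rewrite indicE; case: (boolP (p x)) => px; first by rewrite mem_set.
by rewrite memNset//; exact/negP.
Qed.

(** * Polar decomposition *)

Section radial.
Context {R : realType} {m : nat}.
Variable gamma : probability (@borel_cV R m) R.
Hypothesis Hg : standard_normal gamma.

(* Up to a constant, the Lebesgue volume of the Euclidean ball of radius [rho];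
   the dilation formula makes it a multiple of [rho ^+ m]. *)
Definition radial_mass (rho : R) : \bar R :=
  (\int[gamma]_z (expR (sqnorm (z : 'cV[R]_m) / 2) *
     \1_[set z : 'cV[R]_m | 0 < rho ^+ 2 - sqnorm z] (z : 'cV[R]_m))%:E)%E.

(** Inside the ball of radius [rho] this is the weight of [radial_mass] divided by its value on the
    boundary. The absolute value keeps it continuous and at most 1 outside as well, as
    [gaussian_homogeneous] demands. *)
Let F (rho : R) (z : 'cV[R]_m) := expR (- (`|sqnorm z - rho ^+ 2| / 2)).

Let cont_sq (c : R) : continuous (fun z : 'cV[R]_m => sqnorm z - c).
Proof.
apply: (@continuous_subr R _ (@sqnorm R m) (cst c)); last exact: cst_continuous.
exact: continuous_sqnorm.
Qed.

Let cG rho : continuous (fun z : 'cV[R]_m => rho ^+ 2 - sqnorm z).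
Proof.
apply: (@continuous_subr R _ (cst (rho ^+ 2)) (@sqnorm R m)).
  exact: cst_continuous.
exact: continuous_sqnorm.
Qed.

Let cF rho : continuous (F rho).
Proof.
move=> z; apply: (@continuous_comp _ _ _ (fun z : 'cV[R]_m => sqnorm z - rho ^+ 2)
  (fun t : R => expR (- (`|t| / 2)))); first exact: cont_sq.
apply: (@continuous_comp _ _ _ (fun t : R => - (`|t| / 2)) expR);
  last exact: continuous_expR.
by apply: cvgN; apply: cvgMl; exact: norm_continuous.
Qed.

Let F01 rho z : 0 <= F rho z <= 1.
Proof.
by rewrite expR_ge0 -[leRHS]expR0 ler_expR oppr_le0 divr_ge0.
Qed.

Let measurable_sq : measurable_fun setT (fun z : @borel_cV R m => sqnorm (z : 'cV[R]_m)).
Proof. by apply: measurable_sqnorm => i; exact: measurable_fun_coord. Qed.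

Let measurable_open rho :
  measurable_fun setT (fun z : @borel_cV R m => \1_[set z : 'cV[R]_m | 0 < rho ^+ 2 - sqnorm z] (z : 'cV[R]_m) : R).
Proof.
apply: (@measurable_indic _ (@borel_cV R m)).
rewrite (_ : [set _ | _] = (fun z : @borel_cV R m => rho ^+ 2 - sqnorm (z : 'cV[R]_m)) @^-1` `]0, +oo[).
  rewrite -[X in measurable X]setTI.
  have : measurable_fun setT (fun z : @borel_cV R m => rho ^+ 2 - sqnorm (z : 'cV[R]_m)).
    exact: measurable_funB.
  by apply => //; exact: measurable_itv.
by apply/seteqP; split => z /=; rewrite in_itv/= andbT.
Qed.

Let radial_massE rho : radial_mass rho =
  ((expR (rho ^+ 2 / 2))%:E *
   \int[gamma]_z (F rho (z : 'cV[R]_m) *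
     \1_[set z : 'cV[R]_m | 0 < rho ^+ 2 - sqnorm z] (z : 'cV[R]_m))%:E)%E.
Proof.
rewrite -ge0_integralZl//.
- apply: eq_integral => z _; rewrite -EFinM mulrA; congr (_%:E).
  rewrite indicE; case: (boolP (z \in _)); rewrite ?mulr0// inE /= => h.
  rewrite !mulr1 -expRD; congr expR.
  by rewrite ler0_norm; lra.
- apply/measurable_EFinP; apply: measurable_funM => //.
  exact: (continuous_borel_measurable (@cF rho)).
- by move=> z _; rewrite lee_fin mulr_ge0// expR_ge0.
Qed.

Lemma radial_mass_fin rho : radial_mass rho \is a fin_num.
Proof.
rewrite radial_massE fin_numM//.
have -> := @eq_integral _ _ _ gamma setT
  (fun z => (\1_[set z : 'cV[R]_m | 0 < rho ^+ 2 - sqnorm z] (z : 'cV[R]_m) *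
     F rho (z : 'cV[R]_m))%:E); last by move=> z _; rewrite mulrC.
apply: integral_unit_itv_fin_num.
  apply: measurable_funM => //; exact: (continuous_borel_measurable (@cF rho)).
move=> z; have /andP[h0 h1] := F01 rho z.
by rewrite indicE; case: (_ \in _); rewrite ?mul0r ?mul1r ?lexx ?ler01 ?h0.
Qed.

Lemma radial_mass_scale q rho : 1 < q -> 0 < rho ->
  radial_mass rho = ((q ^+ m)%:E * radial_mass (rho / q))%E.
Proof.
move=> q1 r0; have q0 : 0 < q by lra.
rewrite {1}radial_massE -(gaussian_homogeneous Hg q1 (@cF rho) (F01 rho) (@cG rho)).
rewrite /radial_mass -!ge0_integralZl//.
- apply: eq_integral => z _; rewrite -!EFinM; congr (_%:E).
  rewrite !indic_bool.
  have -> : (0 < rho ^+ 2 - sqnorm (q *: (z : 'cV[R]_m))) =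
            (0 < (rho / q) ^+ 2 - sqnorm (z : 'cV[R]_m)).
    rewrite sqnormZ !subr_gt0 exprMn exprVn ltr_pdivlMr ?exprn_gt0//.
    by rewrite mulrC.
  case: (boolP (0 < (rho / q) ^+ 2 - _)) => [h|_]; last by rewrite !mulr0.
  rewrite !mulr1 [LHS](_ : _ = q ^+ m * (expR (rho ^+ 2 / 2) *
    expR (- ((q ^+ 2 - 1) / 2 * sqnorm (z : 'cV[R]_m))) *
    F rho (q *: (z : 'cV[R]_m)))); last by ring.
  rewrite -!expRD sqnormZ; congr (_ * expR _).
  have h' : q ^+ 2 * sqnorm (z : 'cV[R]_m) < rho ^+ 2.
    rewrite mulrC -ltr_pdivlMr ?exprn_gt0// -exprVn -exprMn; lra.
  by rewrite ler0_norm; [field|lra].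
- apply/measurable_EFinP; apply: measurable_funM => //.
  by apply: measurableT_comp => //; exact: measurable_funM.
- by rewrite lee_fin exprn_ge0// ltW.
- apply/measurable_EFinP; apply: measurable_funM.
    apply: measurable_funM => //; apply: measurableT_comp => //.
    by apply: measurableT_comp => //; exact: measurable_funM.
  have mZ : measurable_fun setT (fun z : @borel_cV R m => q *: (z : 'cV[R]_m) : borel_cV m).
    apply: measurable_to_borel => i; under eq_fun do rewrite mxE.
    by apply: measurable_funM => //; exact: measurable_fun_coord.
  apply: measurable_funM; last exact: (measurableT_comp (measurable_open rho) mZ).
  exact: (measurableT_comp (continuous_borel_measurable (@cF rho)) mZ).
- move=> z _; rewrite lee_fin !mulr_ge0 ?expR_ge0// exprn_ge0//; exact: ltW.
Qed.

Definition radial_const : R := fine (radial_mass 1).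

(** Dilations come with [1 < q]: a large ball is shrunk to the unit ball by [q = rho], and for a
    small one the unit ball is shrunk by [q = rho^-1]. *)
Lemma radial_massX rho : 0 < rho ->
  radial_mass rho = (radial_const * rho ^+ m)%:E.
Proof.
move=> r0; have K : radial_mass 1 = radial_const%:E by rewrite fineK// radial_mass_fin.
have [r1|r1|<-] := ltgtP 1 rho.
- by rewrite (radial_mass_scale r1 r0) divff ?gt_eqF// K -EFinM mulrC.
- have i1 : 1 < rho^-1 by rewrite invf_gt1.
  have := radial_mass_scale i1 ltr01.
  rewrite invrK mul1r K -(fineK (radial_mass_fin rho)) -EFinM => -[->].
  rewrite mulrAC exprVn mulVf ?mul1r// expf_neq0// gt_eqF//.
- by rewrite expr1n mulr1.
Qed.

Lemma radial_const_ge0 : 0 <= radial_const.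
Proof.
apply: fine_ge0; apply: integral_ge0 => z _.
by rewrite lee_fin mulr_ge0 ?expR_ge0.
Qed.

Lemma integral_power_itv (rho : R) : (0 < m)%N -> 0 < rho ->
  (\int[lebesgue_measure]_(r in `[0%R, rho]) (radial_const * m%:R * r ^+ m.-1)%:E =
   (radial_const * rho ^+ m)%:E)%E.
Proof.
move=> m0 r0.
have D (x : R) : is_derive x 1 (fun r : R => radial_const * r ^+ m)
    (radial_const * m%:R * x ^+ m.-1).
  rewrite (_ : (fun r : R => _) = radial_const \*: ((id : R -> R) ^+ m)); last first.
    by apply/funext => r; rewrite /= exprfctE.
  by apply: is_derive_eq; rewrite /GRing.scale/= mulr1 mulrA.
have cX (n : nat) (c : R) : continuous (fun r : R => c * r ^+ n).
  by move=> x; apply: cvgM; [exact: cvg_cst|exact: exprn_continuous].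
apply: etrans.
  apply: (@continuous_FTC2 R _ (fun r : R => radial_const * r ^+ m) 0 rho) => //.
  - by apply: continuous_subspaceT => x; exact: cX.
  - split=> [x _||]; first by have := D x; case.
      by apply: cvg_at_right_filter; exact: cX.
    by apply: cvg_at_left_filter; exact: cX.
  - by move=> x _; rewrite derive1E; apply/derive_val.
by rewrite /= expr0n gtn_eqF// mulr0 sube0.
Qed.

Lemma measurable_enorm : measurable_fun setT (fun z : @borel_cV R m => enorm (z : 'cV[R]_m)).
Proof.
exact: (measurableT_comp (continuous_measurable_fun (@sqrt_continuous R)) measurable_sq).
Qed.

(** Both sides integrate [k] against a measure on the line: the image [n1] of the weighted Gaussian
    law under [enorm], and [n2], whose density is a multiple of a power of [r]. They agree on open
    half-lines by [radial_massX], hence everywhere. *)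
Lemma radial_law_unnormalized (m0 : (0 < m)%N) (k : R -> R) :
  measurable_fun setT k -> (forall r, 0 <= k r) ->
  (\int[gamma]_z (expR (sqnorm (z : 'cV[R]_m) / 2) * k (enorm (z : 'cV[R]_m)))%:E =
   \int[lebesgue_measure]_(r in `[0%R, +oo[)
      (radial_const * m%:R * r ^+ m.-1 * k r)%:E)%E.
Proof.
move=> mk k0.
pose G1 (z : @borel_cV R m) := expR (sqnorm (z : 'cV[R]_m) / 2).
have mG1 : measurable_fun setT G1.
  by apply: measurableT_comp => //; exact: measurable_funM.
have G10 z : 0 <= G1 z by exact: expR_ge0.
pose G2 (r : R) := radial_const * m%:R * r ^+ m.-1 * \1_(`[0, +oo[ : set R) r.
have mG2 : measurable_fun setT G2.
  apply: measurable_funM; last exact: measurable_indic.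
  by apply: measurable_funM => //; exact: measurable_funX.
have G20 r : 0 <= G2 r.
  rewrite /G2 indicE; case: (boolP (r \in _)); rewrite ?mulr0// inE /= in_itv/= andbT => r0.
  by rewrite mulr1 !mulr_ge0 ?radial_const_ge0// exprn_ge0.
have [n1 n1E] := exists_density_measure gamma mG1 G10 measurable_enorm.
have mid : measurable_fun [set: R] (fun r : R => r) by exact: measurable_id.
have [n2 n2E] := exists_density_measure lebesgue_measure mG2 G20 mid.
have n2neg (x : R) : x <= 0 -> n2 `]-oo, x[%classic = 0%E.
  move=> x0; rewrite n2E integral0_eq// => r /=; rewrite in_itv/= => rx.
  rewrite /G2 indicE memNset ?mulr0//= in_itv/= andbT.
  by apply/negP; rewrite -ltNge (lt_le_trans rx).
have n2pos (x : R) : 0 < x -> n2 `]-oo, x[%classic = (radial_const * x ^+ m)%:E.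
  move=> x0; rewrite n2E -integral_power_itv//.
  rewrite -integral_itv_bndo_bndc; last first.
    apply/measurable_EFinP; apply: measurable_funTS.
    by apply: measurable_funM => //; exact: measurable_funX.
  rewrite integral_mkcond [RHS]integral_mkcond; apply: eq_integral => r _.
  rewrite /patch /= !mem_setE /G2 indic_bool !in_itv/= andbT.
  by case: ltP => _; rewrite ?andbF// andbT; case: ifP => _; rewrite ?mulr1// mulr0.
have n12i (x : R) : n1 `]-oo, x[%classic = n2 `]-oo, x[%classic.
  have [x0|x0] := leP x 0.
    rewrite n2neg// n1E (_ : _ @^-1` _ = set0) ?integral_set0//.
    apply/seteqP; split => z //=; rewrite in_itv/= => zx.
    by have := sqrtr_ge0 (\sum_(i < m) (z : 'cV[R]_m) i 0 ^+ 2); rewrite leNgt (lt_le_trans zx).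
  rewrite n2pos// -radial_massX// n1E integral_mkcond; apply: eq_integral => z _.
  rewrite epatch_indic -EFinM indic_bool subr_gt0 -enorm_lt// indicE.
  case: (boolP (enorm _ < x)) => h; first by rewrite mem_set//= in_itv.
  by rewrite memNset//= in_itv /=; exact/negP.
have n2fin (x : R) : (n2 `]-oo, x[%classic < +oo)%E.
  by have [x0|x0] := leP x 0; [rewrite n2neg|rewrite n2pos// ltry].
have n12 (A : set R) : measurable A -> n1 A = n2 A.
  apply: (@measure_unique _ R _ (@RGenInftyO.G R)
    (fun n => `]-oo, n%:R[%classic) _ _ _ _ n1 n2).
  - exact: RGenInftyO.measurableE.
  - move=> _ _ [x ->] [y ->]; exists (Num.min x y).
    by apply/seteqP; split=> z /=; rewrite !in_itv/= lt_min => /andP.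
  - by move=> n; exists n%:R.
  - apply/seteqP; split=> // x _; exists (Num.truncn `|x|).+1 => //=.
    by rewrite in_itv/= (le_lt_trans (ler_norm x))// truncnS_gt.
  - move=> _ [x ->]; exact: n12i.
  - by move=> n; rewrite n12i n2fin.
have W1 := @ge0_integral_weight _ _ _ _ _ gamma n2 G1
   (fun z : @borel_cV R m => enorm (z : 'cV[R]_m)) 1 mG1 G10 measurable_enorm ler01 _
   (fun r => (k r)%:E) _ _.
have W2 := @ge0_integral_weight _ _ _ _ _ lebesgue_measure n2 G2
   (fun r : R => r) 1 mG2 G20 mid ler01 _
   (fun r => (k r)%:E) _ _.
transitivity (1%:E * \int[n2]_r (k r)%:E)%E.
  apply: W1 => //.
  - move=> A mA; rewrite mul1e -n12// n1E [RHS]integral_mkcond.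
    by apply: eq_integral => z _; rewrite epatch_indic.
  - exact/measurable_EFinP.
rewrite -W2//.
- rewrite [RHS]integral_mkcond; apply: eq_integral => r _.
  rewrite epatch_indic /G2 -!EFinM; congr (_%:E); ring.
- move=> A mA; rewrite mul1e n2E [RHS]integral_mkcond.
  by apply: eq_integral => z _; rewrite epatch_indic.
- exact/measurable_EFinP.
Qed.


(** The test function [expR (- (r ^+ 2 / 2)) * k r] cancels the weight of the unnormalized law. With
    [k = 1] the left side is 1, which identifies [c] with the inverse of the normalizing integral of
    [chi_pdf]. *)
Lemma radial_law (m0 : (0 < m)%N) (k : R -> R) :
  measurable_fun setT k -> (forall r, 0 <= k r) ->
  (\int[gamma]_z (k (enorm (z : 'cV[R]_m)))%:E =
   \int[lebesgue_measure]_(r in `[0%R, +oo[) (chi_pdf m r * k r)%:E)%E.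
Proof.
move=> mk k0.
pose f (s : R) := s ^+ m.-1 * expR (- (s ^+ 2 / 2)).
pose c := radial_const * m%:R.
have mg : measurable_fun [set: R] (fun r : R => expR (- (r ^+ 2 / 2))).
  apply: measurableT_comp => //; apply: measurableT_comp => //.
  exact: measurable_funM.
have mf : measurable_fun setT f.
  by apply: measurable_funM => //; exact: measurable_funX.
have sqE (z : 'cV[R]_m) : enorm z ^+ 2 = sqnorm z.
  by rewrite sqr_sqrtr// sqnorm_ge0.
have U (h : R -> R) : measurable_fun setT h -> (forall r, 0 <= h r) ->
  (\int[gamma]_z (h (enorm (z : 'cV[R]_m)))%:E =
   \int[lebesgue_measure]_(r in `[0%R, +oo[) (c * f r * h r)%:E)%E.
  move=> mh h0.
  have := @radial_law_unnormalized m0 (fun r => expR (- (r ^+ 2 / 2)) * h r).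
  rewrite (_ : (fun z => _) = (fun z : @borel_cV R m => (h (enorm (z : 'cV[R]_m)))%:E)); last first.
    apply/funext => z; rewrite mulrA -expRD sqE subrr expR0 mul1r//.
  move=> ->.
  - by apply: eq_integral => r _; rewrite /f /c; congr (_%:E); ring.
  - exact: measurable_funM.
  - by move=> r; rewrite mulr_ge0 ?expR_ge0.
pose N := (\int[lebesgue_measure]_(s in `[0%R, +oo[) f s)%R.
have c0 : 0 <= c by rewrite mulr_ge0 ?radial_const_ge0.
have f0 r : r \in `[0%R, +oo[%classic -> 0 <= f r.
  rewrite inE /= in_itv/= andbT => r0.
  by rewrite mulr_ge0 ?expR_ge0// exprn_ge0.
have : (1 = c%:E * \int[lebesgue_measure]_(r in `[0%R, +oo[) (f r)%:E)%E.
  have := U (cst 1) (measurable_cst _) (fun=> ler01).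
  rewrite [LHS](_ : _ = 1%E) => [->|]; last first.
    transitivity (\int[gamma]_z (cst 1%E z))%E => //.
    by rewrite integral_cst// mul1e; exact: probability_setT.
  rewrite -ge0_integralZl//.
  - by apply: eq_integral => r _; rewrite mulr1 EFinM.
  - exact/measurable_EFinP/measurable_funTS.
  - by move=> r r0; rewrite lee_fin f0// inE.
move=> E.
(* [N] is a real-valued integral, equal to 0 by convention if the extended one is infinite; this is
   excluded because no multiple of infinity is 1. *)
have cN : c * N = 1.
  move: E; rewrite /N /Rintegral.
  case: (\int[lebesgue_measure]_(r in `[0%R, +oo[) (f r)%:E)%E => [n| |].
  - by rewrite -EFinM => -[->].
  - have [->|cn0] := eqVneq c 0; first by rewrite mul0e => /eqP; rewrite eqe oner_eq0.
    by rewrite gt0_muley// lte_fin lt_neqAle eq_sym cn0.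
  - have [->|cn0] := eqVneq c 0; first by rewrite mul0e => /eqP; rewrite eqe oner_eq0.
    by rewrite gt0_muleNy// lte_fin lt_neqAle eq_sym cn0.
have N0 : N != 0 by apply/eqP => N0; move: cN; rewrite N0 mulr0 => /esym/eqP; rewrite oner_eq0.
have cE : c = N^-1 by rewrite -[LHS]mulr1 -(divff N0) mulrA cN mul1r.
rewrite U//; apply: eq_integral => r; rewrite inE /= in_itv/= andbT => r0.
by rewrite /chi_pdf r0 cE (mulrC N^-1).
Qed.

End radial.

Lemma sigma_finite_measure_of d (T : measurableType d) (R : realType)
    (nu : {measure set T -> \bar R})
  (sf : sigma_finite setT nu) :
    exists nuS : {sigma_finite_measure set T -> \bar R}, nu = nuS :> {measure set T -> \bar R}.
Proof.
pose H1 := isSFinite.Build _ _ _ _ (sfinite_measure_sigma_finite sf).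
pose H2 := isSigmaFinite.Build _ _ _ _ sf.
pose nuS := HB.pack_for (SigmaFiniteMeasure.type T R) (Measure.sort nu) H1 H2.

exists nuS; exact: eq_measure.
Qed.

Lemma sigma_finite_prod (R : realType) (m : nat) (mu : probability (@borel_cV R m) R) :
 sigma_finite setT (mu \x (@lebesgue_measure R))%E.
Proof.
have /sigma_finiteP[G [TG ndG Goo]] := sigma_finiteT (@lebesgue_measure R).
exists (fun n => setT `*` G n).
  by rewrite -setX_bigcupr -TG setXTT.
move=> k; have [mG Gk] := Goo k.
split; first exact: measurableX.
rewrite product_measure1E// lte_mul_pinfty//.
exact: fin_num_measure.
Qed.

(** * Orthogonal invariance on the sphere *)

Section sphere_invariance.
Context {R : realType} {m : nat}.
Implicit Types (u v a b z : 'cV[R]_m).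

Definition dot u v : R := \sum_(i < m) u i 0 * v i 0.

Lemma dotE u v : u^T *m v = (dot u v)%:M.
Proof.
apply/matrixP => i j; rewrite !ord1 !mxE eqxx mulr1n.
by apply: eq_bigr => k _; rewrite mxE.
Qed.

Lemma dotC u v : dot u v = dot v u.
Proof. by apply: eq_bigr => i _; rewrite mulrC. Qed.

Lemma dotvv v : dot v v = sqnorm v.
Proof. by apply: eq_bigr => i _. Qed.

Lemma sqnormB u v : sqnorm (u - v) = sqnorm u - 2 * dot u v + sqnorm v.
Proof.
rewrite /sqnorm /dot mulr_sumr -sumrN -!big_split /=.
by apply: eq_bigr => i _; rewrite !mxE; ring.
Qed.

Lemma dotZl (c : R) u v : dot (c *: u) v = c * dot u v.
Proof. by rewrite /dot mulr_sumr; apply: eq_bigr => i _; rewrite mxE mulrA. Qed.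

Lemma dotZr (c : R) u v : dot u (c *: v) = c * dot u v.
Proof. by rewrite dotC dotZl dotC. Qed.

Lemma dot_mulmx (Q : 'M[R]_m) u v : dot (Q *m u) v = dot u (Q^T *m v).
Proof.
suff : (dot (Q *m u) v)%:M = (dot u (Q^T *m v))%:M :> 'M[R]_1.
  by move/matrixP/(_ 0 0); rewrite !mxE eqxx !mulr1n.
by rewrite -!dotE trmx_mul mulmxA.
Qed.

Lemma sqnorm_eq0 v : sqnorm v = 0 -> v = 0.
Proof.
move=> /eqP; rewrite psumr_eq0; last by move=> i _; exact: sqr_ge0.
move=> /allP h; apply/matrixP => i j; rewrite (ord1 j) mxE.
by have := h i (mem_index_enum i); rewrite sqrf_eq0 => /eqP.
Qed.

(* Householder reflection exchanging [a] and [b]. *)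
Lemma orthogonal_transitive a b : sqnorm a = sqnorm b ->
  exists2 Q : 'M[R]_m, Q *m Q^T = 1%:M & Q^T *m b = a.
Proof.
move=> ab; have [->|nab] := eqVneq a b.
  by exists 1%:M; rewrite trmx1 ?mulmx1 ?mul1mx.
pose u := a - b; have u0 : sqnorm u != 0.
  by apply: contra nab => /eqP/sqnorm_eq0/eqP; rewrite subr_eq0.
pose c := 2 / sqnorm u.
pose Q : 'M[R]_m := 1%:M - c *: (u *m u^T).
have QT : Q^T = Q by rewrite /Q linearB /= trmx1 linearZ /= trmx_mul trmxK.
exists Q; rewrite QT.
  set U := u *m u^T in Q QT *.
  have UU : U *m U = sqnorm u *: U.
    by rewrite /U mulmxA -(mulmxA u) dotE dotvv mul_mx_scalar -scalemxAl.
  rewrite /Q mulmxBl mul1mx mulmxBr mulmx1 -scalemxAl -scalemxAr UU !scalerA.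
  rewrite (_ : c * c * _ = c + c); last by rewrite /c; field.
  by rewrite scalerDl opprB addrK subrK.
rewrite /Q mulmxBl mul1mx -scalemxAl -mulmxA dotE mul_mx_scalar scalerA.
(* As [a] and [b] have equal norm, [sqnorm u] is [- (2 * dot u b)], so the reflection moves [b] by
   exactly [u]. *)
have -> : c * dot u b = -1.
  have : sqnorm u = - (2 * dot u b).
    have := sqnormB a b; rewrite ab => E.
    have : dot u b = dot a b - sqnorm b.
      rewrite /u /dot /sqnorm -sumrN -big_split /=; apply: eq_bigr => i _.
      by rewrite !mxE; ring.
    by rewrite /u E => ->; ring.
  move=> E; rewrite /c mulrAC -[2 * dot u b]opprK -E mulNr divff//.
by rewrite scaleN1r opprK addrC subrK.
Qed.

Variable mu : probability (@borel_cV R m) R.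
Hypothesis Hmu : uniform_on_sphere mu.

Lemma measurable_mulmx (Q : 'M[R]_m) :
  measurable_fun setT (fun v : @borel_cV R m => Q *m (v : 'cV[R]_m) : borel_cV m).
Proof.
apply: measurable_to_borel => i; under eq_fun do rewrite mxE.
apply: measurable_sum => k; apply: measurable_funM => //.
exact: measurable_fun_coord.
Qed.

Lemma measurable_sphere : measurable (sphere : set (@borel_cV R m)).
Proof.
rewrite (_ : sphere = (fun v : @borel_cV R m => enorm (v : 'cV[R]_m)) @^-1` [set 1])//.
by rewrite -[X in measurable X]setTI; apply: measurable_enorm.
Qed.

Lemma ge0_integral_sphere (f : @borel_cV R m -> \bar R) :
  measurable_fun setT f -> (forall v, 0 <= f v)%E ->
  (\int[mu]_v f v = \int[mu]_(v in sphere) f v)%E.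
Proof.
move=> mf f0; have mS := measurable_sphere.
rewrite (@ge0_negligible_integral _ _ _ mu setT (~` sphere))//.
- by rewrite setTD setCK.
- exact: measurableC.
- by apply: etrans (probability_setC mu mS) _; rewrite Hmu.1 subee.
Qed.

Lemma ge0_integral_orthogonal (Q : 'M[R]_m) (f : @borel_cV R m -> \bar R) :
  Q *m Q^T = 1%:M ->
  measurable_fun setT f -> (forall v, 0 <= f v)%E ->
  (\int[mu]_v f (Q *m (v : 'cV[R]_m)) = \int[mu]_v f v)%E.
Proof.
move=> QQ mf f0.
have := @ge0_integral_weight _ _ _ _ _ mu mu (cst 1) _ 1 (measurable_cst _)
  (fun=> ler01) (measurable_mulmx Q) ler01 _ f mf f0.
rewrite mul1e => <-.
- by apply: eq_integral => v _; rewrite mul1e.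
- move=> A mA; rewrite mul1e; apply: etrans _ (Hmu.2 Q QQ A mA).
  have mQA : measurable [set v : @borel_cV R m | A (Q *m (v : 'cV[R]_m))].
    by rewrite -[X in measurable X]setTI; exact: measurable_mulmx.
  apply: etrans _ (integral_indicT mu mQA).
  by apply: eq_integral => v _; rewrite mul1e.
Qed.

End sphere_invariance.

Section polar.
Context {R : realType} {m : nat}.
Variables (gamma mu : probability (@borel_cV R m) R).
Hypotheses (Hg : standard_normal gamma) (Hmu : uniform_on_sphere mu)
  (m0 : (0 < m)%N).

Lemma chi_pdf_ge0 r : 0 <= chi_pdf m r :> R.
Proof.
rewrite /chi_pdf; case: ifP => // r0.
rewrite divr_ge0//; first by rewrite mulr_ge0 ?expR_ge0// exprn_ge0.
apply: Rintegral_ge0 => s; rewrite /= in_itv/= andbT => s0.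
by rewrite mulr_ge0 ?expR_ge0// exprn_ge0.
Qed.

Lemma measurable_chi_pdf : measurable_fun setT (@chi_pdf R m).
Proof.
apply: measurable_fun_ifT => //.
  exact: measurable_fun_ler.
apply: measurable_funM => //; apply: measurable_funM.
  exact: measurable_funX.
by apply: measurableT_comp => //; apply: measurableT_comp => //; exact: measurable_funM.
Qed.

Lemma radial_law_full (k : R -> R) : measurable_fun setT k -> (forall r, 0 <= k r) ->
  (\int[gamma]_z (k (enorm (z : 'cV[R]_m)))%:E =
   \int[lebesgue_measure]_r (chi_pdf m r * k r)%:E)%E.
Proof.
move=> mk k0; rewrite (radial_law Hg m0)// integral_mkcond.
apply: eq_integral => r _; rewrite /patch; case: ifPn => //.
rewrite notin_setE /= in_itv/= andbT => /negP r0.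
by rewrite /chi_pdf (negbTE r0) mul0r.
Qed.

Let measurable_expR_sq d (T : measurableType d) s (u : T -> 'cV[R]_m) :
  (forall i, measurable_fun setT (fun x => u x i 0)) ->
  measurable_fun setT (fun x => (expR (- (s * sqnorm (u x))))%:E).
Proof.
move=> hu; apply/measurable_EFinP; apply: measurableT_comp => //.
apply: measurableT_comp => //; apply: measurable_funM => //.
exact: measurable_sqnorm.
Qed.

Let sqE (z : 'cV[R]_m) : enorm z ^+ 2 = sqnorm z.
Proof. by rewrite sqr_sqrtr// sqnorm_ge0. Qed.

Let expR_E0 (x : R) : (0 <= (expR x)%:E)%E.
Proof. by rewrite lee_fin expR_ge0. Qed.

(** On the sphere the first exponent depends on [v] only through its scalar product with
    [enorm z *: b], the second through that with [enorm b *: z]. These vectors have equal norm, so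
    an orthogonal matrix carries one to the other, and [mu] is invariant under it. *)
Lemma sphere_swap s (z b : 'cV[R]_m) :
  (\int[mu]_v (expR (- (s * sqnorm (enorm z *: (v : 'cV[R]_m) - b))))%:E =
   \int[mu]_v (expR (- (s * sqnorm (z - enorm b *: (v : 'cV[R]_m)))))%:E)%E.
Proof.
pose h (a v : 'cV[R]_m) :=
  (expR (- (s * (sqnorm z + sqnorm b - 2 * dot v a))))%:E.
have mh a : measurable_fun setT (h a : @borel_cV R m -> \bar R).
  apply/measurable_EFinP; apply: measurableT_comp => //.
  apply: measurableT_comp => //; apply: measurable_funM => //.
  apply: measurable_funB => //; apply: measurable_funM => //.
  apply: measurable_sum => i; apply: measurable_funM => //.
  exact: measurable_fun_coord.
have mc (v0 : 'cV[R]_m) (c : R) i :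
    measurable_fun setT (fun v : @borel_cV R m => (c *: (v : 'cV[R]_m) - v0) i 0).
  under eq_fun do rewrite !mxE.
  apply: measurable_funB => //; apply: measurable_funM => //.
  exact: measurable_fun_coord.
have mc' (v0 : 'cV[R]_m) (c : R) i :
    measurable_fun setT (fun v : @borel_cV R m => (v0 - c *: (v : 'cV[R]_m)) i 0).
  under eq_fun do rewrite !mxE.
  apply: measurable_funB => //; apply: measurable_funM => //.
  exact: measurable_fun_coord.
have sph (v : 'cV[R]_m) : sphere v -> sqnorm v = 1.
  by move=> v1; rewrite -sqE v1 expr1n.
have [Q QQ Qa] : exists2 Q : 'M[R]_m, Q *m Q^T = 1%:M &
    Q^T *m (enorm b *: z) = enorm z *: b.
  by apply: orthogonal_transitive; rewrite !sqnormZ !sqE mulrC.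
have m1 := @measurable_expR_sq _ _ s _ (mc b (enorm z)).
have m2 := @measurable_expR_sq _ _ s _ (mc' z (enorm b)).
have h0 a (v : @borel_cV R m) : (0 <= h a v)%E by exact: expR_E0.
transitivity (\int[mu]_v h (enorm z *: b) v)%E.
  rewrite (ge0_integral_sphere Hmu m1 (fun=> expR_E0 _)).
  rewrite (ge0_integral_sphere Hmu (mh _) (h0 _)).
  apply: eq_integral => v; rewrite inE => /sph v1; congr (expR (- (s * _)))%:E.
  by rewrite sqnormB sqnormZ v1 sqE dotZl dotZr; ring.
transitivity (\int[mu]_v h (enorm b *: z) v)%E.
  apply: etrans _ (ge0_integral_orthogonal Hmu QQ (mh _) (h0 _)).
  by apply: eq_integral => v _; rewrite /h dot_mulmx Qa.
rewrite (ge0_integral_sphere Hmu (mh _) (h0 _)).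
rewrite (ge0_integral_sphere Hmu m2 (fun=> expR_E0 _)).
apply: eq_integral => v; rewrite inE => /sph v1; congr (expR (- (s * _)))%:E.
by rewrite sqnormB sqnormZ v1 sqE !dotZr dotC; ring.
Qed.

Local Notation nu := (mu \x (@lebesgue_measure R))%E.

Let Z (p : @borel_cV R m * R) : @borel_cV R m := p.2 *: (p.1 : 'cV[R]_m).

Let mZ : measurable_fun setT Z.
Proof.
apply: measurable_to_borel => i; under eq_fun do rewrite mxE.
apply: measurable_funM; first exact: measurable_snd.
exact: measurableT_comp (measurable_fun_coord i) (@measurable_fst _ _ _ _).
Qed.

Let mchi : measurable_fun setT (fun p : @borel_cV R m * R => chi_pdf m p.2).
Proof. exact: measurableT_comp measurable_chi_pdf (@measurable_snd _ _ _ _). Qed.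

(** [radial_law_full] replaces the Chi radius by [enorm z] for Gaussian [z], and [sphere_swap] moves
    the random direction from [z] to [b]. The Gaussian integral is then explicit and depends on the
    centre [enorm b *: v] through its norm alone, so averaging over [v] changes nothing. *)
Lemma polar_bump s (b : 'cV[R]_m) : 0 <= s ->
  (\int[nu]_p (chi_pdf m p.2 * expR (- (s * sqnorm ((Z p : 'cV[R]_m) - b))))%:E =
   \int[gamma]_z (expR (- (s * sqnorm ((z : 'cV[R]_m) - b))))%:E)%E.
Proof.
move=> s0.
have c0 (v : 'cV[R]_m) r := chi_pdf_ge0 r.
have mf : measurable_fun setT (fun p : @borel_cV R m * R =>
    (chi_pdf m p.2 * expR (- (s * sqnorm ((Z p : 'cV[R]_m) - b))))%:E).
  under eq_fun do rewrite EFinM.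
  apply: emeasurable_funM; first exact/measurable_EFinP.
  apply: measurable_expR_sq => i; under eq_fun do rewrite !mxE.
  apply: measurable_funB => //; apply: measurable_funM; first exact: measurable_snd.
  exact: measurableT_comp (measurable_fun_coord i) (@measurable_fst _ _ _ _).
have f0 (p : @borel_cV R m * R) :
    (0 <= (chi_pdf m p.2 * expR (- (s * sqnorm ((Z p : 'cV[R]_m) - b))))%:E)%E.
  by rewrite lee_fin mulr_ge0 ?expR_ge0// chi_pdf_ge0.
apply: etrans (@fubini_tonelli1 _ _ _ _ _ mu lebesgue_measure _ mf f0) _.
transitivity (\int[mu]_v \int[gamma]_z
    (expR (- (s * sqnorm (enorm (z : 'cV[R]_m) *: (v : 'cV[R]_m) - b))))%:E)%E.
  apply: eq_integral => v _; rewrite /fubini_F /Z /=.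
  rewrite -(@radial_law_full (fun r => expR (- (s * sqnorm (r *: (v : 'cV[R]_m) - b)))))//.
  apply: measurableT_comp => //; apply: measurableT_comp => //.
  apply: measurable_funM => //; apply: measurable_sqnorm => i.
  by under eq_fun do rewrite !mxE; apply: measurable_funB => //; exact: measurable_funM.
have mg1 : measurable_fun setT (fun p : @borel_cV R m * @borel_cV R m =>
    (expR (- (s * sqnorm (enorm (p.2 : 'cV[R]_m) *: (p.1 : 'cV[R]_m) - b))))%:E).
  apply: measurable_expR_sq => i; under eq_fun do rewrite !mxE.
  apply: measurable_funB => //; apply: measurable_funM.
    exact: measurableT_comp (@measurable_enorm R m) (@measurable_snd _ _ _ _).
  exact: measurableT_comp (measurable_fun_coord i) (@measurable_fst _ _ _ _).
have mg2 : measurable_fun setT (fun p : @borel_cV R m * @borel_cV R m =>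
    (expR (- (s * sqnorm ((p.1 : 'cV[R]_m) - enorm b *: (p.2 : 'cV[R]_m)))))%:E).
  apply: measurable_expR_sq => i; under eq_fun do rewrite !mxE.
  apply: measurable_funB.
    exact: measurableT_comp (measurable_fun_coord i) (@measurable_fst _ _ _ _).
  apply: measurable_funM => //.
  exact: measurableT_comp (measurable_fun_coord i) (@measurable_snd _ _ _ _).
rewrite (fubini_tonelli _ mg1); last by move=> p; exact: expR_E0.
transitivity (\int[gamma]_z \int[mu]_v
    (expR (- (s * sqnorm ((z : 'cV[R]_m) - enorm b *: (v : 'cV[R]_m)))))%:E)%E.
  by apply: eq_integral => z _; exact: sphere_swap.
rewrite (fubini_tonelli _ mg2); last by move=> p; exact: expR_E0.
pose K := Num.sqrt (1 + 2 * s) ^- m.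
have K0 : 0 <= K by rewrite invr_ge0 exprn_ge0// sqrtr_ge0.
pose h (v : @borel_cV R m) :=
  (K * expR (- (s * (sqnorm b * sqnorm (v : 'cV[R]_m)) / (1 + 2 * s))))%:E.
have h0 v : (0 <= h v)%E by rewrite lee_fin mulr_ge0 ?expR_ge0.
have mh : measurable_fun setT h.
  apply/measurable_EFinP; apply: measurable_funM => //.
  apply: measurableT_comp => //; apply: measurableT_comp => //.
  apply: measurable_funM => //; apply: measurable_funM => //.
  apply: measurable_funM => //; apply: measurable_sqnorm => i.
  exact: measurable_fun_coord.
transitivity (\int[mu]_v h v)%E.
  apply: eq_integral => v _.
  have -> := @integral_standard_normal_bump R m gamma s (enorm b *: (v : 'cV[R]_m)) Hg s0.
  by rewrite /h sqnormZ sqE /K exprVn.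
rewrite (ge0_integral_sphere Hmu mh h0) (integral_standard_normal_bump _ Hg s0).
transitivity (\int[mu]_(v in sphere)
   (cst (K * expR (- (s * sqnorm b / (1 + 2 * s))))%:E v))%E.
  apply: eq_integral => v; rewrite inE => v1.
  by rewrite /h -(sqE (v : 'cV[R]_m)) v1 expr1n mulr1.
rewrite integral_cst; last exact: measurable_sphere.
by rewrite [X in (_ * X)%E](Hmu.1) mule1 /K exprVn.
Qed.

Lemma measurable_polar_fun (G : 'cV[R]_m -> R) : continuous G ->
  measurable_fun setT (fun p : @borel_cV R m * R =>
    \1_[set z | G z <= 0] (Z p : 'cV[R]_m) : R).
Proof.
move=> cG; apply: (@measurableT_comp _ _ _ _ _ _
  (\1_[set z | G z <= 0] : @borel_cV R m -> R) _ Z) => //.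
apply: measurable_indic.
rewrite (_ : [set z | _] = (G : @borel_cV R m -> R) @^-1` `]-oo, 0]).
  rewrite -[X in measurable X]setTI.
  by apply: (continuous_borel_measurable cG) => //; exact: measurable_itv.
by apply/seteqP; split => z /=; rewrite in_itv.
Qed.

Lemma chi_probE (A : set R) :
  (chi_prob m A = \int[lebesgue_measure]_r (chi_pdf m r * \1_A r)%:E)%E.
Proof.
rewrite /chi_prob integral_mkcond; apply: eq_integral => r _.
by rewrite epatch_indic EFinM.
Qed.

Lemma chi_prob_polarE (G : 'cV[R]_m -> R) (v : @borel_cV R m) :
  (chi_prob m [set r : R | (0 <= r)%R /\ (G (r *: (v : 'cV[R]_m)) <= 0)%R] =
   \int[lebesgue_measure]_r
     (chi_pdf m r * \1_[set z | G z <= 0] (r *: (v : 'cV[R]_m)))%:E)%E.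
Proof.
rewrite chi_probE; apply: eq_integral => r _; congr (_%:E).
have [r0|r0] := leP 0 r; last by rewrite /chi_pdf leNgt r0 !mul0r.
congr (_ * _); rewrite indic_bool; case: (boolP (_ <= 0)) => h.
  by rewrite indicE mem_set.
by rewrite indicE memNset// => -[_]; exact/negP.
Qed.

Let polar_meas (G : 'cV[R]_m -> R) : continuous G ->
  measurable_fun setT (fun p : @borel_cV R m * R =>
    (chi_pdf m p.2 * \1_[set z | G z <= 0] (Z p : 'cV[R]_m))%:E).
Proof.
move=> cG; apply/measurable_EFinP; apply: measurable_funM => //.
exact: measurable_polar_fun.
Qed.

Let polar_ge0 (G : 'cV[R]_m -> R) (p : @borel_cV R m * R) :
  (0 <= (chi_pdf m p.2 * \1_[set z | G z <= 0] (Z p : 'cV[R]_m))%:E)%E.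
Proof. by rewrite lee_fin mulr_ge0 ?chi_pdf_ge0. Qed.

Lemma measurable_chi_prob_polar (G : 'cV[R]_m -> R) : continuous G ->
  measurable_fun setT (fun v : @borel_cV R m =>
    chi_prob m [set r : R | (0 <= r)%R /\ (G (r *: (v : 'cV[R]_m)) <= 0)%R]).
Proof.
move=> cG; under eq_fun do rewrite chi_prob_polarE.
exact: (@measurable_fun_fubini_tonelli_F _ _ _ _ _ lebesgue_measure _
  (polar_meas cG) (@polar_ge0 G)).
Qed.

(** Equality on bumps gives equality on continuous functions, hence on the open set where [G] is
    positive. Both sides have mass 1, so the closed sublevel set follows by complement. *)
Lemma gaussian_polar (G : 'cV[R]_m -> R) : continuous G ->
  (gamma [set z : 'cV[R]_m | (G z <= 0)%R] =
   \int[mu]_v chi_prob m [set r : R | (0 <= r)%R /\ (G (r *: (v : 'cV[R]_m)) <= 0)%R])%E.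
Proof.
move=> cG.
have chi0 (p : @borel_cV R m * R) : 0 <= chi_pdf m p.2 by exact: chi_pdf_ge0.
have W (f : 'cV[R]_m -> R) : continuous f -> (forall a, 0 <= f a <= 1) ->
    (\int[nu]_p (chi_pdf m p.2 * f (Z p))%:E = \int[gamma]_z (f z)%:E)%E.
  move=> cf f01; have [nuS nuE] := sigma_finite_measure_of (sigma_finite_prod mu).
  have {}nuE : (mu \x (@lebesgue_measure R))%E = nuS :> (set _ -> \bar R).
    exact: (congr1 (@Measure.sort _ _ _) nuE).
  rewrite nuE.
  apply: (@gauss_bump_determines R m _ _ nuS gamma
    (fun p : @borel_cV R m * R => chi_pdf m p.2) Z f Hg mchi chi0 mZ _ cf f01).
  by move=> s b s0; rewrite -nuE; exact: polar_bump.
have c01 (a : 'cV[R]_m) : 0 <= (cst 1 a : R) <= 1 by rewrite ler01 lexx.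
have O1 := @weak_eq_open R m (cst 1) G _ _ nu gamma _ _ (@cst_continuous _ _ _)
  c01 cG mchi chi0 mZ W.
have T1 := W (cst 1) (@cst_continuous _ _ _) c01.
have gT (c : R) : (\int[gamma]_z (cst c%:E z) = c%:E)%E.
  by rewrite integral_cst// [X in (_ * X)%E](probability_setT gamma) mule1.
have {}T1 : (\int[nu]_p (chi_pdf m p.2)%:E = 1)%E.
  transitivity (\int[nu]_p (chi_pdf m p.2 * 1)%:E)%E.
    by apply: eq_integral => p _; rewrite mulr1.
  by apply: etrans T1 _; exact: gT.
pose C := [set z : @borel_cV R m | G z <= 0].
have mC : measurable C.
  rewrite (_ : C = (G : @borel_cV R m -> R) @^-1` `]-oo, 0]).
    rewrite -[X in measurable X]setTI.
    by apply: (continuous_borel_measurable cG) => //; exact: measurable_itv.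
  by apply/seteqP; split => z /=; rewrite in_itv.
pose B := [set z : @borel_cV R m | 0 < G z].
have CB : C = ~` B.
  by apply/seteqP; split => z; rewrite /C /B /= leNgt => /negP.
have mB : measurable B by rewrite -[B]setCK -CB; exact: measurableC.
have {}O1 : (\int[nu]_p (chi_pdf m p.2 * \1_B (Z p))%:E = gamma B)%E.
  transitivity (\int[nu]_p (chi_pdf m p.2 * (cst 1 (Z p) * \1_B (Z p)))%:E)%E.
    by apply: eq_integral => p _; rewrite mul1r.
  apply: etrans O1 _.
  apply: etrans _ (integral_indicT gamma mB).
  by apply: eq_integral => z _; rewrite mul1r.
have mBZ : measurable_fun setT (fun p : @borel_cV R m * R => \1_B (Z p) : R).
  apply: (@measurableT_comp _ _ _ _ _ _ (\1_B : @borel_cV R m -> R) _ Z) => //.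
have S1 : (\int[nu]_p (chi_pdf m p.2 * \1_B (Z p))%:E +
           \int[nu]_p (chi_pdf m p.2 * \1_C (Z p))%:E = 1)%E.
  rewrite -ge0_integralD//.
  - rewrite -T1; apply: eq_integral => p _; rewrite -EFinD -mulrDr !indic_bool.
    by case: ltP => _; rewrite ?addr0 ?add0r mulr1.
  - by move=> p _; rewrite lee_fin mulr_ge0.
  - by apply/measurable_EFinP; exact: measurable_funM.
  - by move=> p _; exact: polar_ge0.
  - exact: polar_meas.
have -> : (gamma C = \int[nu]_p (chi_pdf m p.2 * \1_C (Z p))%:E)%E.
  have gB : gamma B \is a fin_num by exact: fin_num_measure.
  rewrite CB; apply: etrans (probability_setC gamma mB) _.
  by rewrite -CB -S1 O1 [X in (X - _)%E]addeC addeK.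
apply: etrans (@fubini_tonelli1 _ _ _ _ _ mu lebesgue_measure _ (polar_meas cG) (@polar_ge0 G)) _.
by apply: eq_integral => v _; rewrite chi_prob_polarE.
Qed.

End polar.

Lemma continuous_cV (R : realType) (m : nat) (U : topologicalType)
    (u : U -> 'cV[R]_m) :
  (forall i, continuous (fun x => u x i 0)) -> continuous u.
Proof.
move=> cu x A /nbhs_ballP[e /= e0 eA]; rewrite /nbhs/=.
have H : \forall y \near x, forall i, `|u x i 0 - u y i 0| < e.
  by apply: filter_forall => i; have /cvgrPdist_lt/(_ e e0) := cu i x.
apply: filterS H => y Hy; apply: eA; split=> // i j.
by rewrite (ord1 j); exact: Hy.
Qed.

Lemma continuous_mulmx (R : realType) (m : nat) (M : 'M[R]_m) :
  continuous (fun z : 'cV[R]_m => M *m z).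
Proof.
apply: continuous_cV => i.
have -> : (fun z : 'cV[R]_m => (M *m z) i 0) = (fun z => \sum_(j < m) M i j * z j 0).
  by apply/funext => z; rewrite mxE.
apply: continuous_big => [|j _]; first exact: add_continuous.
move=> z; apply: (@continuous_comp _ _ _ (fun z : 'cV[R]_m => z j 0) (fun t : R => M i j * t)).
  exact: coord_continuous.
exact: mulrl_continuous.
Qed.

Lemma measurable_ray (R : realType) (m : nat) (G : 'cV[R]_m -> R)
    (v : 'cV[R]_m) : continuous G ->
  measurable [set r : R | (0 <= r) /\ (G (r *: v) <= 0)].
Proof.
move=> cG; rewrite (_ : [set r | _] = `[0, +oo[ `&` (fun r => G (r *: v)) @^-1` `]-oo, 0]).
  apply: measurableI => //; rewrite -[X in measurable X]setTI.
  have : measurable_fun setT (fun r : R => G (r *: v)).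
    apply: continuous_measurable_fun => r.
    apply: (@continuous_comp _ _ _ (fun r : R => r *: v) G); last exact: cG.
    apply: continuous_cV => i; under eq_fun do rewrite mxE.
    exact: mulrr_continuous.
  by apply => //; exact: measurable_itv.
by apply/seteqP; split => r /=; rewrite !in_itv/= andbT.
Qed.

Lemma chi_prob_setT (R : realType) (m : nat)
    (gamma : probability (@borel_cV R m) R) : standard_normal gamma ->
  (0 < m)%N -> (@chi_prob R m setT = 1)%E.
Proof.
move=> Hg m0; rewrite chi_probE.
transitivity (\int[@lebesgue_measure R]_r (chi_pdf m r * (cst 1 r : R))%:E)%E.
  by apply: eq_integral => r _; rewrite indicT.
have mc : measurable_fun [set: R] (cst 1 : R -> R) by exact: measurable_cst.
rewrite -(radial_law_full Hg m0 mc (fun=> ler01)).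
transitivity (\int[gamma]_z (cst 1%E z))%E => //.
by rewrite integral_cst// mul1e; exact: probability_setT.
Qed.

Lemma chi_prob_le1 (R : realType) (m : nat)
    (gamma : probability (@borel_cV R m) R) (A : set R) : standard_normal gamma ->
  (0 < m)%N -> measurable A -> (0 <= @chi_prob R m A <= 1)%E.
Proof.
move=> Hg m0 mA; apply/andP; split.
  by apply: integral_ge0 => r _; rewrite lee_fin chi_pdf_ge0.
rewrite -(chi_prob_setT Hg m0); apply: ge0_subset_integral => //.
- by apply/measurable_EFinP; exact: measurable_chi_pdf.
- by move=> r _; rewrite lee_fin chi_pdf_ge0.
Qed.

Section prob_fun_polar.
Context {R : realType} {X : normedModType R} {m : nat}.
Variables (g : X -> 'cV[R]_m -> R) (Sigma L : 'M[R]_m).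
Context d (Omega : measurableType d).
Variables (P : probability Omega R) (xi : {RV P >-> @borel_cV R m})
  (mu : probability (@borel_cV R m) R) (y : X).
Hypotheses (m0 : (0 < m)%N) (hL : L \in unitmx) (hSL : Sigma = L *m L^T)
  (hxi : centered_normal Sigma (distribution P xi)) (Hmu : uniform_on_sphere mu)
  (cg : continuous (g y)).

Let E (v : 'cV[R]_m) :=
  chi_prob m [set r : R | 0 <= r /\ g y (r *: (L *m v)) <= 0].

Let cGL : continuous (fun z => g y (L *m z)).
Proof.
move=> z; apply: (@continuous_comp _ _ _ (fun z : 'cV[R]_m => L *m z) (g y)).
  exact: continuous_mulmx.
exact: cg.
Qed.

Let EE v : E v = chi_prob m [set r : R | 0 <= r /\ g y (L *m (r *: v)) <= 0].
Proof.
by rewrite /E; congr chi_prob; apply/seteqP; split=> r /=; rewrite scalemxAr.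
Qed.

Let E01 v : (0 <= E v <= 1)%E.
Proof.
have [M [gamma [_ Hg _]]] := hxi.
by rewrite EE; apply: (chi_prob_le1 Hg m0); exact: (measurable_ray v cGL).
Qed.

Lemma radial_prob_itv v : 0 <= radial_prob g L y v <= 1.
Proof.
have /andP[h0 h1] := E01 v; rewrite /radial_prob -/(E v).
rewrite fine_ge0//= -lee_fin fineK//.
by rewrite ge0_fin_numE// (le_lt_trans h1)// ltry.
Qed.

Let EfinE v : (radial_prob g L y v)%:E = E v.
Proof.
have /andP[h0 h1] := E01 v; rewrite /radial_prob -/(E v) fineK//.
by rewrite ge0_fin_numE// (le_lt_trans h1)// ltry.
Qed.

Let mE : measurable_fun setT (E : @borel_cV R m -> \bar R).
Proof.
rewrite (_ : E = fun v => chi_prob m [set r : R | 0 <= r /\ g y (L *m (r *: v)) <= 0]).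
  exact: (measurable_chi_prob_polar cGL).
by apply/funext => v; exact: EE.
Qed.

Lemma measurable_radial_prob :
  measurable_fun setT (radial_prob g L y : @borel_cV R m -> R).
Proof.
apply/measurable_EFinP; rewrite (_ : _ \o _ = E)//.
by apply/funext => v; exact: EfinE.
Qed.

Lemma prob_fun_polar :
  prob_fun g P xi y = \int[mu]_(v in sphere) radial_prob g L y v.
Proof.
have [M [gamma [SM Hg HM]]] := hxi.
(* The law is that of [M *m z] with [M *m M^T = L *m L^T], so [M] is [L] times an orthogonal matrix,
   which the uniform law absorbs. *)
pose Q := invmx L *m M.
have MQ : M = L *m Q by rewrite mulmxA mulmxV// mul1mx.
have QQ : Q *m Q^T = 1%:M.
  rewrite /Q trmx_mul mulmxA -(mulmxA _ M) -SM hSL mulmxA mulVmx// mul1mx.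
  by rewrite -trmx_mul mulVmx// trmx1.
have cGM : continuous (fun z => g y (M *m z)).
  move=> z; apply: (@continuous_comp _ _ _ (fun z : 'cV[R]_m => M *m z) (g y)).
    exact: continuous_mulmx.
  exact: cg.
have mB : measurable [set z : @borel_cV R m | g y z <= 0].
  rewrite (_ : [set z | _] = (g y : @borel_cV R m -> R) @^-1` `]-oo, 0]).
    rewrite -[X in measurable X]setTI.
    by apply: (continuous_borel_measurable cg) => //; exact: measurable_itv.
  by apply/seteqP; split => z /=; rewrite in_itv.
have key : (P [set w | (g y (xi w) <= 0)%R] = \int[mu]_v E v)%E.
  apply: etrans (HM _ mB) _; apply: etrans (gaussian_polar Hg Hmu m0 cGM) _.
  have E0 v : (0 <= E v)%E by case/andP: (E01 v).
  rewrite -(ge0_integral_orthogonal Hmu QQ mE E0).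
  apply: eq_integral => v _; rewrite EE; congr chi_prob.
  by apply/seteqP; split => r /=; rewrite MQ -mulmxA scalemxAr.
have E0 v : (0 <= E v)%E by case/andP: (E01 v).
rewrite /prob_fun key (ge0_integral_sphere Hmu mE E0) /Rintegral.
by congr fine; apply: eq_integral => v _; rewrite EfinE.
Qed.

End prob_fun_polar.

(** * Lipschitz dependence of the radial probabilities *)

Definition chi_scale {R : realType} (m : nat) : R :=
  (\int[lebesgue_measure]_(s in `[0, +oo[)
    (s ^+ m.-1 * expR (- (s ^+ 2 / 2))))^-1.

(** * Tail and annulus estimates for the Chi distribution *)

Section chi_bounds.
Context {R : realType}.
Variable m : nat.
Hypothesis m0 : (0 < m)%N.

Lemma chi_weight_cvg0 : r ^+ m * expR (- (r ^+ 2 / 2)) @[r --> +oo] --> (0 : R).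
Proof.
apply/cvgrPdist_le => e e0.
near=> r.
have r1 : 1 <= r by near: r; apply: nbhs_pinfty_ge; exact: num_real.
have r0 : 0 < r by exact: lt_le_trans r1.
rewrite sub0r normrN ger0_norm; last by rewrite mulr_ge0 ?expR_ge0 ?exprn_ge0 ?(ltW r0).
(* The term of degree [m] in the series of [expR (r ^+ 2 / 2)] is [r ^+ m * r ^+ m / a]; one factor
   cancels the power and the other tends to infinity. *)
pose a : R := 2 ^+ m * m`!%:R.
have a0 : 0 < a by rewrite mulr_gt0 ?exprn_gt0// ltr0n fact_gt0.
have Hm : r ^+ m * r ^+ m / a <= expR (r ^+ 2 / 2).
  have h : 0 <= r ^+ 2 / 2 by rewrite divr_ge0// sqr_ge0.
  apply: le_trans (expR_ge1Dxn m.-1 h); rewrite prednK//.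
  rewrite ler_wpDl// /a expr_div_n -exprM mulnC exprM expr2 invfM mulrA//.
have Hr : a / e <= r by near: r; apply: nbhs_pinfty_ge; exact: num_real.
have rm : r <= r ^+ m by rewrite -[leLHS]expr1 ler_weXn2l.
have rm0 : 0 < r ^+ m by rewrite exprn_gt0.
rewrite expRN ler_pdivrMr ?expR_gt0//.
apply: le_trans (ler_wpM2l (ltW e0) Hm).
rewrite ler_pdivrMr// in Hr.
have h2 : a <= r ^+ m * e by rewrite (le_trans Hr)// ler_wpM2r// ltW.
rewrite (_ : e * _ = r ^+ m * (r ^+ m * e / a)); last by ring.
by rewrite -[leLHS]mulr1 ler_wpM2l ?(ltW rm0)// ler_pdivlMr// mul1r.
Unshelve. all: by end_near. Qed.

Let kappa : R := chi_scale m.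

Lemma chi_scale_ge0 : 0 <= chi_scale m :> R.
Proof.
rewrite /chi_scale invr_ge0; apply: Rintegral_ge0 => s; rewrite /= in_itv/= andbT => s0.
by rewrite mulr_ge0 ?expR_ge0// exprn_ge0.
Qed.

Let kappa0 : 0 <= kappa := chi_scale_ge0.

Lemma chi_pdf_nneg (r : R) : 0 <= r ->
  chi_pdf m r = chi_scale m * (r ^+ m.-1 * expR (- (r ^+ 2 / 2))).
Proof. by move=> r0; rewrite /chi_pdf r0 mulrC. Qed.

Let dq (r : R) : is_derive r 1 (fun r => - (r ^+ m * expR (- (r ^+ 2 / 2))))
  ((r ^+ m.+1 - m%:R * r ^+ m.-1) * expR (- (r ^+ 2 / 2))).
Proof.
have d1 n : is_derive r 1 (fun r : R => r ^+ n) (n%:R * r ^+ n.-1).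
  have := @is_deriveX R R^o id n r 1 1 _.
  by rewrite exprfctE /GRing.scale/= mulr1; apply; exact: is_derive_id.
have d2 : is_derive r 1 (fun r : R => - (r ^+ 2 / 2)) (- r).
  have h := @is_deriveM R R^o (fun r : R => r ^+ 2) (cst 2^-1) r 1 _ _ (d1 2) (is_derive_cst _ _ _).
  have := is_deriveN h; rewrite /GRing.scale/= mulr0 add0r => h'.
  by apply: is_derive_eq h' _; field.
have d3 : is_derive r 1 (fun r : R => expR (- (r ^+ 2 / 2))) (- r * expR (- (r ^+ 2 / 2))).
  have := @is_derive1_comp R expR (fun r : R => - (r ^+ 2 / 2)) r _ _ (is_derive_expR _) d2.
  by rewrite mulrC.
have h := is_deriveN (@is_deriveM R R^o _ _ r 1 _ _ (d1 m) d3).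
apply: is_derive_eq h _; rewrite /GRing.scale/=.
have alg (a b c e : R) : - (a * (- r * e) + e * (c * b)) = (a * r - c * b) * e.
  by ring.
by rewrite (exprSr r m); exact: alg.
Qed.

(** The function [- (r ^+ m * expR (- (r ^+ 2 / 2)))] has derivative [f], which dominates the
    unnormalized density once [m.+1%:R <= s ^+ 2]; its increment up to infinity is the bound. *)
Lemma chi_tail (r : R) : 0 < r -> m.+1%:R <= r ^+ 2 ->
  (chi_prob m `[r, +oo[ <= (chi_scale m * (r ^+ m * expR (- (r ^+ 2 / 2))))%:E)%E.
Proof.
move=> r0 mr.
have s0 s : r <= s -> 0 < s by exact: lt_le_trans.
have pos s : r <= s -> s ^+ m.-1 <= s ^+ m.+1 - m%:R * s ^+ m.-1.
  move=> rs; have -> : s ^+ m.+1 = s ^+ 2 * s ^+ m.-1.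
    by rewrite -exprD addnC addn2 prednK.
  rewrite -mulrBl -[leLHS]mul1r ler_wpM2r ?exprn_ge0 ?(ltW (s0 _ rs))//.
  rewrite lerBrDr addrC natr1 (le_trans mr)// lerXn2r// ?nnegrE ?(ltW r0)//.
  exact: ltW (s0 _ rs).
pose f (s : R) := (s ^+ m.+1 - m%:R * s ^+ m.-1) * expR (- (s ^+ 2 / 2)).
have f0 s : r <= s -> 0 <= f s.
  move=> rs; rewrite mulr_ge0 ?expR_ge0// (le_trans _ (pos _ rs))//.
  by rewrite exprn_ge0// ltW// s0.
have cf : continuous f.
  move=> s; apply: (@continuousM R _ (fun s : R => s ^+ m.+1 - m%:R * s ^+ m.-1)).
    apply: (@continuousB _ R^o R^o); first exact: exprn_continuous.
    by apply: (@continuousM R _ (cst (m%:R))); [exact: cvg_cst|exact: exprn_continuous].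
  apply: (@continuous_comp _ _ _ (fun s : R => - (s ^+ 2 / 2)) expR); last exact: continuous_expR.
  apply: (@continuousN _ R^o R^o (fun s : R => s ^+ 2 / 2)).
  apply: (@continuousM R _ (fun s : R => s ^+ 2) (cst 2^-1)); last exact: cvg_cst.
  exact: exprn_continuous.
have mf : measurable_fun setT f by exact: continuous_measurable_fun.
pose F (s : R) : R := - (s ^+ m * expR (- (s ^+ 2 / 2))).
have cF (s : R) : {for s, continuous F}.
  by apply: (@differentiable_continuous _ R^o R^o); apply/derivable1_diffP; have [] := dq s.
have key : (\int[lebesgue_measure]_(s in `[r, +oo[) (f s)%:E)%E =
  (r ^+ m * expR (- (r ^+ 2 / 2)))%:E.
  rewrite (@ge0_continuous_FTC2y R f F r 0)//.
  - by rewrite sub0e -EFinN opprK.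
  - exact: continuous_subspaceT.
  - by rewrite -oppr0; apply: (@cvgN _ R^o); exact: chi_weight_cvg0.
  - by move=> s _; have [] := dq s.
  - by apply: cvg_at_right_filter; exact: cF.
  - by move=> s _; rewrite derive1E; have [_ ->] := dq s.
have mk : measurable_fun `[r, +oo[ (fun s : R => (kappa * f s)%:E).
  apply/measurable_EFinP; apply: measurable_funTS; apply: measurable_funM => //.
have : (chi_prob m `[r, +oo[ <= \int[lebesgue_measure]_(s in `[r, +oo[) (kappa * f s)%:E)%E.
  apply: ge0_le_integral => //.
  - by move=> s _; rewrite lee_fin chi_pdf_ge0.
  - by apply/measurable_EFinP; apply: measurable_funTS; exact: measurable_chi_pdf.
  - move=> s; rewrite /= in_itv/= andbT => rs; rewrite lee_fin chi_pdf_nneg ?(ltW (s0 _ rs))//.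
    by rewrite ler_wpM2l// ler_wpM2r ?expR_ge0// pos.
move/le_trans; apply.
rewrite EFinM -key; under eq_integral do rewrite EFinM.
rewrite ge0_integralZl//.
- by apply/measurable_EFinP; apply: measurable_funTS.
- by move=> s; rewrite /= in_itv/= andbT => rs; rewrite lee_fin f0.
Qed.

(** On this interval [s <= 2 * r], whence the power of 2, and the exponential factor is largest at
    [r]. *)
Lemma chi_annulus (r u : R) : 0 < r -> 0 <= u <= r ->
  (chi_prob m `[r, (r + u)%R] <=
   (chi_scale m * 2 ^+ m.-1 * u * (r ^+ m.-1 * expR (- (r ^+ 2 / 2))))%:E)%E.
Proof.
move=> r0 /andP[u0 ur].
have : (chi_prob m `[r, (r + u)%R] <=
  \int[lebesgue_measure]_(s in `[r, (r + u)%R]) cst (kappa * (2 ^+ m.-1 * (r ^+ m.-1 * expR (- (r ^+ 2 / 2)))))%:E s)%E.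
  apply: ge0_le_integral => //.
  - by move=> s _; rewrite lee_fin chi_pdf_ge0.
  - by apply/measurable_EFinP; apply: measurable_funTS; exact: measurable_chi_pdf.
  - move=> s; rewrite /= in_itv/= => /andP[rs sr].
    have s0 : 0 <= s by rewrite (le_trans (ltW r0)).
    rewrite lee_fin chi_pdf_nneg// ler_wpM2l// mulrA ler_pM ?expR_ge0 ?exprn_ge0//.
      by rewrite -exprMn lerXn2r ?nnegrE// ?mulr_ge0// ?(ltW r0)//; lra.
    by rewrite ler_expR lerN2 ler_wpM2r// lerXn2r// nnegrE ltW.
move/le_trans; apply.
rewrite integral_cst//= lebesgue_measure_itv/= lte_fin.
case: ifPn => h; first by rewrite -EFinB -EFinM lee_fin /kappa
  le_eqVlt; apply/orP; left; apply/eqP; ring.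
by rewrite mule0 lee_fin !mulr_ge0// ?exprn_ge0 ?expR_ge0// ltW.
Qed.

Lemma chi_probU (A B : set R) : measurable A -> measurable B ->
  (chi_prob m (A `|` B) <= chi_prob m A + chi_prob m B)%E.
Proof.
move=> mA mB.
have mc D : measurable_fun D (fun r : R => (chi_pdf m r)%:E).
  by apply/measurable_EFinP; apply: measurable_funTS; exact: measurable_chi_pdf.
have -> : A `|` B = A `|` (B `\` A).
  apply/seteqP; split => r [|]; [by left| |by left|by case; right].
  by have [|] := pselect (A r); [left|right].
rewrite /chi_prob ge0_integral_setU//; last 4 first.
- exact: measurableD.
- exact: mc.
- by move=> r _; rewrite lee_fin chi_pdf_ge0.
- by apply/disj_setPS => r [Ar []].
rewrite leeD2l//; apply: ge0_subset_integral => //; [exact: measurableD|exact: mc|].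
by move=> r _; rewrite lee_fin chi_pdf_ge0.
Qed.

Lemma chi_prob_mono (A B : set R) : measurable A -> measurable B -> A `<=` B ->
  (chi_prob m A <= chi_prob m B)%E.
Proof.
move=> mA mB AB; apply: ge0_subset_integral => //.
  by apply/measurable_EFinP; apply: measurable_funTS; exact: measurable_chi_pdf.
by move=> r _; rewrite lee_fin chi_pdf_ge0.
Qed.

(* Along a ray, the sublevel set of [phi] is an interval [0, r], and the
   endpoint of that of [psi] exceeds r by at most a factor 1 / (1 - e / c0)
   where e bounds [phi r - psi r]. The weight absorbs the growth of e as
   r tends to infinity, since the Chi density decays like its inverse. *)
Lemma chi_prob_ray_comparison (phi psi : R -> R) (c0 D R1 : R) :
  @chi_prob R m setT = 1%E ->
  0 < c0 -> 0 <= D -> 0 < R1 -> m.+1%:R <= R1 ^+ 2 ->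
  continuous phi -> continuous psi ->
  (forall a r : R, 0 <= a <= 1 -> phi (a * r) <= (1 - a) * phi 0 + a * phi r) ->
  (forall a r : R, 0 <= a <= 1 -> psi (a * r) <= (1 - a) * psi 0 + a * psi r) ->
  phi 0 <= - c0 -> psi 0 <= - c0 ->
  (forall r : R, 0 < r -> phi r = 0 ->
     - psi r <= D / (if r <= R1 then 1 else r ^+ m * expR (- (r ^+ 2 / 2)))) ->
  (chi_prob m [set r | (0 <= r)%R /\ (psi r <= 0)%R] <=
   chi_prob m [set r | (0 <= r)%R /\ (phi r <= 0)%R] +
   (2 / c0 * (1 + chi_scale m + chi_scale m * 2 ^+ m.-1 * (R1 ^+ m + 1)) * D)%:E)%E.
Proof.
move=> chi1 c00 D0 R10 mR1 cphi cpsi Cphi Cpsi phi0 psi0 H.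
have mset (f : R -> R) : continuous f ->
    measurable [set r : R | (0 <= r)%R /\ (f r <= 0)%R].
  move=> cf; rewrite (_ : [set r | _] = `[0, +oo[ `&` f @^-1` `]-oo, 0]).
    apply: measurableI => //; rewrite -[X in measurable X]setTI.
    by apply: (continuous_measurable_fun cf) => //; exact: measurable_itv.
  by apply/seteqP; split => r /=; rewrite !in_itv/= andbT.
have mphi := mset _ cphi; have mpsi := mset _ cpsi.
have chile1 A : measurable A -> (@chi_prob R m A <= 1)%E.
  by move=> mA; rewrite -chi1; exact: chi_prob_mono.
(* The summand containing [R1] pays for a short displacement of the endpoint (annulus), and
   [1 + chi_scale m] for a long one (tail). *)
set C := (X in (X * D)%:E).
have C0 : 0 <= C * D.
  rewrite mulr_ge0// /C mulr_ge0// ?divr_ge0 ?(ltW c00)//.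
  by rewrite !addr_ge0 ?mulr_ge0 ?exprn_ge0 ?addr_ge0 ?exprn_ge0 ?(ltW R10).
have [allphi|] := pselect (forall r, 0 <= r -> phi r <= 0).
  apply: (@le_trans _ _ (chi_prob m [set r | (0 <= r)%R /\ (phi r <= 0)%R])).
    by apply: chi_prob_mono => // r [r0 _]; split => //; exact: allphi.
  by rewrite leeDl// lee_fin.
move=> /existsNP[s0 /not_implyP[s00 /negP]]; rewrite -ltNge => phis0.
have [r] : exists2 r, r \in `[0, s0] & phi r = 0.
  apply: IVT => //; first exact: continuous_subspaceT.
  by rewrite ge_min le_max (ltW phis0) (le_trans phi0) ?oppr_le0 ?(ltW c00)// orbT.
rewrite in_itv/= => /andP[r0 _] phir.
have {r0} r0 : 0 < r.
  rewrite lt_neqAle r0 andbT; apply/eqP => r00; move: phi0.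
  by rewrite r00 phir lerNr oppr0 leNgt c00.
have sub0 s : 0 <= s <= r -> phi s <= 0.
  move=> /andP[s1 sr].
  have := Cphi (s / r) r; rewrite divfK ?gt_eqF// phir mulr0 addr0.
  rewrite divr_ge0 ?(ltW r0)// ler_pdivrMr// mul1r sr => /(_ isT)/le_trans; apply.
  rewrite mulr_ge0_le0// ?subr_ge0 ?ler_pdivrMr ?mul1r//.
  by rewrite (le_trans phi0)// oppr_le0 ltW.
set W := (if r <= R1 then 1 else r ^+ m * expR (- (r ^+ 2 / 2))) in H *.
have HW := H r r0 phir; rewrite -/W in HW.
set e := D / W in HW.
have W0 : 0 < W.
  by rewrite /W; case: ifP => // _; rewrite mulr_gt0 ?expR_gt0// exprn_gt0.
have e0 : 0 <= e by rewrite divr_ge0// ltW.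
have De : D = e * W by rewrite /e divfK// gt_eqF.
(* Convexity of [psi] on [[0, s]], read at [r]: the value there is at least [- e], while a
   combination of [- c0] and a nonpositive number lies below that unless [s] is close to [r]. *)
have far s : r < s -> psi s <= 0 -> (s - r) * c0 <= e * s.
  move=> rs psis; have s1 : 0 < s by exact: lt_trans rs.
  have := Cpsi (r / s) s; rewrite divfK ?gt_eqF// divr_ge0 ?(ltW s1) ?(ltW r0)//.
  rewrite ler_pdivrMr// mul1r (ltW rs) => /(_ isT) h.
  have h1 : (1 - r / s) * psi 0 <= - ((1 - r / s) * c0).
    by rewrite -(mulrN (1 - r / s)) ler_wpM2l// subr_ge0 ler_pdivrMr// mul1r ltW.
  have h2 : r / s * psi s <= 0 by rewrite mulr_ge0_le0// divr_ge0 ?(ltW s1) ?(ltW r0).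
  have h3 : (1 - r / s) * c0 <= e by lra.
  rewrite -(ler_pM2r s1) in h3; apply: le_trans h3.
  by rewrite (_ : _ * s = (s - r) * c0)//; field; rewrite gt_eqF.
have mitv : measurable `[0, r] by exact: measurable_itv.
have chiphi : (chi_prob m `[0%R, r] <= chi_prob m [set r | (0 <= r)%R /\ (phi r <= 0)%R])%E.
  apply: chi_prob_mono => // s /=; rewrite in_itv/= => s0r.
  by split; [case/andP: s0r|exact: sub0].
have split_le (B : set R) x : measurable B ->
    (forall s, r < s -> psi s <= 0 -> B s) -> (chi_prob m B <= x%:E)%E -> x <= C * D ->
    (chi_prob m [set r | (0 <= r)%R /\ (psi r <= 0)%R] <=
     chi_prob m [set r | (0 <= r)%R /\ (phi r <= 0)%R] + (C * D)%:E)%E.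
  move=> mB HB cB xC.
  apply: (@le_trans _ _ (chi_prob m (`[0%R, r] `|` B))).
    apply: chi_prob_mono => //; first exact: measurableU.
    move=> s [s1 psis]; have [sr|rs] := leP s r; last by right; exact: HB.
    by left; rewrite /= in_itv/= s1.
  apply: le_trans (chi_probU mitv mB) _; apply: leeD => //.
  by rewrite (le_trans cB)// lee_fin.
(* Both regimes of [W] at once: the Chi weight at [r] is at most a constant times [W]. *)
have q1 : r ^+ m * expR (- (r ^+ 2 / 2)) <= (R1 ^+ m + 1) * W.
  rewrite /W; case: ifP => rR1.
    rewrite mulr1 ler_wpDr// -[leRHS]mulr1 ler_pM ?exprn_ge0 ?expR_ge0 ?(ltW r0)//.
      by rewrite lerXn2r// nnegrE ltW.
    by rewrite expR_le1 oppr_le0 divr_ge0// sqr_ge0.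
  rewrite mulrDl mul1r ler_wpDl// !mulr_ge0 ?expR_ge0 ?exprn_ge0 ?(ltW r0)//.
  exact: ltW.
have c2 : 0 <= 2 / c0 by rewrite divr_ge0// ltW.
(* For [e <= c0 / 2], [far] confines [s] below [r + 2 * r * e / c0], which is at most [2 * r], and
   the annulus estimate applies. Otherwise [2 / c0 * e] is at least 1, so even the whole tail beyond
   [r] is affordable. *)
have [ec|ec] := leP e (c0 / 2).
  have u0 : 0 <= 2 * r * e / c0.
    by rewrite divr_ge0 ?(ltW c00)// mulr_ge0// mulr_ge0// ltW.
  have ur : 2 * r * e / c0 <= r by rewrite ler_pdivrMr//; nra.
  apply: (split_le `[r, (r + 2 * r * e / c0)%R]%classic (chi_scale m * 2 ^+ m.-1 *
      (2 * r * e / c0) * (r ^+ m.-1 * expR (- (r ^+ 2 / 2))))).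
  - exact: measurable_itv.
  - move=> s rs psis; have := far s rs psis => h.
    rewrite /= in_itv/= (ltW rs)/= -lerBlDl ler_pdivlMr//.
    by nra.
  - by apply: chi_annulus => //; rewrite u0.
  - rewrite [leLHS](_ : _ = 2 / c0 * (chi_scale m * 2 ^+ m.-1) * e * (r ^+ m * expR (- (r ^+ 2 / 2)))); last first.
      have -> : r ^+ m = r * r ^+ m.-1 by rewrite -exprS prednK.
      by field; rewrite gt_eqF.
    apply: (@le_trans _ _ (2 / c0 * (chi_scale m * 2 ^+ m.-1) * e * ((R1 ^+ m + 1) * W))).
      by rewrite ler_wpM2l// mulr_ge0// mulr_ge0// mulr_ge0// exprn_ge0.
    rewrite De /C.
    rewrite [leLHS](_ : _ = 2 / c0 * (chi_scale m * 2 ^+ m.-1 * (R1 ^+ m + 1)) * (e * W)); last first.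
      by field; rewrite gt_eqF.
    apply: ler_wpM2r; first by rewrite mulr_ge0// ltW.
    apply: ler_wpM2l => //.
    by rewrite ler_wpDl// addr_ge0.
have ec' : 1 <= 2 / c0 * e by rewrite mulrAC ler_pdivlMr//; lra.
apply: (split_le `[r, +oo[%classic (W * (1 + chi_scale m))).
- exact: measurable_itv.
- by move=> s rs _; rewrite /= in_itv/= andbT ltW.
- rewrite /W; case: ifPn => rR1.
    rewrite mul1r (le_trans (chile1 _ (measurable_itv _)))// lee_fin.
    by rewrite ler_wpDr.
  rewrite -ltNge in rR1.
  apply: le_trans (chi_tail r0 _) _.
    rewrite (le_trans mR1)// lerXn2r// ?nnegrE ?ltW//.
  rewrite lee_fin mulrC ler_wpM2l ?mulr_ge0 ?expR_ge0 ?exprn_ge0 ?(ltW r0)//.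
  by rewrite ler_wpDl.
- rewrite De /C.
  set k := chi_scale m; set b := k * 2 ^+ m.-1 * _.
  have k0 : 0 <= k by [].
  have b0 : 0 <= b by rewrite !mulr_ge0 ?exprn_ge0// addr_ge0// exprn_ge0// ltW.
  have : W * (1 + k) <= (2 / c0 * e) * (W * (1 + k)).
    by rewrite ler_peMl// mulr_ge0 ?addr_ge0// ltW.
  move/le_trans; apply.
  rewrite [leLHS](_ : _ = 2 / c0 * e * W * (1 + k)); last by rewrite mulrA.
  rewrite [leRHS](_ : _ = 2 / c0 * e * W * (1 + k + b)); last first.
    by rewrite /b; field; rewrite gt_eqF.
  apply: ler_wpM2l; last by rewrite ler_wpDr.
  by rewrite mulr_ge0 ?(ltW W0)// mulr_ge0.
Qed.

End chi_bounds.

(** A mean value inequality, proved by advancing along the segment: [S] collects the points reached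
    with slope at most [C + eta]. A bound on the directional derivative controls quotients based at
    all nearby points, so a step may start at an element of [S] just below the supremum and pass
    beyond it. *)
Lemma clarke_increment (R : realType) (X : normedModType R) (f : X -> R)
    (a h : X) (C : R) :
  (forall s : R, 0 <= s <= 1 -> (clarke_deriv f (a + s *: h)%R h <= C%:E)%E) ->
  f (a + h) - f a <= C.
Proof.
move=> H; apply/ler_addgt0Pr => eta eta0.
pose psi s := f (a + s *: h).
have loc s : 0 <= s <= 1 -> exists2 rho : R, 0 < rho & forall s' t : R,
    `|s - s'| < rho -> 0 < t < rho -> psi (s' + t) - psi s' <= t * (C + eta).
  move=> s01; have : (clarke_deriv f (a + s *: h)%R h < (C + eta)%:E)%E.
    by rewrite (le_lt_trans (H s s01))// lte_fin ltrDl.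
  rewrite /clarke_deriv limf_esupE => /ereal_inf_lt[_ [V FV <-]] supV.
  have [[A B] /= [nA nB] AB] := FV.
  have : \forall s' \near s, A (a + s' *: h).
    have : (a + s' *: h) @[s' --> s] --> a + s *: h.
      by apply: cvgD; [exact: cvg_cst|apply: cvgZr_tmp; exact: cvg_id].
    by apply.
  move=> /nbhs_ballP[r1 /= r10 Hr1].
  have [r2 /= r20 Hr2] := nB.
  exists (Num.min r1 r2); first by rewrite lt_min r10.
  move=> s' t; rewrite lt_min => /andP[ss' _] /andP[t0]; rewrite lt_min => /andP[_ tr].
  have Vst : V (a + s' *: h, t).
    apply: AB; split => /=; first exact: Hr1.
    by apply: Hr2 => //=; rewrite sub0r normrN gtr0_norm.
  have : (((f (a + s' *: h + t *: h) - f (a + s' *: h)) / t)%:E < (C + eta)%:E)%E.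
    by apply: le_lt_trans supV; apply: ereal_sup_ubound; exists (a + s' *: h, t).
  rewrite lte_fin ltr_pdivrMr// => /ltW; rewrite mulrC; apply: le_trans.
  by rewrite /psi scalerDl addrA.
pose S := [set s : R | 0 <= s <= 1 /\ psi s - psi 0 <= (C + eta) * s].
suff [_] : S 1 by rewrite /psi scale1r scale0r addr0 mulr1.
have S0 : S 0 by split; rewrite ?lexx ?ler01// subrr mulr0.
have ubS : ubound S 1 by move=> s [/andP[]].
have supS : has_sup S by split; [exists 0|exists 1].
have sig0 : 0 <= sup S by exact: (ub_le_sup supS.2 S0).
have sig1 : sup S <= 1 by apply: ge_sup => //; exists 0.
have [|rho rho0 Hrho] := loc (sup S); first by rewrite sig0.
have [s' Ss' s'rho] := sup_adherent (divr_gt0 rho0 (@ltr0n R 2)) supS.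
have s'sup : s' <= sup S by exact: (ub_le_sup supS.2 Ss').
have [[/andP[s'0 s'1] Hs']] := Ss'.
have [s1E|s'n1] := eqVneq s' 1; first by rewrite -s1E.
have s'lt1 : s' < 1 by rewrite lt_neqAle s'n1.
(* A step of [rho / 2] from [s'] would exceed the supremum, so the minimum is [1 - s'] and the end
   of the segment is reached. *)
pose t := Num.min (1 - s') (rho / 2).
have t0 : 0 < t by rewrite lt_min subr_gt0 s'lt1 divr_gt0.
have trho : t < rho by rewrite gt_min; apply/orP; right; lra.
have tle : t <= 1 - s' by rewrite ge_min lexx.
have Sst : S (s' + t).
  split; first by apply/andP; split; lra.
  have := Hrho s' t; rewrite t0 trho ger0_norm ?subr_ge0// => Hst.
  have {}Hst : psi (s' + t) - psi s' <= t * (C + eta) by apply: Hst => //; lra.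
  by rewrite mulrDr (mulrC _ t); lra.
have stsup : s' + t <= sup S by exact: (ub_le_sup supS.2 Sst).
suff : t = 1 - s' by move=> tE; move: Sst; rewrite tE addrC subrK.
rewrite /t; case: (leP (1 - s') (rho / 2)) => // hh.
have tE : t = rho / 2 by rewrite /t min_r// ltW.
by rewrite tE in stsup; lra.
Qed.

Section euclidean_norm.
Context {R : realType} {m : nat}.
Implicit Types (z : 'cV[R]_m) (A : 'M[R]_m).

Lemma enorm_ge0 z : 0 <= enorm z.
Proof. exact: sqrtr_ge0. Qed.

Lemma enormZ (c : R) z : enorm (c *: z) = `|c| * enorm z.
Proof.
by rewrite [LHS](congr1 Num.sqrt (sqnormZ c z)) sqrtrM ?sqr_ge0// sqrtr_sqr.
Qed.

Lemma enorm_eq0 z : enorm z = 0 -> z = 0.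
Proof.
move=> /eqP; rewrite sqrtr_eq0 => h.
have /eqP : sqnorm z = 0 by apply/le_anti; rewrite h sqnorm_ge0.
rewrite psumr_eq0 => [/allP zi|i _]; last exact: sqr_ge0.
apply/colP => i; rewrite mxE; apply/eqP; rewrite -sqrf_eq0.
by have := zi i (mem_index_enum i).
Qed.

Lemma coord_le_enorm z i : `|z i 0| <= enorm z.
Proof.
rewrite -sqrtr_sqr ler_wsqrtr// (bigD1 i)//= lerDl.
by apply: sumr_ge0 => j _; exact: sqr_ge0.
Qed.

Lemma enorm_bound z (t : R) : (forall i, `|z i 0| <= t) -> enorm z <= Num.sqrt m%:R * `|t|.
Proof.
move=> h; rewrite -sqrtr_sqr -sqrtrM// ler_wsqrtr//.
apply: (@le_trans _ _ (\sum_(i < m) t ^+ 2)).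
  apply: ler_sum => i _; rewrite -real_normK ?num_real// lerXn2r// nnegrE//.
  exact: le_trans (h i).
by rewrite sumr_const card_ord mulr_natl.
Qed.

Lemma opnorm_has_ubound A :
  has_ubound [set enorm (A *m v) | v in [set v : 'cV[R]_m | enorm v <= 1]].
Proof.
pose t := \sum_i \sum_j `|A i j|.
exists (Num.sqrt m%:R * `|t|) => _ [v /= v1 <-]; apply: enorm_bound => i.
rewrite mxE (le_trans (ler_norm_sum _ _ _))//.
apply: (@le_trans _ _ (\sum_j `|A i j|)).
  apply: ler_sum => j _; rewrite normrM ler_piMr//.
  exact: le_trans (coord_le_enorm v j) v1.
rewrite /t [leRHS](bigD1 i)//= lerDl; apply: sumr_ge0 => k _.
by apply: sumr_ge0.
Qed.

Lemma enorm0 : enorm (0 : 'cV[R]_m) = 0.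
Proof.
by rewrite /enorm big1 ?sqrtr0// => i _; rewrite mxE expr0n.
Qed.

Lemma opnorm_ge0 A : 0 <= opnorm A.
Proof.
apply: (le_trans (enorm_ge0 (A *m 0))); apply: (ub_le_sup (opnorm_has_ubound A)).
by exists 0 => //=; rewrite enorm0.
Qed.

Lemma enorm_mulmx_le A z : enorm (A *m z) <= opnorm A * enorm z.
Proof.
have [z0|z0] := eqVneq (enorm z) 0.
  by rewrite (enorm_eq0 z0) mulmx0 enorm0 mulr0.
have zp : 0 < enorm z by rewrite lt_neqAle eq_sym z0 enorm_ge0.
rewrite -ler_pdivrMr//; apply: (ub_le_sup (opnorm_has_ubound A)).
exists ((enorm z)^-1 *: z) => /=.
  by rewrite enormZ ger0_norm ?invr_ge0 ?enorm_ge0// mulVf.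
by rewrite -scalemxAr enormZ ger0_norm ?invr_ge0 ?enorm_ge0// mulrC.
Qed.

Lemma continuous_enorm : continuous (@enorm R m).
Proof.
move=> z; apply: (@continuous_comp _ _ _ (@sqnorm R m) Num.sqrt).
  exact: continuous_sqnorm.
exact: sqrt_continuous.
Qed.

Lemma compact_enorm_ball (T : R) : compact [set z : 'cV[R]_m | enorm z <= T].
Proof.
have cK : compact [set v : 'rV[R]_m | forall j, `[- T, T]%classic (v ord0 j)].
  apply: (@rV_compact R m (fun=> `[- T, T]%classic)) => _.
  exact: segment_compact.
have ct : continuous (fun v : 'rV[R]_m => v^T).
  apply: continuous_cV => i; under eq_fun do rewrite mxE.
  exact: coord_continuous.
apply: (subclosed_compact _ (continuous_compact (continuous_subspaceT ct) cK)).
  by apply: closed_comp (@closed_le R T) => z _; exact: continuous_enorm.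
move=> z /= zT; exists z^T; last by rewrite trmxK.
move=> j /=; rewrite in_itv/= mxE -ler_norml.
exact: le_trans (coord_le_enorm z j) zT.
Qed.

Lemma compact_enorm_sphere (T : R) : compact [set z : 'cV[R]_m | enorm z = T].
Proof.
apply: (subclosed_compact _ (compact_enorm_ball (T := T))).
  by apply: closed_comp (@closed_eq R T) => z _; exact: continuous_enorm.
by move=> z /= ->.
Qed.

End euclidean_norm.

Section locally_lipschitz_family.
Context {R : realType} {X : normedModType R} {m : nat}.
Variable g : X -> 'cV[R]_m -> R.
Hypothesis glip : locally_lipschitz (fun p : X * 'cV[R]_m => g p.1 p.2).

Let glip_ball (y : X) (z : 'cV[R]_m) : exists (k e : R), [/\ 0 <= k, 0 < e &
  forall y1 y2 z1 z2, ball y e y1 -> ball y e y2 -> ball z e z1 -> ball z e z2 ->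
  `|g y1 z1 - g y2 z2| <= k * Num.max `|y1 - y2| `|z1 - z2|].
Proof.
have [k [U [/nbhs_ballP[e /= e0 eU] kU]]] := glip (y, z).
exists `|k|, e; split => // y1 y2 z1 z2 h1 h2 h3 h4.
have /= := kU ((y1, z1), (y2, z2)) (conj (eU (y1, z1) (conj h1 h3)) (eU (y2, z2) (conj h2 h4))).
move/le_trans; apply.
by rewrite ler_wpM2r// ?ler_norm// le_max normr_ge0.
Qed.

Lemma locally_lipschitz_continuous : continuous (fun p : X * 'cV[R]_m => g p.1 p.2).
Proof.
move=> [y z]; have [k [e [k0 e0 H]]] := glip_ball y z.
apply/cvgrPdist_le => eps eps0.
have d0 : 0 < Num.min e (eps / (k + 1)) by rewrite lt_min e0 divr_gt0// ltr_wpDl.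
apply: (@filterS _ _ _ (ball (y, z) (Num.min e (eps / (k + 1))))); last first.
  exact: (nbhsx_ballx (y, z) _ d0).
move=> p [/= b1 b2].
have sub (V : pseudoMetricType R) (u v : V) : ball u (Num.min e (eps / (k + 1))) v -> ball u e v.
  by apply: le_ball; rewrite ge_min lexx.
apply: le_trans (H _ _ _ _ (ballxx y e0) (sub _ _ _ b1) (ballxx z e0) (sub _ _ _ b2)) _.
have : Num.max `|y - p.1| `|z - p.2| <= eps / (k + 1).
  move: b1 b2; rewrite -!ball_normE/= !lt_min => /andP[_ /ltW b1] /andP[_ /ltW b2].
  by rewrite ge_max b1.
move=> h; apply: (@le_trans _ _ ((k + 1) * (eps / (k + 1)))).
  by rewrite ler_pM// ?le_max ?normr_ge0// lerDl.
by rewrite mulrC divfK// gt_eqF// ltr_wpDl.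
Qed.

Lemma locally_lipschitz_continuousr y : continuous (g y).
Proof.
move=> z; apply: (@continuous_comp _ _ _ (fun z => (y, z)) (fun p : X * 'cV[R]_m => g p.1 p.2)).
  move=> A [[B C] /= [nB nC] BC]; rewrite /nbhs/=; apply: filterS nC => z' Cz'.
  by apply: BC; split => //=; exact: nbhs_singleton.
exact: locally_lipschitz_continuous.
Qed.

Lemma locally_lipschitz_continuousl z : continuous (g ^~ z).
Proof.
move=> y; apply: (@continuous_comp _ _ _ (fun y => (y, z)) (fun p : X * 'cV[R]_m => g p.1 p.2)).
  move=> A [[B C] /= [nB nC] BC]; rewrite /nbhs/=; apply: filterS nB => y' By'.
  by apply: BC; split => //=; exact: nbhs_singleton.
exact: locally_lipschitz_continuous.
Qed.

(** Compactness of [K] makes the local constants uniform: in the covering argument the Lipschitz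
    constant tends to infinity and the radius to 0 simultaneously. *)
Lemma lipschitz_slab (x : X) (K : set 'cV[R]_m) : compact K ->
  exists (k e : R), [/\ 0 <= k, 0 < e & forall z y1 y2, K z ->
    ball x e y1 -> ball x e y2 -> `|g y1 z - g y2 z| <= k * `|y1 - y2|].
Proof.
move=> /compact_near_coveringP cK.
pose P (p : R * R) (z : 'cV[R]_m) := forall y1 y2, ball x p.2 y1 -> ball x p.2 y2 ->
  `|g y1 z - g y2 z| <= p.1 * `|y1 - y2|.
have := cK (R * R)%type (filter_prod +oo 0^'+) P _.
case.
  move=> z Kz; have [k [e [k0 e0 H]]] := glip_ball x z.
  exists (ball z e, [set p | k <= p.1 /\ p.2 <= e]) => /=.
    split; first exact: nbhsx_ballx.
    exists ([set t | k <= t], [set t | t <= e]) => /=; last by move=> [? ?] [].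
    split; first by apply: nbhs_pinfty_ge; exact: num_real.
    exact: nbhs_right_le.
  move=> [z' p] /= [zz' [kp pe]] y1 y2 b1 b2.
  have sub v : ball x p.2 v -> ball x e v by exact: le_ball.
  have := H y1 y2 z' z' (sub _ b1) (sub _ b2) zz' zz'.
  rewrite subrr normr0 max_l// => /le_trans; apply.
  by rewrite ler_wpM2r.
move=> [A B] /= [nA nB] AB.
have [k [kr Ak]] := nA.
have [e' /= e'0 Be] := nB.
exists (Num.max k 0 + 1), (e' / 2); split.
- by rewrite addr_ge0// le_max lexx orbT.
- by rewrite divr_gt0.
- move=> z y1 y2 Kz b1 b2.
  apply: (AB (Num.max k 0 + 1, e' / 2)) => //=; split.
    by apply: Ak; rewrite (@le_lt_trans _ _ (Num.max k 0)) ?le_max ?lexx// ltrDl.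
  apply: Be => /=; last by rewrite divr_gt0.
  by rewrite sub0r normrN gtr0_norm ?divr_gt0//; lra.
Qed.

End locally_lipschitz_family.

(** * Growth of [g] far from the origin *)

Section far_growth.
Context {R : realType} {X : normedModType R} {m : nat}.
Variables (g : X -> 'cV[R]_m -> R) (L : 'M[R]_m) (x : X).
Hypotheses (glip : locally_lipschitz (fun p : X * 'cV[R]_m => g p.1 p.2))
  (gconv : forall y, convex_function [set: convex_lmodType 'cV[R]_m] (g y))
  (gx0 : g x 0 < 0).

Lemma convex_star y z (a : R) : 0 <= a <= 1 ->
  g y (a *: z) <= (1 - a) * g y 0 + a * g y z.
Proof.
move=> /andP[a0 a1]; have := gconv y (Itv01 a0 a1) (in_setT z) (in_setT 0).
rewrite convRE /=; rewrite {1}/conv/= scaler0 addr0.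
by rewrite addrC; apply.
Qed.

Lemma near_value0 : \forall y \near x, g y 0 <= g x 0 / 2.
Proof.
have c := @locally_lipschitz_continuousl _ _ _ _ glip 0 x.
have h : g x 0 < g x 0 / 2.
  have half (a : R) : a < 0 -> a < a / 2 by move=> ?; lra.
  exact: half.
exact: cvgr_le c _ h.
Qed.

Let weight (l : R) (z : 'cV[R]_m) :=
  l * enorm z ^- m * expR (enorm z ^+ 2 / (2 * opnorm L ^+ 2)).

(** On a sphere enclosing the sublevel set [g x] is positive; by compactness so is [g y] for [y]
    near [x], and convexity together with [g y 0 < 0] propagates positivity outwards. *)
Lemma far_growth_bounded : bounded_set [set z : 'cV[R]_m | g x z <= 0] ->
  exists T : R, 0 < T /\ \forall y \near x, forall z, T <= enorm z -> 0 < g y z.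
Proof.
move=> [M [Mr HM]].
(* The sublevel set lies in the cube of half-width [M + 1]; the last summand puts the sphere
   strictly outside it. *)
pose T := Num.sqrt m%:R * `|M + 1| + 1.
have T0 : 0 < T by rewrite ltr_wpDl// mulr_ge0// sqrtr_ge0.
exists T; split => //.
have posT z : enorm z = T -> 0 < g x z.
  move=> zT; rewrite ltNge; apply/negP => gz.
  have zM : `|z| <= M + 1 by apply: (HM (M + 1)) => //=; rewrite ltrDl.
  have : enorm z <= Num.sqrt m%:R * `|M + 1|.
    apply: enorm_bound => i; apply: le_trans zM.
    rewrite /Num.norm/= mx_normrE.
    exact: (@le_bigmax _ _ _ 0 (fun ij : 'I_m * 'I_1 => `|z ij.1 ij.2|) (i, 0)).
  by rewrite zT /T -subr_ge0 opprD addrA subrr sub0r oppr_ge0 ler10.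
have /compact_near_coveringP cS := @compact_enorm_sphere R m T.
have nS : \forall y \near x, [set z : 'cV[R]_m | enorm z = T] `<=` (fun z => 0 < g y z).
  apply: (cS X (nbhs x) (fun y z => 0 < g y z)) => z zT.
  have c := locally_lipschitz_continuous glip (x := (x, z)).
  have [[A B]/= [nA nB] AB] := cvgr_gt _ c _ (posT z zT).
  exists (B, A) => //= -[z' y'] /= [Bz Ay].
  exact: (AB (y', z')).
apply: filterS2 nS near_value0 => y Sy gy0 z Tz.
have z0 : 0 < enorm z by exact: lt_le_trans Tz.
have a01 : 0 <= T / enorm z <= 1.
  by rewrite divr_ge0 ?(ltW T0) ?(ltW z0)//= ler_pdivrMr// mul1r.
have /Sy/= h1 : enorm (T / enorm z *: z) = T.
  by rewrite enormZ ger0_norm ?divfK ?gt_eqF//; case/andP: a01.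
have h2 := convex_star y z a01.
have h3 : (1 - T / enorm z) * g y 0 <= 0.
  rewrite mulr_ge0_le0 ?subr_ge0//; first by case/andP: a01.
  by rewrite (le_trans gy0)// pmulr_lle0// ltW.
have : 0 < T / enorm z * g y z.
  by move: h1 h2 h3; set p := _ * g y 0; set q := _ * g y z; lra.
by rewrite pmulr_rgt0// divr_gt0.
Qed.

(** Balls are convex, so the bound defining [nice_directions] holds along the whole segment from
    [y'] to [y], and [clarke_increment] turns it into a bound on the increment. *)
Lemma far_growth_nice (l : R) : 0 < l -> nice_directions g L l x = [set: X] ->
  forall y y', ball x l^-1 y -> ball x l^-1 y' -> forall z, l <= enorm z ->
  g y z - g y' z <= weight l z * `|y - y'|.
Proof.
move=> l0 nice y y' xy xy' z lz.
have -> : g y z = g (y' + (y - y')) z by rewrite addrC subrK.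
apply: (@clarke_increment _ _ (g ^~ z)) => s /andP[s0 s1].
have : nice_directions g L l x (y - y') by rewrite nice.
apply => //; apply: subset_closed_ball; move: xy xy'.
rewrite -!ball_normE/= => xy xy'.
have -> : x - (y' + s *: (y - y')) = s *: (x - y) + (1 - s) *: (x - y').
  have -> : x - y = (x - y') - (y - y') by rewrite opprB addrA subrK.
  apply/esym; rewrite scalerBr addrAC -scalerDl [s + _]addrC subrK scale1r.
  by rewrite opprD addrA.
rewrite (le_lt_trans (ler_normD _ _))// !normrZ !ger0_norm ?subr_ge0//.
have [->|s1'] := eqVneq s 0; first by rewrite mul0r add0r subr0 mul1r.
have sp : 0 < s by rewrite lt_neqAle eq_sym s1'.
apply: (@lt_le_trans _ _ (s * l^-1 + (1 - s) * l^-1)).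
  by rewrite ltr_leD// ?ltr_pM2l// ler_wpM2l ?subr_ge0// ltW.
by rewrite -mulrDl addrC subrK mul1r.
Qed.

(** The restriction to [g y z <= 0] lets the bounded case enter vacuously: far out there is no such
    [z]. *)
Lemma far_growth :
  bounded_set [set z : 'cV[R]_m | g x z <= 0] \/
    (exists l : R, 0 < l /\ nice_directions g L l x = [set: X]) ->
  exists l e : R, [/\ 0 < l, 0 < e & forall y y', ball x e y -> ball x e y' ->
    forall z, l <= enorm z -> g y z <= 0 ->
    g y z - g y' z <= weight l z * `|y - y'|].
Proof.
case=> [/far_growth_bounded[T [T0 /nbhs_ballP[e /= e0 He]]]|[l [l0 nice]]].
  exists T, e; split => // y y' xy xy' z Tz.
  by rewrite leNgt (He y xy z Tz).
exists l, l^-1; split; rewrite ?invr_gt0// => y y' xy xy' z lz _.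
exact: far_growth_nice.
Qed.

End far_growth.

Section radial_lipschitz.
Context {R : realType} {X : normedModType R} {m : nat}.
Variables (g : X -> 'cV[R]_m -> R) (L : 'M[R]_m) (x : X).
Hypotheses (glip : locally_lipschitz (fun p : X * 'cV[R]_m => g p.1 p.2))
  (gconv : forall y, convex_function [set: convex_lmodType 'cV[R]_m] (g y))
  (gx0 : g x 0 < 0) (m0 : (0 < m)%N) (hL : L \in unitmx)
  (hgrowth : bounded_set [set z : 'cV[R]_m | g x z <= 0] \/
    (exists l : R, 0 < l /\ nice_directions g L l x = [set: X]))
  (chi1 : @chi_prob R m setT = 1%E).

(** A lower bound for [enorm (L *m v)] on the unit sphere, from [v = invmx L *m (L *m v)]; adding 1
    makes the inverted number visibly positive. *)
Let cl : R := (opnorm (invmx L) + 1)^-1.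

Let cl0 : 0 < cl. Proof. by rewrite invr_gt0 ltr_wpDl// opnorm_ge0. Qed.

Let enorm_Lv v : sphere v -> cl <= enorm (L *m v) <= opnorm L.
Proof.
move=> v1; apply/andP; split; last first.
  by rewrite (le_trans (enorm_mulmx_le _ _))// v1 mulr1.
rewrite /cl -[_^-1]mul1r ler_pdivrMr; last by rewrite ltr_wpDl// opnorm_ge0.
have v1E : enorm v = 1 := v1.
rewrite -[leLHS]v1E -{1}(mulKmx hL v) (le_trans (enorm_mulmx_le _ _))// mulrC ler_wpM2l ?enorm_ge0//.
by rewrite lerDl.
Qed.

(** Compactness gives the bound for [r <= R1]. Beyond, [enorm (r *: (L *m v))] lies between [r * cl]
    and [r * opnorm L]: the lower bound serves the negative power, the upper one the exponential,
    and the growth bound becomes a multiple of the inverse of the weight. *)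
Lemma ray_growth : exists e C R1 : R,
  [/\ 0 < e, 0 <= C, 0 < R1, m.+1%:R <= R1 ^+ 2 &
   forall y y', ball x e y -> ball x e y' ->
     g y 0 <= g x 0 / 2 /\
     forall v (r : R), sphere v -> 0 < r -> g y (r *: (L *m v)) = 0 ->
       - g y' (r *: (L *m v)) <=
       C * `|y - y'| / (if r <= R1 then 1 else r ^+ m * expR (- (r ^+ 2 / 2)))].
Proof.
have [l [e1 [l0 e10 far]]] := far_growth glip gconv gx0 hgrowth.
have /nbhs_ballP[e2 /= e20 near0] := near_value0 glip gx0.
(* The root serves [chi_tail]; [l / cl] ensures that for [R1 < r] the point on the ray is at
   distance at least [l] from the origin. *)
pose R1 : R := Num.max (Num.sqrt m.+1%:R) (l / cl).
have R10 : 0 < R1 by rewrite lt_max sqrtr_gt0 ltr0n.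
have [k [e3 [k0 e30 slab]]] := lipschitz_slab glip x (@compact_enorm_ball R m (R1 * opnorm L)).
pose e := Num.min e1 (Num.min e2 e3).
have sub1 y : ball x e y -> ball x e1 y by apply: le_ball; rewrite ge_min lexx.
have sub2 y : ball x e y -> ball x e2 y by apply: le_ball; rewrite !ge_min lexx orbT.
have sub3 y : ball x e y -> ball x e3 y by apply: le_ball; rewrite !ge_min lexx !orbT.
pose C := k + l * cl ^- m.
have C1 : 0 <= l * cl ^- m by rewrite mulr_ge0 ?invr_ge0 ?exprn_ge0// ltW.
exists e, C, R1; split => //.
- by rewrite !lt_min e10 e20.
- exact: addr_ge0.
- rewrite -[leLHS]sqr_sqrtr//; rewrite lerXn2r ?nnegrE ?sqrtr_ge0 ?(ltW R10)//.
  by rewrite le_max lexx.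
move=> y y' xy xy'; split; first by apply: near0; exact: sub2.
move=> v r v1 r0 gr0.
have /andP[lo hi] := enorm_Lv v1.
have zr : enorm (r *: (L *m v)) = r * enorm (L *m v) by rewrite enormZ gtr0_norm.
rewrite -[leLHS]add0r -[X in X + _]gr0.
have n0 := normr_ge0 (y - y').
case: ifPn => [rR1|]; last rewrite -ltNge => rR1.
  have zK : enorm (r *: (L *m v)) <= R1 * opnorm L.
    by rewrite zr ler_pM ?enorm_ge0 ?(ltW r0).
  have /(le_trans (ler_norm _)) h := slab _ _ _ zK (sub3 _ xy) (sub3 _ xy').
  by rewrite divr1 (le_trans h)// ler_wpM2r// lerDl.
have lz : l <= enorm (r *: (L *m v)).
  rewrite zr; apply: (@le_trans _ _ (r * cl)); last by rewrite ler_wpM2l// ltW.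
  by rewrite -ler_pdivrMr//; apply: le_trans (ltW rR1); rewrite le_max lexx orbT.
have gle : g y (r *: (L *m v)) <= 0 by rewrite gr0.
have h := far _ _ (sub1 _ xy) (sub1 _ xy') _ lz gle.
apply: le_trans h _; rewrite [leRHS]mulrAC ler_wpM2r//.
rewrite [in leRHS]invfM -expRN opprK [leRHS]mulrA; apply: ler_pM; rewrite ?expR_ge0//.
- by rewrite mulr_ge0 ?(ltW l0)// invr_ge0 exprn_ge0// enorm_ge0.
- apply: (@le_trans _ _ (l * cl ^- m * r ^- m)); last first.
    by rewrite ler_wpM2r ?lerDr// invr_ge0 exprn_ge0// ltW.
  rewrite -mulrA ler_wpM2l ?(ltW l0)// -invfM -exprMn.
  rewrite lef_pV2 ?posrE ?exprn_gt0 ?mulr_gt0//; last first.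
    by apply: lt_le_trans lz.
  rewrite lerXn2r ?nnegrE ?enorm_ge0//; first by rewrite mulr_ge0// ltW.
  by rewrite zr mulrC ler_wpM2l// ltW.
- rewrite ler_expR zr.
  have [nL0|nL0] := eqVneq (opnorm L) 0.
    by rewrite nL0 expr0n mulr0 invr0 mulr0 divr_ge0// sqr_ge0.
  have op : 0 < opnorm L by rewrite lt_neqAle eq_sym nL0 opnorm_ge0.
  rewrite invfM [leLHS]mulrA ler_pdivrMr ?exprn_gt0// [leRHS]mulrAC ler_wpM2r ?invr_ge0//.
  rewrite exprMn ler_wpM2l ?sqr_ge0// lerXn2r// nnegrE ?enorm_ge0//.
  exact: ltW.
Qed.

(** [chi_prob_ray_comparison] is one-sided and is applied to both orders of [y] and [y']. The depth
    [- (g x 0 / 2)] at the origin is common to all points near [x]. *)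
Lemma radial_prob_lipschitz : exists e C : R, [/\ 0 < e, 0 <= C &
  forall y y' v, ball x e y -> ball x e y' -> sphere v ->
  `|radial_prob g L y v - radial_prob g L y' v| <= C * `|y - y'|].
Proof.
have [e [C [R1 [e0 C0 R10 mR1 H]]]] := ray_growth.
pose K : R := 2 / - (g x 0 / 2) * (1 + chi_scale m + chi_scale m * 2 ^+ m.-1 * (R1 ^+ m + 1)).
have c0 : 0 < - (g x 0 / 2) by rewrite oppr_gt0 pmulr_llt0.
have K0 : 0 <= K.
  by rewrite mulr_ge0 ?divr_ge0 ?(ltW c0)// !addr_ge0 ?mulr_ge0 ?chi_scale_ge0 ?exprn_ge0 ?addr_ge0 ?exprn_ge0 ?(ltW R10).
exists e, (K * C); split => //; first exact: mulr_ge0.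
have cont y (v : 'cV[R]_m) : continuous (fun r : R => g y (r *: (L *m v))).
  move=> r; apply: (@continuous_comp _ _ _ (fun r : R => r *: (L *m v)) (g y)).
    by apply: cvgZr_tmp; exact: cvg_id.
  exact: locally_lipschitz_continuousr.
have le1 y y' v : ball x e y -> ball x e y' -> sphere v ->
    radial_prob g L y' v <= radial_prob g L y v + K * C * `|y - y'|.
  move=> xy xy' v1; have [gy0 Hr] := H y y' xy xy'; have [gy0' _] := H y' y xy' xy.
  have D0 : 0 <= C * `|y - y'| by rewrite mulr_ge0.
  have star u (a r : R) : 0 <= a <= 1 ->
      g u ((a * r) *: (L *m v)) <= (1 - a) * g u (0 *: (L *m v)) + a * g u (r *: (L *m v)).
    by move=> a01; rewrite -scalerA scale0r; exact: convex_star.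
  have fin y1 : (chi_prob m [set r : R | (0 <= r)%R /\ (g y1 (r *: (L *m v)) <= 0)%R] \is a fin_num)%E.
    rewrite ge0_fin_numE; last by apply: integral_ge0 => r _; rewrite lee_fin chi_pdf_ge0.
    apply: (@le_lt_trans _ _ 1%E); last exact: ltry.
    rewrite -chi1; apply: chi_prob_mono => //.
    have c1 : continuous (g y1) by exact: locally_lipschitz_continuousr.
    have h := measurable_ray (L *m v) c1.
    exact: h.
  have := @chi_prob_ray_comparison R m m0 (fun r => g y (r *: (L *m v)))
    (fun r => g y' (r *: (L *m v))) (- (g x 0 / 2)) (C * `|y - y'|) R1
    chi1 c0 D0 R10 mR1 (cont y v) (cont y' v) (star y) (star y').
  rewrite !scale0r opprK => /(_ gy0 gy0' (fun r => Hr v r v1)).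
  rewrite -/K /radial_prob => h.
  rewrite -lee_fin EFinD !fineK// (le_trans h)// leeD2l// lee_fin mulrA//.
move=> y y' v xy xy' v1; rewrite ler_norml lerBlDl lerBrDr addrC.
rewrite [X in _ && (_ <= X)]addrC.
have := le1 _ _ _ xy xy' v1; have := le1 _ _ _ xy' xy v1.
rewrite (distrC y'); set p := K * C * _; set a := radial_prob _ _ _ _; set b := radial_prob _ _ _ _.
by move=> h1 h2; apply/andP; split; lra.
Qed.

End radial_lipschitz.

(** * Clarke directional derivatives *)

Lemma pos_homogeneous (R : realType) (X : lmodType R) (s : X -> R) : s 0 = 0 ->
  (forall (a : R) h, 0 < a -> s (a *: h) <= a * s h) ->
  forall (a : R) h, 0 <= a -> s (a *: h) = a * s h.
Proof.
move=> s0 le1 a h; rewrite le_eqVlt => /orP[/eqP <-|a0].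
  by rewrite scale0r mul0r.
apply/le_anti; rewrite le1//=.
have ai : 0 < a^-1 by rewrite invr_gt0.
have := ler_wpM2l (ltW a0) (le1 _ (a *: h) ai).
by rewrite scalerA mulVf ?gt_eqF// scale1r mulrA mulfV ?gt_eqF// mul1r.
Qed.

Section difference_quotients.
Context {R : realType} {X : normedModType R}.
Implicit Types (f : X -> R) (x y h : X) (p : X * R).

Definition diff_quot f h p : R := (f (p.1 + p.2 *: h) - f p.1) / p.2.

Local Notation near_dir x := (filter_prod (nbhs x) (0 : R)^'+).

Lemma clarke_lt f x h (c : R) : (clarke_deriv f x h < c%:E)%E ->
  \forall p \near near_dir x, diff_quot f h p < c.
Proof.
rewrite /clarke_deriv limf_esupE => /ereal_inf_lt[_ [V FV <-]] supV.
apply: (filterS _ FV) => p Vp; rewrite -lte_fin; apply: le_lt_trans supV.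
by apply: ereal_sup_ubound; exists p.
Qed.

Lemma clarke_le f x h (c : R) :
  (\forall p \near near_dir x, diff_quot f h p <= c) -> (clarke_deriv f x h <= c%:E)%E.
Proof.
move=> H; rewrite /clarke_deriv limf_esupE.
apply: (@le_trans _ _ (ereal_sup ((fun p => (diff_quot f h p)%:E) @` [set p | diff_quot f h p <= c]))).
  by apply: ereal_inf_lbound; exists [set p | diff_quot f h p <= c].
by apply: ge_ereal_sup => _ [p /= pc <-]; rewrite lee_fin.
Qed.

Lemma clarke_ge f x h (c : R) :
  (\forall p \near near_dir x, c <= diff_quot f h p) -> (c%:E <= clarke_deriv f x h)%E.
Proof.
move=> H; rewrite /clarke_deriv limf_esupE.
apply: le_ereal_inf_tmp => _ [V FV <-].
have [p [Vp cp]] : exists p, V p /\ c <= diff_quot f h p.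
  have [p] := @filter_ex _ _ _ _ (filterI FV H).
  by exists p.
apply: (@le_trans _ _ (diff_quot f h p)%:E); first by rewrite lee_fin.
by apply: ereal_sup_ubound; exists p.
Qed.

(** A base point displaced by the step times a fixed vector still tends to [x], so quotients along
    broken or reversed segments obey the same upper limits. *)
Lemma cvg_shift x h :
  (fun p => (p.1 + p.2 *: h, p.2)) @ near_dir x --> near_dir x.
Proof.
have c2 : (fun p => p.2) @ near_dir x --> (0 : R)^'+ by exact: cvg_snd.
have c1 : (fun p => p.1 + p.2 *: h) @ near_dir x --> x.
  rewrite -[X in _ --> X]addr0 -[X in _ + X](scale0r h); apply: cvgD.
    exact: cvg_fst.
  apply: cvgZr_tmp; apply: cvg_trans c2 _; exact: cvg_at_right_filter.
move=> P [[A B] /= [nA nB] AB].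
have nA' : near_dir x (fun p => A (p.1 + p.2 *: h)) := c1 A nA.
have nB' : near_dir x (fun p => B p.2) := c2 B nB.
by apply: (filterS _ (filterI nA' nB')) => p [] Ap Bp; exact: AB.
Qed.

Lemma cvg_rescale x (a : R) : 0 < a ->
  (fun p => (p.1, a * p.2)) @ near_dir x --> near_dir x.
Proof.
move=> a0 P [[A B] /= [nA [e /= e0 eB]] AB].
exists (A, [set t | 0 < t < e / a]) => /=.
  split => //; exists (e / a) => /=; first by rewrite divr_gt0.
  by move=> t /=; rewrite sub0r normrN => te t0; rewrite t0 (le_lt_trans (ler_norm t)).
move=> [y t] [/= Ay /andP[t0 te]]; apply: AB; split => //=; apply: eB => /=.
  by rewrite sub0r normrN gtr0_norm ?mulr_gt0// mulrC -ltr_pdivlMr.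
exact: mulr_gt0.
Qed.

Lemma near_shift x h (P : set (X * R)) :
  near_dir x P -> near_dir x (fun p => P (p.1 + p.2 *: h, p.2)).
Proof. exact: cvg_shift. Qed.

Lemma near_rescale x (a : R) (P : set (X * R)) : 0 < a ->
  near_dir x P -> near_dir x (fun p => P (p.1, a * p.2)).
Proof. by move=> a0; exact: cvg_rescale. Qed.

Lemma near_dir_gt0 x : \forall p \near near_dir x, 0 < p.2.
Proof.
exists (setT, [set t | 0 < t]) => /=; last by move=> [y t] [].
by split; [exact: filterT|exact: nbhs_right_gt].
Qed.

Lemma diff_quotN f h p : p.2 != 0 ->
  diff_quot f h p = - diff_quot f (- h) (p.1 + p.2 *: h, p.2).
Proof.
by move=> p0; rewrite /diff_quot/= scalerN addrK -mulNr opprB.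
Qed.

Lemma diff_quotD f h k p :
  diff_quot f (h + k) p = diff_quot f h p + diff_quot f k (p.1 + p.2 *: h, p.2).
Proof.
by rewrite /diff_quot/= -mulrDl scalerDr addrA; congr (_ / _); rewrite [RHS]addrC subrKA.
Qed.

Lemma diff_quotZ f h (a : R) p : a != 0 ->
  diff_quot f (a *: h) p = a * diff_quot f h (p.1, a * p.2).
Proof.
move=> a0; rewrite /diff_quot/= scalerA (mulrC p.2).
by rewrite invfM [RHS]mulrCA (mulrA a) mulfV// mul1r.
Qed.

End difference_quotients.

Section clarke_lipschitz.
Context {R : realType} {X : normedModType R}.
Local Notation near_dir x := (filter_prod (nbhs x) (0 : R)^'+).
Variables (f : X -> R) (x : X) (e K : R).
Hypotheses (e0 : 0 < e)
  (lip : forall y y', ball x e y -> ball x e y' -> `|f y - f y'| <= K * `|y - y'|).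

Lemma near_diff_quot_le h : \forall p \near near_dir x, `|diff_quot f h p| <= K * `|h|.
Proof.
have nb : \forall p \near near_dir x, ball x e p.1.
  by exists (ball x e, setT) => /=; [split; [exact: nbhsx_ballx|exact: filterT]|case=> ? ? []].
apply: (filterS _ (filterI (filterI nb (near_shift h nb)) (near_dir_gt0 x))).
move=> p [[b1 /= b2] p0].
rewrite /diff_quot normrM normfV (gtr0_norm p0) ler_pdivrMr//.
rewrite (le_trans (lip b2 b1))// addrAC subrr add0r normrZ (gtr0_norm p0).
by rewrite mulrAC mulrA.
Qed.

Lemma clarke_ge_bound h : ((- (K * `|h|))%:E <= clarke_deriv f x h)%E.
Proof.
apply: clarke_ge; apply: (filterS _ (near_diff_quot_le h)) => p.
by rewrite ler_norml => /andP[].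
Qed.

Lemma clarke_le_bound h : (clarke_deriv f x h <= (K * `|h|)%:E)%E.
Proof.
apply: clarke_le; apply: (filterS _ (near_diff_quot_le h)) => p.
by rewrite ler_norml => /andP[].
Qed.

(** The Lipschitz bound keeps the upper limit finite, so [fine] loses nothing here
    ([clarke_dirE]). *)
Definition clarke_dir h : R := fine (clarke_deriv f x h).

Lemma clarke_dirE h : (clarke_dir h)%:E = clarke_deriv f x h.
Proof.
rewrite /clarke_dir fineK// fin_numE; apply/andP; split; apply/eqP => h'.
  by have := clarke_ge_bound h; rewrite h' leeNy_eq.
by have := clarke_le_bound h; rewrite h' leye_eq.
Qed.

Lemma clarke_dir_le h : clarke_dir h <= K * `|h|.
Proof. by rewrite -lee_fin clarke_dirE clarke_le_bound. Qed.

Let dir_lt h c : clarke_dir h < c -> \forall p \near near_dir x, diff_quot f h p < c.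
Proof. by rewrite -lte_fin clarke_dirE => /clarke_lt. Qed.

Let dir_le h c : (\forall p \near near_dir x, diff_quot f h p <= c) -> clarke_dir h <= c.
Proof. by move=> /clarke_le; rewrite -clarke_dirE lee_fin. Qed.

Lemma clarke_dirD h k : clarke_dir (h + k) <= clarke_dir h + clarke_dir k.
Proof.
apply/ler_addgt0Pr => eps eps0; apply: dir_le.
have h1 : clarke_dir h < clarke_dir h + eps / 2 by rewrite ltrDl divr_gt0.
have h2 : clarke_dir k < clarke_dir k + eps / 2 by rewrite ltrDl divr_gt0.
apply: (filterS _ (filterI (dir_lt h1) (near_shift h (dir_lt h2)))) => p [q1 q2].
rewrite diff_quotD; move: q1 q2 => /= /ltW q1 /ltW q2.
by rewrite (le_trans (lerD q1 q2))//; lra.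
Qed.

Lemma clarke_dirZ (a : R) h : 0 <= a -> clarke_dir (a *: h) = a * clarke_dir h.
Proof.
have le1 (b : R) k : 0 < b -> clarke_dir (b *: k) <= b * clarke_dir k.
  move=> b0; apply/ler_addgt0Pr => eps eps0; apply: dir_le.
  have h1 : clarke_dir k < clarke_dir k + eps / b by rewrite ltrDl divr_gt0.
  apply: (filterS _ (near_rescale b0 (dir_lt h1))) => p /= /ltW q1.
  rewrite diff_quotZ ?gt_eqF//; have := ler_wpM2l (ltW b0) q1.
  by rewrite mulrDr [b * (eps / b)]mulrC divfK ?gt_eqF.
apply: pos_homogeneous => //.
apply/le_anti; rewrite (le_trans (clarke_dir_le 0)) ?normr0 ?mulr0//.
by rewrite -lee_fin clarke_dirE (le_trans _ (clarke_ge_bound 0))// normr0 mulr0 oppr0.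
Qed.

(* Reversing a segment exchanges the direction with its opposite and moves the
   base point, which still tends to [x]. *)
Lemma clarke_linear_near p : scalar p -> (forall h, clarke_dir h <= p h) ->
  forall h (eps : R), 0 < eps ->
  \forall q \near near_dir x, `|diff_quot f h q - p h| < eps.
Proof.
move=> lp Dp h eps eps0.
have pN : p (- h) = - p h.
  have := lp (- 1) h 0; have := lp (-1) 0 0.
  by rewrite !scaleN1r !addr0 oppr0 !mulN1r => p0 ->; move: p0; lra.
have h1 : clarke_dir h < p h + eps by rewrite (le_lt_trans (Dp h))// ltrDl.
have h2 : clarke_dir (- h) < - p h + eps by rewrite -pN (le_lt_trans (Dp _))// ltrDl.
apply: (filterS _ (filterI (filterI (dir_lt h1) (near_shift h (dir_lt h2))) (near_dir_gt0 x))).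
move=> q [[q1 /= q2] q0]; rewrite ltr_norml (@diff_quotN _ _ f h)//=; last by rewrite gt_eqF.
move: q1; rewrite (@diff_quotN _ _ f h)//=; last by rewrite gt_eqF.
move: q2; set a := diff_quot _ _ _; move=> q2 q1.
by apply/andP; split; lra.
Qed.

End clarke_lipschitz.

(** * The Hahn-Banach theorem through minimal sublinear functionals *)

Section hahn_banach.
Context {R : realType} {X : lmodType R}.
Implicit Types (s u : X -> R).

Definition sublinear s :=
  (forall h k, s (h + k) <= s h + s k) /\
  (forall (a : R) h, 0 <= a -> s (a *: h) = a * s h).

Lemma sublinear0 s : sublinear s -> s 0 = 0.
Proof. by move=> [_ /(_ 0 0 (lexx 0))]; rewrite scale0r mul0r. Qed.

Lemma sublinearN s h : sublinear s -> - s (- h) <= s h.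
Proof.
move=> ss; have := ss.1 h (- h); rewrite subrr sublinear0//.
by rewrite lerNl oppr_le0 || (move=> ?; lra).
Qed.

(* Lowers [s] to a sublinear functional taking the value [- s k] at [- k]. A
   functional that no tilt lowers is linear. *)
Definition tilt s (k : X) (h : X) : R :=
  inf [set s (h + t *: k) - t * s k | t in [set t : R | 0 <= t]].

Lemma tilt_has_inf s k h : sublinear s ->
  has_inf [set s (h + t *: k) - t * s k | t in [set t : R | 0 <= t]].
Proof.
move=> ss; split; first by exists (s (h + 0 *: k) - 0 * s k); exists 0 => //=.
exists (- s (- h)) => _ [t /= t0 <-].
have := ss.1 (h + t *: k) (- h); rewrite addrAC subrr add0r ss.2//.
by move=> ?; lra.
Qed.

Lemma tilt_le s k h (t : R) : sublinear s -> 0 <= t -> tilt s k h <= s (h + t *: k) - t * s k.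
Proof.
by move=> ss t0; apply: (ge_inf (tilt_has_inf k h ss).2); exists t.
Qed.

Lemma tilt_sublinear s k : sublinear s -> sublinear (tilt s k).
Proof.
move=> ss; have hi h := tilt_has_inf k h ss; split.
  move=> h h'; apply/ler_addgt0Pr => eps eps0.
  have e2 : 0 < eps / 2 by rewrite divr_gt0.
  have [_ [t /= t0 <-] ht] := inf_adherent e2 (hi h).
  have [_ [t' /= t'0 <-] ht'] := inf_adherent e2 (hi h').
  rewrite -/(tilt s k h) in ht; rewrite -/(tilt s k h') in ht'.
  have := tilt_le k (h + h') ss (addr_ge0 t0 t'0).
  have := ss.1 (h + t *: k) (h' + t' *: k).
  rewrite addrACA -scalerDl mulrDl => h1 h2.
  by move: h1 h2 ht ht'; set a := tilt _ _ _; set b := tilt _ _ _; set c := tilt _ _ _; lra.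
have le1 (a : R) h : 0 < a -> tilt s k (a *: h) <= a * tilt s k h.
  move=> a0; rewrite -ler_pdivrMl//; apply: lb_le_inf; first exact: (hi h).1.
  move=> _ [t /= t0 <-]; rewrite ler_pdivrMl//.
  have := tilt_le k (a *: h) ss (mulr_ge0 (ltW a0) t0).
  by rewrite -scalerA -scalerDr ss.2 ?(ltW a0)// mulrBr mulrA.
apply: pos_homogeneous => //; apply/le_anti/andP; split.
  by have := tilt_le k 0 ss (lexx 0); rewrite scale0r mul0r subr0 addr0 (sublinear0 ss).
apply: lb_le_inf; first exact: (hi 0).1.
by move=> _ [t /= t0 <-]; rewrite add0r ss.2// subrr.
Qed.

Lemma tilt_le_id s k h : sublinear s -> tilt s k h <= s h.
Proof.
by move=> ss; have := tilt_le k h ss (lexx 0); rewrite scale0r mul0r subr0 addr0.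
Qed.

(** Zorn's lemma for the reversed pointwise order. The infimum of a chain is finite because every
    member is at least [- s (- h)] at [h], and subadditive because two members of a chain are
    comparable. *)
Lemma sublinear_minimal s : sublinear s ->
  exists u, [/\ sublinear u, forall h, u h <= s h &
    forall w, sublinear w -> (forall h, w h <= u h) -> w = u].
Proof.
move=> ss.
pose T := {u : X -> R | sublinear u /\ forall h, u h <= s h}.
pose Rel (u w : T) : bool := `[< forall h, sval w h <= sval u h >].
have s0 : T by exists s.
have [|||A Atot|u umin] := @Zorn T Rel.
- by move=> t; apply/asboolP.
- move=> r t w /asboolP h1 /asboolP h2; apply/asboolP => h.
  exact: le_trans (h2 h) (h1 h).
- move=> [r hr] [t ht] /asboolP/= h1 /asboolP/= h2.
  have E : r = t by apply/funext => h; apply/le_anti; rewrite h1 h2.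
  by subst t; congr exist; exact: Prop_irrelevance.
- have [[a0 Aa0]|A0] := pselect (A !=set0); last first.
    by exists s0 => t At; exfalso; apply: A0; exists t.
  pose Vh h := [set sval u h | u in A].
  have hi h : has_inf (Vh h).
    split; first by exists (sval a0 h), a0.
    exists (- s (- h)) => _ [u Au <-]; have [su us] := svalP u.
    by apply: le_trans (sublinearN h su); rewrite lerN2.
  pose w h := inf (Vh h).
  have wle (u : T) h : A u -> w h <= sval u h.
    by move=> Au; apply: (ge_inf (hi h).2); exists u.
  have ws h : w h <= s h.
    by apply: le_trans (wle a0 h Aa0) _; have [_] := svalP a0.
  have sw : sublinear w.
    split.
      move=> h k; apply/ler_addgt0Pr => eps eps0.
      have e2 : 0 < eps / 2 by rewrite divr_gt0.
      have [_ [u Au <-] hu] := inf_adherent e2 (hi h).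
      have [_ [u' Au' <-] hu'] := inf_adherent e2 (hi k).
      rewrite -/(w h) in hu; rewrite -/(w k) in hu'.
      have [/asboolP uu'|/asboolP u'u] := Atot u u' Au Au'.
        have := wle u' (h + k) Au'; have := (svalP u').1.1 h k; have := uu' h.
        by move: hu hu'; set a := w _; set b := w _; set c := w _; lra.
      have := wle u (h + k) Au; have := (svalP u).1.1 h k; have := u'u k.
      by move: hu hu'; set a := w _; set b := w _; set c := w _; lra.
    have le1 (a : R) h : 0 < a -> w (a *: h) <= a * w h.
      move=> a0'; rewrite -ler_pdivrMl//; apply: lb_le_inf; first exact: (hi h).1.
      move=> _ [u Au <-]; rewrite ler_pdivrMl// -(svalP u).1.2 ?(ltW a0')//.
      exact: wle.
    apply: pos_homogeneous => //; apply/le_anti/andP; split.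
      by rewrite -(sublinear0 (svalP a0).1); exact: wle.
    apply: lb_le_inf; first exact: (hi 0).1.
    by move=> _ [u Au <-]; rewrite (sublinear0 (svalP u).1).
  exists (exist _ w (conj sw ws)) => t At; apply/asboolP => h /=.
  exact: wle.
exists (sval u); have [su us] := svalP u; split => // w sw wu.
have ws h : w h <= s h by exact: le_trans (wu h) (us h).
have uw : Rel u (exist _ w (conj sw ws)) by apply/asboolP.
by rewrite -(umin _ uw).
Qed.

(** A minimal [u] below [tilt s k] is fixed by all of its own tilts, which makes it superadditive
    and so linear. Since [tilt s k] is at most [- s k] at [- k], linearity turns this into
    [s k <= u k]. *)
Lemma hahn_banach s k : sublinear s ->
  exists p, [/\ scalar p, forall h, p h <= s h & p k = s k].
Proof.
move=> ss; have sk := tilt_sublinear k ss.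
have [u [su us umin]] := sublinear_minimal sk.
have add_le h k' : u h + u k' <= u (h + k').
  have := umin _ (tilt_sublinear k' su) (fun h => tilt_le_id k' h su).
  move=> /(congr1 (fun f => f h)) /= <-.
  have := tilt_le k' h su ler01; rewrite scale1r mul1r; lra.
have addu h k' : u (h + k') = u h + u k' by apply/le_anti; rewrite add_le su.1.
have uN h : u (- h) = - u h.
  by have := addu h (- h); rewrite subrr (sublinear0 su) => ?; lra.
exists u; split.
- move=> a h k'; rewrite addu; congr (_ + _).
  have [a0|a0] := leP 0 a; first exact: su.2.
  rewrite -[a]opprK scaleNr uN su.2 ?oppr_ge0 ?(ltW a0)//.
  by rewrite !mulNr.
- by move=> h; rewrite (le_trans (us h))// tilt_le_id.
- apply/le_anti; rewrite (le_trans (us k) (tilt_le_id k k ss))/=.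
  have := us (- k); rewrite uN; have := tilt_le k (- k) ss ler01.
  rewrite scale1r mul1r addNr (sublinear0 ss); set a := tilt _ _ _; lra.
Qed.

End hahn_banach.

Lemma scalarN (R : realType) (X : lmodType R) (p : X -> R) h :
  scalar p -> p (- h) = - p h.
Proof.
move=> lp; have := lp (- 1) h 0; have := lp (- 1) 0 0.
by rewrite !scaleN1r !addr0 oppr0 !mulN1r => p0 ->; move: p0; lra.
Qed.

Lemma scalarB (R : realType) (X : lmodType R) (p : X -> R) h k :
  scalar p -> p (h - k) = p h - p k.
Proof.
by move=> lp; have := lp 1 h (- k); rewrite scale1r mul1r scalarN.
Qed.

Lemma bounded_scalar_dual (R : realType) (X : normedModType R) (p : X -> R) (K : R) :
  scalar p -> (forall h, `|p h| <= K * `|h|) -> dual p.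
Proof.
move=> lp pK; split => // y; apply/cvgrPdist_le => eps eps0.
have K1 : 0 < `|K| + 1 by rewrite ltr_wpDl.
near=> z; rewrite -scalarB// (le_trans (pK _))//.
apply: (@le_trans _ _ ((`|K| + 1) * `|y - z|)).
  by rewrite ler_wpM2r// (le_trans (ler_norm _))// lerDl.
rewrite mulrC -ler_pdivlMr//; near: z.
by apply: cvgr_dist_le; [exact: cvg_id|rewrite divr_gt0].
Unshelve. all: by end_near. Qed.

Section clarke_single.
Context {R : realType} {X : normedModType R}.
Variables (f : X -> R) (x : X) (e K : R).
Hypotheses (e0 : 0 < e)
  (lip : forall y y', ball x e y -> ball x e y' -> `|f y - f y'| <= K * `|y - y'|).

Local Notation D := (clarke_dir f x).

Lemma clarke_dir_sublinear : sublinear D.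
Proof.
by split => [h k|a h a0]; [exact: (clarke_dirD e0 lip)|exact: (clarke_dirZ e0 lip)].
Qed.

Lemma clarke_dir_lipschitz h k : `|D h - D k| <= K * `|h - k|.
Proof.
have le1 h' k' : D h' - D k' <= K * `|h' - k'|.
  rewrite lerBlDl -{1}(subrK k' h') addrC (le_trans (clarke_dirD e0 lip _ _))//.
  by rewrite lerD2l (clarke_dir_le e0 lip).
by rewrite ler_norml le1 andbT lerNl opprB distrC le1.
Qed.

Lemma clarke_dir_norm h : `|D h| <= K * `|h|.
Proof.
by have := clarke_dir_lipschitz h 0; rewrite (sublinear0 clarke_dir_sublinear) !subr0.
Qed.

Lemma below_clarke_dir_norm p : scalar p -> (forall h, p h <= D h) ->
  forall h, `|p h| <= K * `|h|.
Proof.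
move=> lp pD h; rewrite ler_norml; apply/andP; split.
  by rewrite lerNl -scalarN// (le_trans (pD _))// (le_trans (clarke_dir_le e0 lip _))// normrN.
by rewrite (le_trans (pD _))// (clarke_dir_le e0 lip).
Qed.

Lemma clarke_subdiffE p :
  clarke_subdiff f x p <-> scalar p /\ forall h, p h <= D h.
Proof.
split=> [[[lp _] pD]|[lp pD]].
  by split=> // h; rewrite -lee_fin (clarke_dirE e0 lip).
split; last by move=> h; rewrite -(clarke_dirE e0 lip) lee_fin.
exact: (bounded_scalar_dual lp (below_clarke_dir_norm lp pD)).
Qed.

(** By Hahn-Banach each value of the directional derivative is attained by some subgradient, and [p]
    is the only one. *)
Lemma clarke_dir_single p : clarke_subdiff f x = [set p] -> D = p.
Proof.
move=> sp; apply/funext => h.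
have [q [lq qD qh]] := hahn_banach h clarke_dir_sublinear.
have : clarke_subdiff f x q by apply/clarke_subdiffE.
by rewrite sp => /= <-.
Qed.

(** The hypothesis makes the directional derivative odd, hence linear, and a linear functional below
    a linear one equals it. Tested on a dense sequence, it becomes a measurable condition on a
    parameter. *)
Lemma clarke_single : (forall h, D h + D (- h) <= 0) -> clarke_subdiff f x = [set D].
Proof.
move=> Dle; have [DD DZ] := clarke_dir_sublinear.
have DN h : D (- h) = - D h.
  have := sublinearN h clarke_dir_sublinear; have := Dle h.
  by move=> h1 h2; apply/le_anti; apply/andP; split; lra.
have lD : scalar D.
  have add h k : D (h + k) = D h + D k.
    apply/le_anti; rewrite DD/=.
    by have := DD (h + k) (- k); rewrite addrK DN => ?; lra.
  move=> a h k; rewrite add; congr (_ + _).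
  have [a0|a0] := leP 0 a; first exact: DZ.
  rewrite -[a]opprK scaleNr DN DZ ?oppr_ge0 ?(ltW a0)//.
  by rewrite !mulNr.
apply/seteqP; split => p; last by move=> ->; apply/clarke_subdiffE.
move=> /clarke_subdiffE[lp pD]; apply/funext => h; apply/le_anti; rewrite pD/=.
by have := pD (- h); rewrite scalarN// DN lerN2.
Qed.

End clarke_single.

Lemma clarke_gradE (R : realType) (X : normedModType R) (f : X -> R) x p :
  clarke_subdiff f x = [set p] -> clarke_grad f x = p.
Proof.
move=> sp; rewrite /clarke_grad; case: xgetP => [q _ /= sq|/(_ p)//].
by have : [set p] q; [rewrite -sp sq|].
Qed.

Lemma clarke_grad_dual (R : realType) (X : normedModType R) (f : X -> R) x :
  dual (clarke_grad f x).
Proof.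
rewrite /clarke_grad; case: xgetP => [p _ /= sp|_]; last first.
  by split; [move=> a h k /=; rewrite mulr0 addr0|move=> h; exact: cvg_cst].
by have : clarke_subdiff f x p; [rewrite sp|case].
Qed.

Lemma card1_set1 T (A : set T) : (A #= `I_1)%card -> exists a, A = [set a].
Proof.
move=> /card_set_bijP[f [fun_f inj_f surj_f]].
have [a Aa _] := surj_f 0%N (ltn0Sn 0).
exists a; apply/seteqP; split => [b Ab|b ->//].
apply: inj_f; rewrite ?inE//.
have h c : A c -> f c = 0%N by move=> /fun_f /=; rewrite ltnS leqn0 => /eqP.
by rewrite !h.
Qed.

(** * Integrals of locally Lipschitz functions *)

Lemma measurable_fun_of_sup d (T : measurableType d) (R : realType) (D : set T)
    (f : nat -> T -> \bar R) (s : T -> R) :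
  (forall k, measurable_fun D (f k)) ->
  (forall x, D x -> (s x)%:E = ereal_sup (range (f ^~ x))) ->
  measurable_fun D s.
Proof.
move=> mf sE; apply/measurable_EFinP.
apply: (eq_measurable_fun (fun x => esups (f ^~ x) 0)); last exact: measurable_fun_esups.
move=> x; rewrite inE => Dx /=; rewrite sE// /esups/=; congr ereal_sup.
by apply/seteqP; split => [_ [k _ <-]|_ [k _ <-]]; exists k.
Qed.

Lemma separable_sequence (R : realType) (X : normedModType R) :
  separable_space X -> exists u : nat -> X, dense (range u).
Proof.
move=> [D /countable_injP[f finj] dD].
exists (fun n => xget 0 [set y | D y /\ f y = n]) => A A0 oA.
have [y [Ay Dy]] := dD _ A0 oA; exists y; split => //.
exists (f y) => //; case: xgetP => [z _ [Dz fz]|/(_ y)]; last by case.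
by apply: finj; rewrite ?inE.
Qed.

Lemma bounded_integrable d (T : measurableType d) (R : realType)
    (mu : probability T R) (S : set T) (f : T -> R) (M : R) :
  measurable S -> measurable_fun S f -> (forall v, S v -> `|f v| <= M) ->
  mu.-integrable S (EFin \o f).
Proof.
move=> mS mf fM; apply: measurable_bounded_integrable => //.
  by rewrite (le_lt_trans (probability_le1 mu mS))// ltry.
exists M; split; first exact: num_real.
by move=> M' MM' v Sv /=; rewrite (le_trans (fM _ Sv))// ltW.
Qed.

Section dense_dual_norm.
Context {R : realType} {X : normedModType R}.
Variables (u : nat -> X) (p : X -> R) (K : R).
Hypotheses (du : dense (range u)) (lp : scalar p) (pK : forall h, `|p h| <= K * `|h|).

(** Turns the norm into a countable supremum, for the sake of measurability. Points of the sequence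
    outside the unit ball are replaced by the origin, which contributes 0. *)
Lemma dual_normE : (dual_norm p)%:E =
  ereal_sup (range (fun k => (`|p (if `|u k| <= 1 then u k else 0)|)%:E)).
Proof.
have p0 : p 0 = 0 by have := scalarB 0 0 lp; rewrite !subrr.
have K1 h : `|h| <= 1 -> `|p h| <= `|K|.
  move=> h1; rewrite (le_trans (pK h))//.
  rewrite (le_trans (ler_wpM2r _ (ler_norm K)))// ler_piMr//.
have ub : has_ubound [set `|p h| | h in [set h : X | `|h| <= 1]].
  by exists `|K| => _ [h /= h1 <-]; exact: K1.
apply/le_anti/andP; split; last first.
  apply: ge_ereal_sup => _ [k _ <-]; rewrite lee_fin; apply: (ub_le_sup ub).
  by eexists; last reflexivity; rewrite /=; case: ifP => //; rewrite normr0.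
set s := ereal_sup _.
have sge k : `|u k| <= 1 -> ((`|p (u k)|)%:E <= s)%E.
  by move=> uk; apply: ereal_sup_ubound; exists k => //; rewrite uk.
suff H h : `|h| <= 1 -> ((`|p h|)%:E <= s)%E.
  have [r sr] : exists r : R, s = r%:E.
    exists (fine s); rewrite fineK// fin_numE; apply/andP; split.
      by apply/eqP => sE; have := H 0; rewrite normr0 p0 normr0 sE leeNy_eq => /(_ ler01).
    have : (s <= `|K|%:E)%E.
      by apply: ge_ereal_sup => _ [k _ <-]; rewrite lee_fin; case: ifP => [/K1//|_]; rewrite p0 normr0.
    by apply: contraTneq => ->; rewrite leye_eq.
  rewrite sr lee_fin; apply: ge_sup; first by exists `|p 0|, 0 => //=; rewrite normr0.
  by move=> _ [h /= h1 <-]; rewrite -lee_fin -sr; exact: H.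
move=> h1; apply/lee_addgt0Pr => eps eps0.
pose eta := eps / (`|K| + 1).
have Kp : 0 < `|K| + 1 by rewrite ltr_wpDl.
have eta0 : 0 < eta by rewrite divr_gt0.
(* [h] may lie on the unit sphere. Shrinking it by the factor [1 - a] gives a point of the open unit
   ball still within [eta] of [h], so density applies to the intersection. *)
pose a := Num.min (eta / 2) 1.
have a0 : 0 < a by rewrite lt_min divr_gt0//=.
have a1 : a <= 1 by rewrite ge_min lexx orbT.
have aeta : a < eta by rewrite gt_min; apply/orP; left; lra.
have [||y [[/= hy y1] [k _ uky]]] := du (O := ball h eta `&` ball 0 1).
- exists ((1 - a) *: h); split; rewrite -ball_normE/=.
    rewrite scalerBl scale1r opprB addrC subrK normrZ (gtr0_norm a0).
    by rewrite (le_lt_trans _ aeta)// ler_piMr// ltW.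
  rewrite sub0r normrN normrZ ger0_norm ?subr_ge0//.
  by rewrite (@le_lt_trans _ _ (1 - a))// ?ler_piMr ?subr_ge0// ltrBlDl ltrDr.
- by apply: openI; exact: ball_open.
move: hy y1; rewrite -!ball_normE/= sub0r normrN -uky => hy /ltW y1.
apply: (@le_trans _ _ (`|p (u k)|%:E + eps%:E)%E); last by rewrite leeD2r// sge.
rewrite -EFinD lee_fin -{1}(subrK (u k) h) addrC.
have -> : p (u k + (h - u k)) = p (u k) + p (h - u k).
  by rewrite scalarB// [u k + _]addrC subrK [RHS]addrC subrK.
rewrite (le_trans (ler_normD _ _))// lerD2l (le_trans (pK _))//.
apply: (@le_trans _ _ ((`|K| + 1) * eta)); last by rewrite mulrC divfK// gt_eqF.
rewrite (le_trans (ler_wpM2r _ (ler_norm K)))// ler_pM// ?lerDl// ltW//.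
Qed.

End dense_dual_norm.

Section clarke_integral.
Context {R : realType} {X : normedModType R} d (V : measurableType d).
Local Notation near_dir x := (filter_prod (nbhs x) (0 : R)^'+).
Variables (mu : probability V R) (S : set V) (E : X -> V -> R) (y0 : X)
  (e K : R) (u : nat -> X).
Hypotheses (mS : measurable S) (muS : mu S = 1%E) (mE : forall y, measurable_fun S (E y))
  (E1 : forall y v, S v -> `|E y v| <= 1) (e0 : 0 < e) (K0 : 0 <= K)
  (lip : forall v, S v -> forall y y', ball y0 e y -> ball y0 e y' ->
    `|E y v - E y' v| <= K * `|y - y'|)
  (du : dense (range u)).

Let phi y := \int[mu]_(v in S) E y v.
Let D v h := clarke_dir (E ^~ v) y0 h.

Let iE y : mu.-integrable S (EFin \o E y).
Proof. exact: bounded_integrable (E1 y). Qed.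

Let phi_lip y y' : ball y0 e y -> ball y0 e y' -> `|phi y - phi y'| <= K * `|y - y'|.
Proof.
move=> by_ by'; rewrite /phi -RintegralB//.
have iB : mu.-integrable S (EFin \o (fun v => E y v - E y' v)).
  apply: (@bounded_integrable _ _ _ _ _ _ (K * `|y - y'|)) => //.
    exact: measurable_funB.
  by move=> v Sv; exact: lip.
apply: (le_trans (le_normr_Rintegral mS iB)).
apply: (@le_trans _ _ (\int[mu]_(v in S) (K * `|y - y'|))); last first.
  by rewrite Rintegral_cst// [X in _ * X <= _](congr1 fine muS) mulr1.
apply: le_Rintegral => //.
- apply: (@bounded_integrable _ _ _ _ _ _ (K * `|y - y'|)) => // [|v Sv].
    by apply: measurableT_comp => //; exact: measurable_funB.
  by rewrite normr_id lip.
- by apply: (@bounded_integrable _ _ _ _ _ _ `|K * `|y - y'| |) => // v _.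
- by move=> v Sv; exact: lip.
Qed.

Section direction.
Variable h : X.

(** The divisor involving the norm of [h] keeps both end points of a [good] segment in the ball of
    radius [e]; [n.+1] makes the neighbourhoods shrink. *)
Let r (n : nat) : R := e / (1 + `|h|) / n.+1%:R.

Let h1 : 0 < 1 + `|h|. Proof. by rewrite ltr_wpDr. Qed.

Let r0 n : 0 < r n. Proof. by rewrite !divr_gt0. Qed.

Let good n (p : X * R) := ball y0 (r n) p.1 /\ 0 < p.2 < r n.

Let r_cvg0 (a : R) : 0 < a -> exists N, forall n, (N <= n)%N -> r n < a.
Proof.
move=> a0; have c0 : 0 < e / (1 + `|h|) / a by rewrite !divr_gt0.
exists (Num.truncn (e / (1 + `|h|) / a)) => n Nn; rewrite /r ltr_pdivrMr// [ltRHS]mulrC -ltr_pdivrMr//.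
by rewrite (lt_le_trans (truncnS_gt _))// ler_nat.
Qed.

Let good_near n : near_dir y0 (good n).
Proof.
exists (ball y0 (r n), [set t | 0 < t < r n]) => /=; last by move=> [y t] [].
split; first exact: nbhsx_ballx.
by exists (r n) => //= t /=; rewrite sub0r normrN => te t0; rewrite t0 (le_lt_trans (ler_norm t)).
Qed.

Let near_good (P : set (X * R)) : near_dir y0 P ->
  exists N, forall n p, (N <= n)%N -> good n p -> P p.
Proof.
move=> [[A B] /= [/nbhs_ballP[a /= a0 aA] [b /= b0 bB]] AB].
have [N HN] : exists N, forall n, (N <= n)%N -> r n < Num.min a b.
  by apply: r_cvg0; rewrite lt_min a0.
exists N => n [y t] /HN; rewrite lt_min => /andP[ra rb] [/= yr /andP[t0 tr]].
apply: AB; split => /=; first by apply: aA; apply: le_ball yr; exact: ltW.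
by apply: bB => //=; rewrite sub0r normrN gtr0_norm// (lt_trans tr).
Qed.

Let good_ball n p : good n p -> ball y0 e p.1 /\ ball y0 e (p.1 + p.2 *: h).
Proof.
move=> [yr /andP[t0 tr]]; have re : r n <= e / (1 + `|h|).
  by rewrite /r ler_pdivrMr// ler_peMr ?divr_ge0 ?(ltW e0) ?(ltW h1)// ler1n.
move: yr; rewrite -!ball_normE/= => yr; split.
  rewrite (lt_le_trans yr)// (le_trans re)// ler_pdivrMr// ler_peMr ?(ltW e0)//.
  by rewrite lerDl.
rewrite opprD addrA (le_lt_trans (ler_normB _ _))// normrZ gtr0_norm//.
apply: (@lt_le_trans _ _ (r n * (1 + `|h|))); last by rewrite -ler_pdivlMr.
by rewrite mulrDr mulr1 ltr_leD// ler_wpM2r// ltW.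
Qed.

Let good_quot n p v : S v -> good n p -> `|diff_quot (E ^~ v) h p| <= K * `|h|.
Proof.
move=> Sv gp; have [b1 b2] := good_ball gp; case: gp => _ /andP[p0 _].
rewrite /diff_quot normrM normfV (gtr0_norm p0) ler_pdivrMr//.
rewrite (le_trans (lip Sv b2 b1))// addrAC subrr add0r normrZ (gtr0_norm p0).
by rewrite mulrAC mulrA.
Qed.

(** The default has step 0 and so is never [good]: codes that decode to nothing are harmless. *)
Let pts (k : nat) : X * R :=
  if unpickle k is Some (n, q) then (u n, ratr q) else (y0, 0).

Let quot_continuous n p v : S v -> good n p ->
  {for p, continuous (diff_quot (E ^~ v) h)}.
Proof.
move=> Sv gp; have [b1 b2] := good_ball gp; case: gp => _ /andP[p0 _].
have cE y : ball y0 e y -> {for y, continuous (E ^~ v)}.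
  move=> yb; apply/cvgrPdist_le => eps eps0.
  have K1 : 0 < K + 1 by rewrite ltr_wpDl.
  have nb : \forall z \near y, ball y0 e z by exact: open_nbhs_nbhs (conj (ball_open _ _) yb).
  near=> z.
  have zb : ball y0 e z by near: z.
  rewrite (le_trans (lip Sv yb zb))//.
  apply: (@le_trans _ _ ((K + 1) * `|y - z|)); first by rewrite ler_wpM2r// lerDl.
  rewrite mulrC -ler_pdivlMr//; near: z.
  by apply: cvgr_dist_le; [exact: cvg_id|rewrite divr_gt0].
apply: cvgM; last by apply: cvgV; [rewrite gt_eqF|exact: cvg_snd].
apply: cvgB; last by apply: (@continuous_comp _ _ _ fst (E ^~ v)); [exact: cvg_fst|exact: cE].
apply: (@continuous_comp _ _ _ (fun p : X * R => p.1 + p.2 *: h) (E ^~ v)); last exact: cE.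
by apply: cvgD; [exact: cvg_fst|apply: cvgZr_tmp; exact: cvg_snd].
Unshelve. all: by end_near. Qed.

Let pts_dense (P : set (X * R)) (p : X * R) : nbhs p P -> exists k, P (pts k).
Proof.
move=> [[A B] /= [nA nB] AB].
have [||y [Ay [n _ uy]]] := du (O := A^°); [by exists p.1|exact: open_interior|].
have [||t [Bt [q _ qt]]] := @dense_rat R B^°; [by exists p.2|exact: open_interior|].
exists (pickle (n, q)); rewrite /pts pickleK; apply: AB; split => /=.
  by rewrite uy; exact: interior_subset.
by rewrite qt; exact: interior_subset.
Qed.

Let good_open n (p : X * R) : good n p -> nbhs p (good n).
Proof.
move=> [b /andP[p0 pr]].
exists (ball y0 (r n), `]0, r n[%classic) => /=.
  split; first exact: open_nbhs_nbhs (conj (ball_open _ _) b).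
  by apply: open_nbhs_nbhs; split; [exact: interval_open|rewrite /= in_itv/= p0].
by move=> [y t] [/= yr]; rewrite in_itv/=.
Qed.

(** Other points count as [-oo], which leaves a supremum over the [good] points of a countable set;
    by continuity and density it dominates the quotient at every [good] point ([Sup_ge]). *)
Let Sup n v := ereal_sup (range (fun k =>
  if `[< good n (pts k) >] then (diff_quot (E ^~ v) h (pts k))%:E else -oo%E)).

Let Sup_ge n p v : S v -> good n p -> ((diff_quot (E ^~ v) h p)%:E <= Sup n v)%E.
Proof.
move=> Sv gp; rewrite leNgt; apply/negP => Slt.
have nq : \forall p' \near p, (Sup n v < (diff_quot (E ^~ v) h p')%:E)%E.
  move: Slt; case: (Sup n v) => [c||] /=.
  - rewrite lte_fin => cq.
    exact: (cvgr_gt _ (quot_continuous Sv gp) _ cq).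
  - by rewrite ltNge leey.
  - by move=> _; apply: (filterS _ (good_open gp)) => p' _; rewrite ltNyr.
have [k [gk qk]] := pts_dense (filterI (good_open gp) nq).
move: qk; rewrite ltNge => /negP; apply; apply: ereal_sup_ubound.
by exists k => //; rewrite asboolT.
Qed.

Let Sup_le n v (c : R) : (forall p, good n p -> diff_quot (E ^~ v) h p <= c) ->
  (Sup n v <= c%:E)%E.
Proof.
move=> H; apply: ge_ereal_sup => _ [k _ <-]; case: asboolP => [gk|_].
  by rewrite lee_fin H.
exact: leNye.
Qed.

Let s n v : R := fine (Sup n v).

Let sE n v : S v -> (s n v)%:E = Sup n v.
Proof.
move=> Sv; rewrite /s fineK// fin_numE; apply/andP; split.
  apply/eqP => SE; have [p gp] := filter_ex (good_near n).
  by have := Sup_ge Sv gp; rewrite SE leeNy_eq.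
have : (Sup n v <= (K * `|h|)%:E)%E.
  by apply: Sup_le => p /(good_quot Sv); rewrite ler_norml => /andP[].
by apply: contraTneq => ->; rewrite leye_eq.
Qed.

Let s_ge n p v : S v -> good n p -> diff_quot (E ^~ v) h p <= s n v.
Proof. by move=> Sv gp; rewrite -lee_fin sE// Sup_ge. Qed.

Let s_le n v c : S v -> (forall p, good n p -> diff_quot (E ^~ v) h p <= c) -> s n v <= c.
Proof. by move=> Sv H; rewrite -lee_fin sE// Sup_le. Qed.

Let s_bound n v : S v -> `|s n v| <= K * `|h|.
Proof.
move=> Sv; rewrite ler_norml; apply/andP; split.
  have [p gp] := filter_ex (good_near n); apply: le_trans (s_ge Sv gp).
  by have := good_quot Sv gp; rewrite ler_norml => /andP[].
by apply: s_le => // p /(good_quot Sv); rewrite ler_norml => /andP[].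
Qed.

Let measurable_quot p : measurable_fun S (fun v => diff_quot (E ^~ v) h p).
Proof. by apply: measurable_funM => //; exact: measurable_funB. Qed.

Let measurable_s n : measurable_fun S (s n).
Proof.
apply: (measurable_fun_of_sup _ (sE n)) => k.
case: asboolP => gk; last exact: measurable_cst.
by apply/measurable_EFinP; exact: measurable_quot.
Qed.

(** The sets [good n] form a base of the filter defining the directional derivative, so the suprema
    over them tend to the upper limit. *)
Let s_cvg v : S v -> s n v @[n --> \oo] --> D v h.
Proof.
move=> Sv; apply/cvgrPdist_le => eps eps0.
have Dlt : (clarke_deriv (E ^~ v) y0 h < (D v h + eps)%:E)%E.
  by rewrite -(clarke_dirE e0 (lip Sv)) lte_fin ltrDl.
have [N HN] := near_good (clarke_lt Dlt).
exists N => // n /= Nn; rewrite ler_norml; apply/andP; split.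
  rewrite lerBrDl lerBlDr; apply: s_le => // p gp.
  by rewrite ltW// (HN n).
rewrite lerBlDr (le_trans (y := s n v)) ?lerDr ?(ltW eps0)//.
rewrite -lee_fin (clarke_dirE e0 (lip Sv)); apply: clarke_le.
by apply: (filterS _ (good_near n)) => p; exact: s_ge.
Qed.

Lemma measurable_clarke_dir : measurable_fun S (fun v => clarke_dir (E ^~ v) y0 h).
Proof. exact: measurable_fun_cvg measurable_s s_cvg. Qed.

Let phi_quot n p : good n p -> diff_quot phi h p <= \int[mu]_(v in S) s n v.
Proof.
move=> gp; have iB : mu.-integrable S (EFin \o (fun v => E (p.1 + p.2 *: h) v - E p.1 v)).
  apply: (@bounded_integrable _ _ _ _ _ _ 2) => //; first exact: measurable_funB.
  move=> v Sv; rewrite (le_trans (ler_normB _ _))//.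
  by rewrite (le_trans (lerD (E1 _ Sv) (E1 _ Sv)))//; lra.
rewrite /diff_quot /phi -RintegralB// -RintegralZr//.
apply: le_Rintegral => //.
- apply: (@bounded_integrable _ _ _ _ _ _ (K * `|h|)) => //; first exact: measurable_quot.
  by move=> v Sv; exact: (good_quot Sv gp).
- by apply: (@bounded_integrable _ _ _ _ _ _ (K * `|h|)) => // v; exact: s_bound.
- by move=> v Sv; exact: (s_ge Sv gp).
Qed.

Let s_int_cvg : \int[mu]_(v in S) s n v @[n --> \oo] --> \int[mu]_(v in S) D v h.
Proof.
have [|||||iD _ c] := @dominated_convergence _ _ _ mu S mS (fun n => EFin \o s n)
  (EFin \o (D ^~ h)) (cst (K * `|h|)%:E).
- by move=> n; apply/measurable_EFinP; exact: measurable_s.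
- by apply/measurable_EFinP; exact: measurable_clarke_dir.
- by apply: aeW => v Sv; apply/fine_cvgP; split; [exact: nearW|exact: s_cvg].
- exact: (@bounded_integrable _ _ _ _ _ (cst (K * `|h|)) `|K * `|h| |).
- by apply: aeW => v n Sv /=; rewrite lee_fin s_bound.
apply: fine_cvg; rewrite fineK//.
exact: integrable_fin_num.
Qed.

(* A quotient of [phi] based in the n-th neighbourhood is at most the integral of
   [s n], which decreases to the directional derivative; by density of [pts] each
   [s n] is a countable supremum, hence measurable. *)
Lemma clarke_dir_integral :
  clarke_dir phi y0 h <= \int[mu]_(v in S) clarke_dir (E ^~ v) y0 h.
Proof.
apply: (cvgr_to_ge s_int_cvg); apply: nearW => n.
rewrite -lee_fin (clarke_dirE e0 phi_lip); apply: clarke_le.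
by apply: (filterS _ (good_near n)) => p; exact: phi_quot.
Qed.

End direction.

Let G v := clarke_grad (E ^~ v) y0.

(** The parameters whose subdifferential is a singleton, written as countably many measurable
    conditions ([B_single], [single_B]). There [clarke_grad] is [D v], elsewhere in [S] the default
    0, so it is measurable in [v]. *)
Let B := \bigcap_(k in [set: nat])
  (S `&` (fun v => D v (u k) + D v (- u k)) @^-1` `]-oo, 0]%classic).

Let measurable_B : measurable B.
Proof.
apply: bigcap_measurable => // k _.
have mk : measurable_fun S (fun v => D v (u k) + D v (- u k)).
  by apply: measurable_funD; exact: measurable_clarke_dir.
by apply: mk => //; exact: measurable_itv.
Qed.

Let B_single v : S v -> B v -> clarke_subdiff (E ^~ v) y0 = [set D v].
Proof.
move=> Sv Bv; apply: (clarke_single e0 (lip Sv)) => h; rewrite -/(D v).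
apply/ler_addgt0Pr => eps eps0; rewrite add0r.
(* [D v] is [K]-Lipschitz, so replacing [h] by [y] in [D v h + D v (- h)] costs at most [2 * K]
   times their distance. *)
have K1 : 0 < 2 * K + 1 by rewrite ltr_wpDl// mulr_ge0.
have [||y [hy [k _ uk]]] := du (O := ball h (eps / (2 * K + 1))).
- by exists h; apply: ballxx; rewrite divr_gt0.
- exact: ball_open.
have [_ /=] := Bv k I; rewrite in_itv/= uk => Dk.
have d1 := clarke_dir_lipschitz e0 (lip Sv) h y.
have d2 := clarke_dir_lipschitz e0 (lip Sv) (- h) (- y).
rewrite -/(D v) in d1 d2.
move: d2; rewrite -opprD normrN -/(h - y) => d2.
have hye : (2 * K + 1) * `|h - y| <= eps.
  by move: hy; rewrite -ball_normE/= ltr_pdivlMr// mulrC => /ltW.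
have n0 := normr_ge0 (h - y).
move: d1 d2; rewrite !ler_norml => /andP[_ d1] /andP[_ d2].
rewrite /D in Dk; rewrite mulrDl mul1r -mulrA in hye.
by move: Dk hye d1 d2 n0; set Kn := K * `|h - y|; lra.
Qed.

Let single_B v : S v -> forall p, clarke_subdiff (E ^~ v) y0 = [set p] -> B v.
Proof.
move=> Sv p sp k _; split => //=; rewrite in_itv/= /D.
rewrite (clarke_dir_single e0 (lip Sv) sp).
have lp : scalar p by have : clarke_subdiff (E ^~ v) y0 p; [rewrite sp|move=> [[]]].
by rewrite scalarN// subrr.
Qed.

Let GE v h : S v -> G v h = D v h * \1_B v.
Proof.
move=> Sv; rewrite indicE; have [Bv|nBv] := pselect (B v).
  by rewrite mem_set//= mulr1 /G (clarke_gradE (B_single Sv Bv)).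
rewrite memNset//= mulr0 /G /clarke_grad; case: xgetP => // p _ /= sp.
by case: nBv; exact: single_B sp.
Qed.

Lemma measurable_clarke_grad h : measurable_fun S (fun v => G v h).
Proof.
apply: (eq_measurable_fun (fun v => D v h * \1_B v)).
  by move=> v; rewrite inE => Sv; rewrite GE.
apply: measurable_funM; first exact: measurable_clarke_dir.
exact: measurable_indic.
Qed.

Lemma clarke_grad_bound v h : S v -> `|G v h| <= K * `|h|.
Proof.
move=> Sv; rewrite GE// normrM (le_trans (y := `|D v h|))//.
  by rewrite ler_piMr// indicE; case: (_ \in _); rewrite ?normr1 ?normr0.
exact: (clarke_dir_norm e0 (lip Sv)).
Qed.

Let iG h : mu.-integrable S (EFin \o (fun v => G v h)).
Proof.
apply: (@bounded_integrable _ _ _ _ _ _ (K * `|h|)) => //.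
  exact: measurable_clarke_grad.
by move=> v; exact: clarke_grad_bound.
Qed.

Let p h := \int[mu]_(v in S) G v h.

Let scalar_p : scalar p.
Proof.
move=> a h k; rewrite /p -RintegralZl// -RintegralD//; last first.
  exact: (integrableZl mS a (iG h)).
by apply: eq_Rintegral => v _; have [lG _] := clarke_grad_dual (E ^~ v) y0; exact: lG.
Qed.

Let p_bound h : `|p h| <= K * `|h|.
Proof.
apply: (le_trans (le_normr_Rintegral mS (iG h))).
apply: (@le_trans _ _ (\int[mu]_(v in S) (K * `|h|))); last first.
  by rewrite Rintegral_cst// [X in _ * X <= _](congr1 fine muS) mulr1.
apply: le_Rintegral => //.
- apply: (@bounded_integrable _ _ _ _ _ _ (K * `|h|)) => // [|v Sv].
    by apply: measurableT_comp => //; exact: measurable_clarke_grad.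
  by rewrite normr_id clarke_grad_bound.
- by apply: (@bounded_integrable _ _ _ _ _ _ `|K * `|h| |) => // v _.
- by move=> v; exact: clarke_grad_bound.
Qed.

Lemma dual_integral_clarke_grad : dual_integral mu S G p.
Proof.
split; last by move=> h; split; [exact: iG|].
have lG v : scalar (G v) by have [] := clarke_grad_dual (E ^~ v) y0.
have Gb v Sv h := @clarke_grad_bound v h Sv.
have mG : measurable_fun S (fun v => dual_norm (G v)).
  apply: (@measurable_fun_of_sup _ _ _ _ (fun k v =>
    (`|G v (if `|u k| <= 1 then u k else 0)|)%:E)).
    move=> k; apply/measurable_EFinP; apply: measurableT_comp => //.
    exact: measurable_clarke_grad.
  by move=> v Sv; rewrite (dual_normE du (lG v) (Gb v Sv)).
apply: (@bounded_integrable _ _ _ _ _ (fun v => dual_norm (G v)) K) => // v Sv.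
rewrite ger0_norm.
  apply: ge_sup; first by exists `|G v 0|, 0 => //=; rewrite normr0.
  by move=> _ [h /= h1 <-]; rewrite (le_trans (Gb v Sv h))// ler_piMr.
apply: (le_trans (normr_ge0 (G v 0))); apply: ub_le_sup.
  by exists K => _ [h /= h1 <-]; rewrite (le_trans (Gb v Sv h))// ler_piMr.
by exists 0 => //=; rewrite normr0.
Qed.

Hypothesis hstar : {ae mu, forall v, S v ->
  (clarke_subdiff (E ^~ v) y0 #= `I_1)%card}.

Let p_below h : clarke_dir phi y0 h <= p h.
Proof.
apply: (le_trans (clarke_dir_integral h)); rewrite /p /Rintegral.
rewrite le_eqVlt; apply/orP; left; apply/eqP; congr fine.
apply: ae_eq_integral => //.
- by apply/measurable_EFinP; exact: measurable_clarke_dir.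
- by apply/measurable_EFinP; exact: measurable_clarke_grad.
apply: filterS hstar => v Hv Sv; have [q sq] := card1_set1 (Hv Sv).
by rewrite /G (clarke_gradE sq) -(clarke_dir_single e0 (lip Sv) sq).
Qed.

(** For a single [h] this is [clarke_linear_near]. Quotients and [p] are both [K]-Lipschitz in the
    direction, so the estimate extends to a neighbourhood of [h], and compactness of [C] selects
    neighbourhoods of the base point and of the step common to all directions. *)
Lemma strict_derivative_integral : strict_derivative phi y0 p.
Proof.
split; first exact: (bounded_scalar_dual scalar_p p_bound).
move=> C /compact_near_coveringP cC eps eps0.
have := cC (X * R)%type (near_dir y0) (fun q h => `|diff_quot phi h q - p h| < eps).
apply => h Ch.
have e2 : 0 < eps / 2 by rewrite divr_gt0.
have n1 := clarke_linear_near e0 phi_lip scalar_p p_below h e2.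
have K1 : 0 < 2 * K + 1 by rewrite ltr_wpDl// mulr_ge0.
(* Both Lipschitz errors together fit into [eps / 2]; the bound 1 keeps the norm of [h'] within the
   margin that [inb] allows. *)
pose delta := Num.min 1 (eps / 2 / (2 * K + 1)).
have delta0 : 0 < delta by rewrite lt_min ltr01 divr_gt0.
have h2 : 0 < `|h| + 2 by rewrite ltr_wpDl.
have e20 : 0 < e / 2 by rewrite divr_gt0.
have tau0 : 0 < e / 2 / (`|h| + 2) by rewrite divr_gt0.
have n2 : near_dir y0 (fun q => ball y0 (e / 2) q.1 /\ 0 < q.2 < e / 2 / (`|h| + 2)).
  exists (ball y0 (e / 2), [set t | 0 < t < e / 2 / (`|h| + 2)]) => /=; last by move=> [y t] [].
  split; first exact: nbhsx_ballx.
  exists (e / 2 / (`|h| + 2)) => //= t /=.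
  by rewrite sub0r normrN => te t0; rewrite t0 (le_lt_trans (ler_norm t)).
exists (ball h delta, fun q => `|diff_quot phi h q - p h| < eps / 2 /\
    (ball y0 (e / 2) q.1 /\ 0 < q.2 < e / 2 / (`|h| + 2))) => /=.
  by split; [exact: nbhsx_ballx|exact: filterI].
move=> [h' [y t]] [/= hh' [qh [yb /andP[t0 tt]]]].
move: hh'; rewrite -ball_normE/= lt_min => /andP[hh1 hh2].
have inb k : `|k| <= `|h| + 2 -> ball y0 e (y + t *: k).
  move=> k2; move: yb; rewrite -!ball_normE/= => yb.
  rewrite opprD addrA (le_lt_trans (ler_normB _ _))// normrZ gtr0_norm//.
  have : t * `|k| <= e / 2.
    rewrite ltr_pdivlMr// in tt; apply: le_trans (ltW tt).
    by rewrite ler_wpM2l// ltW.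
  by move: yb; set a := `|y0 - y|; lra.
have b1 : ball y0 e (y + t *: h) by apply: inb; rewrite lerDl.
have b2 : ball y0 e (y + t *: h').
  apply: inb; rewrite -(subrK h h') (le_trans (ler_normD _ _))// addrC lerD2l.
  by rewrite distrC (le_trans (ltW hh1))// ler1n.
have q12 : `|diff_quot phi h' (y, t) - diff_quot phi h (y, t)| <= K * `|h - h'|.
  rewrite /diff_quot/= -mulrBl opprB addrA subrK normrM normfV (gtr0_norm t0).
  rewrite ler_pdivrMr// (le_trans (phi_lip b2 b1))//.
  by rewrite opprD addrACA subrr add0r -scalerBr normrZ (gtr0_norm t0) distrC mulrCA mulrC.
have p12 : `|p h - p h'| <= K * `|h - h'| by rewrite -scalarB// p_bound.
have small : (2 * K + 1) * `|h - h'| < eps / 2 by rewrite mulrC -ltr_pdivlMr.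
rewrite mulrDl mul1r -mulrA in small.
have n0 := normr_ge0 (h - h').
move: q12 p12 qh small n0; rewrite !ler_norml !ltr_norml.
set Kn := K * `|h - h'|; set q1 := diff_quot _ _ _; set q2 := diff_quot _ _ _.
move=> /andP[a1 a2] /andP[a3 a4] /andP[a5 a6] a7 a8.
by apply/andP; split; lra.
Qed.

End clarke_integral.

(** * Finite-dimensional spaces *)

Section compact_unit_ball.
Context {R : realType} {X : normedModType R}.

Definition spans n (b : 'I_n -> X) :=
  forall h : X, exists c : 'I_n -> R, h = \sum_(i < n) c i *: b i.

Let T n (b : 'I_n -> X) (c : 'rV[R]_n) := \sum_(i < n) c 0 i *: b i.

Let T_continuous n (b : 'I_n -> X) : continuous (T b).
Proof.
apply: continuous_big => [|i _]; first exact: add_continuous.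
move=> c; apply: (@continuous_comp _ _ _ (fun c : 'rV[R]_n => c 0 i) (fun a : R => a *: b i)).
  exact: coord_continuous.
by apply: cvgZr_tmp; exact: cvg_id.
Qed.

(** A spanning family of least size is independent: in a relation with nonzero coefficient at [j],
    [b j] is a combination of the others and could be dropped. *)
Lemma minimal_spanning : finite_dimensional X ->
  exists n (b : 'I_n -> X), spans b /\ forall c, T b c = 0 -> c = 0.
Proof.
move=> [n0 [b0 sb0]].
have ex : exists n, `[< exists b : 'I_n -> X, spans b >].
  by exists n0; apply/asboolP; exists b0.
case: (ex_minnP ex) => n /asboolP[b sb] nmin.
exists n, b; split => // c Tc; apply/rowP => j; rewrite mxE.
apply/eqP; apply: contraT => cj.
case: n b sb nmin c Tc j cj => [|n] b sb nmin c Tc j cj; first by case: j cj.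
have : (n.+1 <= n)%N; last by rewrite ltnn.
apply: nmin; apply/asboolP; exists (b \o lift j) => h.
have [d ->] := sb h.
exists (fun i => d (lift j i) - d j * c 0 (lift j i) / c 0 j).
rewrite (bigD1_ord j)//=.
have bj : b j = - (\sum_(i < n) (c 0 (lift j i) / c 0 j) *: b (lift j i)).
  move: Tc; rewrite /T (bigD1_ord j)//= => /eqP; rewrite addr_eq0 => /eqP Tc.
  rewrite -[LHS](scalerK cj) Tc scalerN scaler_sumr; congr (- _).
  by apply: eq_bigr => i _; rewrite scalerA mulrC.
rewrite bj scalerN scaler_sumr -sumrN -big_split/=; apply: eq_bigr => i _.
by rewrite scalerA mulrA scalerBl addrC.
Qed.

(** By independence the norm of [T b c] stays above some positive [t] on the compact unit sphere of
    coefficients, so the unit ball lies in the image of the coefficient ball of radius [t^-1]. *)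
Lemma compact_unit_ball : finite_dimensional X -> compact [set h : X | `|h| <= 1].
Proof.
move=> /minimal_spanning[n [b [sb indb]]].
have cS : compact [set c : 'rV[R]_n | `|c| = 1].
  apply: bounded_closed_compact.
    by exists 1; split => // M M1 c /= ->; exact: ltW.
  by apply: closed_comp (@closed_eq R 1) => c _; exact: norm_continuous.
have [t t0 tS] : exists2 t : R, 0 < t & forall c, `|c| = 1 -> t < `|T b c|.
  have near_t : \forall t \near (0 : R)^'+,
      [set c : 'rV[R]_n | `|c| = 1] `<=` (fun c => t < `|T b c|).
    move/compact_near_coveringP: cS => /(_ R (0 : R)^'+ (fun t c => t < `|T b c|)); apply.
    move=> c c1; have Tc0 : 0 < `|T b c|.
      rewrite normr_gt0; apply/eqP => /indb c0; move: c1.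
      by rewrite /= c0 normr0 => /esym/eqP; rewrite oner_eq0.
    have half : `|T b c| / 2 < `|T b c| by lra.
    have cN : {for c, continuous (fun c => `|T b c|)}.
      apply: (@continuous_comp _ _ _ (T b) Num.norm); first exact: T_continuous.
      exact: norm_continuous.
    exists ([set c' : 'rV[R]_n | `|T b c| / 2 < `|T b c'|], [set t | t < `|T b c| / 2]) => /=.
      split; first exact: (cvgr_gt _ cN _ half).
      by apply: nbhs_right_lt; rewrite divr_gt0.
    by move=> [c' t] [/= h1 h2]; exact: lt_trans h1.
  have [t [tS t0]] := filter_ex (filterI near_t (nbhs_right_gt (0 : R))).
  by exists t => // c; exact: tS.
have cB : compact [set c : 'rV[R]_n | `|c| <= t^-1].
  apply: bounded_closed_compact.
    by exists t^-1; split; [exact: num_real|move=> M M1 c /= /le_trans; apply; exact: ltW].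
  by apply: closed_comp (@closed_le R t^-1) => c _; exact: norm_continuous.
have cI : compact (T b @` [set c : 'rV[R]_n | `|c| <= t^-1]).
  by apply: continuous_compact cB; apply: continuous_subspaceT; exact: T_continuous.
apply: (subclosed_compact _ cI).
  by apply: closed_comp (@closed_le R 1) => c _; exact: norm_continuous.
move=> h /= h1; have [d hd] := sb h.
exists (\row_i d i); last first.
  by rewrite hd /T; apply: eq_bigr => i _; rewrite mxE.
set c := \row_i d i => /=.
have Tc : T b c = h by rewrite hd /T; apply: eq_bigr => i _; rewrite mxE.
have [c0|c0] := eqVneq c 0; first by rewrite c0 normr0 invr_ge0 ltW.
have cp : 0 < `|c| by rewrite normr_gt0.
have := tS (`|c|^-1 *: c); rewrite normrZ normfV normr_id mulVf ?gt_eqF// => /(_ erefl).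
have -> : T b (`|c|^-1 *: c) = `|c|^-1 *: T b c.
  by rewrite /T scaler_sumr; apply: eq_bigr => i _; rewrite mxE scalerA.
rewrite Tc normrZ normfV normr_id mulrC ltr_pdivlMr// => tc.
rewrite -[_^-1]mul1r ler_pdivlMr// mulrC (le_trans (ltW tc))//.
Qed.

End compact_unit_ball.

Section strict_C1.
Context {R : realType} {X : normedModType R}.
Hypothesis cB : compact [set h : X | `|h| <= 1].

(** Compactness of the unit ball makes the convergence uniform over unit directions. A nonzero
    increment [k] is its norm times such a direction, which yields the Frechet remainder. *)
Lemma strict_derivative_diff (f : X -> R^o) y p : strict_derivative f y p ->
  differentiable f y /\ 'd f y = p :> (X -> R).
Proof.
move=> [[lp cp] sp].
pose df : {linear X -> R^o} := HB.pack p (GRing.isLinear.Build _ _ _ _ p lp).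
have fE : f \o shift y = cst (f y) + df +o_ 0 id.
  apply/eqaddoP => eps eps0.
  have [[A B] /= [nA [r /= r0 rB]] AB] := sp _ cB eps eps0.
  have Ay : A y by exact: nbhs_singleton.
  have nr : \forall k \near (0 : X), ball 0 r k by exact: nbhsx_ballx.
  apply: filterS nr => k; rewrite -ball_normE/= sub0r normrN => kr.
  rewrite [X in `|X|](_ : _ = f (k + y) - f y - p k); last by rewrite opprD addrA.
  have [->|k0] := eqVneq k 0.
    have p0 : p 0 = 0 by have := scalarB 0 0 lp; rewrite !subrr.
    by rewrite add0r subrr p0 subr0 !normr0 mulr0.
  have kp : 0 < `|k| by rewrite normr_gt0.
  have Bk : B `|k| by apply: rB => //=; rewrite sub0r normrN normr_id.
  have /= := AB (y, `|k|) (conj Ay Bk) (`|k|^-1 *: k).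
  rewrite normrZ normfV normr_id mulVf ?gt_eqF// => /(_ (lexx _)).
  rewrite scalerA mulfV ?gt_eqF// scale1r [y + k]addrC.
  have -> : p (`|k|^-1 *: k) = p k / `|k|.
    have p0 : p 0 = 0 by have := scalarB 0 0 lp; rewrite !subrr.
    by have := lp `|k|^-1 k 0; rewrite !addr0 p0 addr0 mulrC.
  rewrite -mulrBl normrM normfV normr_id ltr_pdivrMr//.
  exact: ltW.
have dE : 'd f y = df :> (X -> R^o) by apply: diff_unique.
split => //; apply/diff_locallyP; rewrite dE; split => //.
Qed.

(** At a common base point [z] and a common small step, the quotient is within [eps] of [p] by
    strictness at [y] and within any [eta] of [q] by strictness at [z]. *)
Lemma strict_derivative_near (f : X -> R) y p (eps : R) : 0 < eps ->
  strict_derivative f y p -> \forall z \near y, forall q, strict_derivative f z q ->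
    forall h, `|h| <= 1 -> `|q h - p h| <= eps.
Proof.
move=> eps0 [_ sp].
have [[A B] /= [nA nB] AB] := sp _ cB eps eps0.
apply: filterS nA => z Az q [_ sq] h h1.
apply/ler_addgt0Pr => eta eta0.
have [[A' B'] /= [nA' nB'] AB'] := sq _ cB eta eta0.
have [t [Bt B't]] := filter_ex (filterI nB nB').
have /= := AB (z, t) (conj Az Bt) h h1.
have /= := AB' (z, t) (conj (nbhs_singleton nA') B't) h h1.
set D := (_ - _) / t; rewrite distrC => h2 h3.
have -> : q h - p h = (q h - D) + (D - p h) by rewrite addrA subrK.
by rewrite (le_trans (ler_normD _ _))// [eps + eta]addrC lerD ?ltW.
Qed.

Lemma strict_derivative_C1 (f : X -> R^o) x :
  (\forall y \near x, exists p, strict_derivative f y p) ->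
  continuously_differentiable_at f x.
Proof.
move=> /nbhs_interior; apply: filterS => y ny.
have [p sp] := nbhs_singleton ny.
have [dy dyE] := strict_derivative_diff sp; split => //.
apply/cvgrPdist_le => eps eps0.
apply: filterS2 ny (strict_derivative_near eps0 sp) => z [q sq] Hz.
have [_ dzE] := strict_derivative_diff sq.
have qp := Hz q sq.
rewrite sub0r normrN dyE dzE.
have n0 : 0 <= dual_norm (fun h => q h - p h).
  apply: (le_trans (normr_ge0 (q 0 - p 0))); apply: ub_le_sup.
    by exists eps => _ [h /= h1 <-]; exact: qp.
  by exists 0 => //=; rewrite normr0.
rewrite ger0_norm//; apply: ge_sup.
  by exists `|q 0 - p 0|, 0 => //=; rewrite normr0.
by move=> _ [h /= h1 <-]; exact: qp.
Qed.

End strict_C1.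

Theorem proposition6 (R : realType) (X : completeNormedModType R)
    (hsep : separable_space X) (hrefl : reflexive_space X)
    (m : nat) (hm : (0 < m)%N)
    (g : X -> 'cV[R]_m -> R)
    (glip : locally_lipschitz (fun p : X * 'cV[R]_m => g p.1 p.2))
    (gconv : forall x : X, convex_function [set: convex_lmodType 'cV[R]_m] (g x))
    (Sigma L : 'M[R]_m) (hSigma : correlation_matrix Sigma)
    (hL : L \in unitmx) (hSL : Sigma = L *m L^T)
    (d : measure_display) (Omega : measurableType d) (P : probability Omega R)
    (xi : {RV P >-> borel_cV m})
    (hxi : centered_normal Sigma (distribution P xi))
    (mu : probability (borel_cV m) R) (hmu : uniform_on_sphere mu)
    (x : X) (gx0 : g x 0 < 0)
    (hgrowth : bounded_set [set z : 'cV[R]_m | g x z <= 0] \/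
               exists l : R, 0 < l /\ nice_directions g L l x = [set: X])
    (hstar : ae_single_subgradient g L mu x) :
  (exists D : X -> R,
     strict_derivative (prob_fun g P xi) x D /\
     dual_integral mu sphere
       (fun v => clarke_grad (radial_prob g L ^~ v) x) D) /\
  (finite_dimensional X ->
   (\forall x' \near x, ae_single_subgradient g L mu x') ->
   continuously_differentiable_at (prob_fun g P xi) x).
Proof.
have [u du] := separable_sequence hsep.
have cg y : continuous (g y) by exact: locally_lipschitz_continuousr.
have chi1 : @chi_prob R m setT = 1%E.
  by have [M [gamma [_ Hg _]]] := hxi; exact: chi_prob_setT Hg hm.
have [e [C [e0 C0 lip]]] := radial_prob_lipschitz glip gconv gx0 hm hL hgrowth chi1.
have phiE : prob_fun g P xi = fun y => \int[mu]_(v in sphere) radial_prob g L y v.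
  by apply/funext => y; exact: (prob_fun_polar hm hL hSL hxi hmu (cg y)).
have mE y : measurable_fun (sphere : set (@borel_cV R m)) (radial_prob g L y).
  apply: measurable_funTS; exact: (measurable_radial_prob L hm hxi (cg y)).
have E1 y (v : borel_cV m) : sphere v -> `|radial_prob g L y v| <= 1.
  by move=> _; have /andP[h0 h1] := radial_prob_itv L hm hxi (cg y) v; rewrite ger0_norm.
(* The growth condition at [x] yields a Lipschitz bound on a whole ball, which can be recentred at
   every [y] in it with the same [C]. *)
have key y : ball x e y -> exists e' : R, 0 < e' /\
    forall v : borel_cV m, sphere v -> forall z z', ball y e' z -> ball y e' z' ->
    `|radial_prob g L z v - radial_prob g L z' v| <= C * `|z - z'|.
  move=> xy; have /nbhs_ballP[e' /= e'0 sub] : nbhs y (ball x e).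
    by apply: open_nbhs_nbhs; split; [exact: ball_open|].
  by exists e'; split => // v Sv z z' /sub xz /sub xz'; exact: lip.
have msphere := @measurable_sphere R m.
have strict y : ball x e y -> ae_single_subgradient g L mu y ->
    strict_derivative (prob_fun g P xi) y
      (fun h => \int[mu]_(v in sphere) clarke_grad (radial_prob g L ^~ v) y h).
  move=> /key[e' [e'0 lip']] hy; rewrite phiE.
  exact: (strict_derivative_integral msphere hmu.1 mE E1 e'0 C0 lip' du hy).
split.
  exists (fun h => \int[mu]_(v in sphere) clarke_grad (radial_prob g L ^~ v) x h).
  split; first by apply: strict => //; exact: ballxx.
  have [e' [e'0 lip']] := key x (ballxx x e0).
  exact: (dual_integral_clarke_grad mu msphere mE e'0 C0 lip' du).
move=> /compact_unit_ball cB near_star; apply: (strict_derivative_C1 cB).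
apply: filterS2 (nbhsx_ballx x e e0) near_star => y xy hy.
by eexists; exact: strict.
Qed.
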